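(* Let $U$ be an open balanced subset of a complex Banach space $E$. Then $\widehat U_{\mathcal P(E)}$ is the $H_b$-envelope of holomorphy of $U$ (via the inclusion $U\hookrightarrow\widehat U_{\mathcal P(E)}$). Moreover, any $f\in H_b(U)$ extends to a holomorphic function $\tilde f$ on $\widehat U_{\mathcal P(E)}$ which is bounded on $\widehat A_{\mathcal P(E)}$ for every $U$-bounded set $A$. Also, for every $U$-bounded set $A$ and every $z\in\widehat A_{\mathcal P(E)}$ we have $\delta_z\prec A$.
   Context: $\mathcal P(E)$ is the space of all continuous polynomials $E\to\mathbb C$. A set $A\subset U$ is $U$-bounded if it is bounded and has positive distance to $E\setminus U$ (no distance condition if $U=E$). $H_b(U)$ is the Fréchet algebra of holomorphic functions on $U$ bounded on every $U$-bounded set, with the topology of uniform convergence on $U$-bounded sets; $\|f\|_A=\sup_A|f|$. $M_b(U)$ is the set of nonzero continuous linear multiplicative functionals on $H_b(U)$; $\varphi\prec A$ means $|\varphi(f)|\le\|f\|_A$ for all $f\in H_b(U)$. For a $U$-bounded set $A$, $\widehat A_{\mathcal P(E)}=\{x\in E:|P(x)|\le\|P\|_A\ \forall P\in\mathcal P(E)\}$. The hull of the open set $U$ is $\widehat U_{\mathcal P(E)}=\bigcup_n\widehat{(U_n)}_{\mathcal P(E)}$, where $(U_n)_n$ is a fundamental sequence of $U$-bounded sets (every $U$-bounded set is contained in some $U_n$), e.g. $U_n=\{x\in U:\mathrm{dist}(x,E\setminus U)\ge 1/n,\ \|x\|\le n\}$. The set $\widehat U_{\mathcal P(E)}$ is open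 and contains $U$. For $z\in \widehat U_{\mathcal P(E)}$, $\delta_z$ denotes the unique element of $M_b(U)$ with $\delta_z(P)=P(z)$ for all $P\in\mathcal P(E)$ (unique because polynomials are dense in $H_b(U)$ for balanced $U$). A Riemann domain $(X,p)$ over $E$ is a Hausdorff space $X$ with a local homeomorphism $p:X\to E$; open subsets of $E$ are Riemann domains with $p$ the inclusion. A morphism $(X,p)\to(Y,q)$ is a continuous $\tau:X\to Y$ with $q\circ\tau=p$. A morphism $\tau:U\to Y$ is an $H_b$-extension of $U$ if for each $f\in H_b(U)$ there is a unique holomorphic $\tilde f$ on $Y$ with $\tilde f\circ\tau=f$; it is an $H_b$-envelope of holomorphy of $U$ if it is an $H_b$-extension and for each $H_b$-extension $\nu:U\to Z$ there is a morphism $\mu:Z\to Y$ with $\mu\circ\nu=\tau$. *)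

(* Defs.v *)
From HB Require Import structures.
From mathcomp Require Import all_boot all_order all_algebra complex.
From mathcomp Require Import all_classical all_reals all_analysis.

Set Implicit Arguments.
Unset Strict Implicit.
Unset Printing Implicit Defensive.

Import Order.TTheory GRing.Theory Num.Theory.
Import numFieldNormedType.Exports.

Local Open Scope classical_set_scope.
Local Open Scope ring_scope.

(* The normed module structure of the complex field over itself is only inferred
   on the regular module R[i]^o. *)
Notation C R := (R[i]^o).

(* The norm of a normed module over R[i] takes its values in R[i]; [rnorm] is
   the same number as an element of R. *)
Definition rnorm (R : realType) (V : normedModType R[i]) (x : V) : R :=
  complex.Re `|x|.

(* Takes the value -oo when A is empty. *)
Definition esupnorm (R : realType) (T : Type) (f : T -> C R) (A : set T) :
    \bar R :=
  ereal_sup [set (rnorm (f x))%:E | x in A].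

Section Polynomials.
Variables (R : realType) (E : normedModType R[i]).

(* Multilinear forms are purely algebraic: continuity is required of the
   polynomial as a whole, in [continuous_polynomial]. *)
Definition multilinear_form (k : nat) (L : ('I_k -> E) -> C R) : Prop :=
  forall (v : 'I_k -> E) (i : 'I_k), linear (fun x : E => L (dfwith v i x)).

Definition homogeneous_polynomial (k : nat) (P : E -> C R) : Prop :=
  exists2 L : ('I_k -> E) -> C R, multilinear_form L &
    forall x : E, P x = L (fun _ => x).

Definition polynomial_map (P : E -> C R) : Prop :=
  exists (m : nat) (Q : nat -> E -> C R),
    (forall k, homogeneous_polynomial k (Q k)) /\
    forall x : E, P x = \sum_(k < m) Q k x.

Definition continuous_polynomial (P : E -> C R) : Prop :=
  polynomial_map P /\ continuous P.

End Polynomials.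

Section RiemannDomains.
Variables (R : realType) (E : normedModType R[i]).

Definition chart (X : topologicalType) (p : X -> E) (V : set X) : Prop :=
  [/\ open V, {in V &, injective p}, {in V, continuous p} &
      forall W : set X, open W -> W `<=` V -> open (p @` W)].

Definition riemann_domain (X : topologicalType) (p : X -> E) : Prop :=
  hausdorff_space X /\ forall x : X, exists2 V, V x & chart p V.

(* [g] extends to E, arbitrarily outside [p @` V], the composite of [f] with the
   inverse of the homeomorphism [p : V -> p @` V]. *)
Definition holomorphic (X : topologicalType) (p : X -> E) (f : X -> C R) :
    Prop :=
  forall V : set X, chart p V ->
    exists2 g : E -> C R, forall y, V y -> f y = g (p y) &
      forall y, V y -> differentiable g (p y).

Definition morphism (X Y : topologicalType) (p : X -> E) (q : Y -> E)
    (t : X -> Y) : Prop :=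
  continuous t /\ q \o t = p.

End RiemannDomains.

Section Hb.
Variables (R : realType) (E : normedModType R[i]) (U : set E).

Definition Ubounded (A : set E) : Prop :=
  [/\ A `<=` U, bounded_set A &
      exists2 r : R[i], 0 < r & forall x y, A x -> ~ U y -> r <= `|x - y|].

Definition Ubounded_sub (A : set U) : Prop := Ubounded (set_val @` A).

Definition is_Hb (f : U -> C R) : Prop :=
  holomorphic (set_val : U -> E) f /\
  forall A : set U, Ubounded_sub A -> [bounded f u | u in A].

Definition Hb_pred : {pred (U -> C R)} := [pred f | `[< is_Hb f >]].

Lemma holomorphic_cst (X : topologicalType) (p : X -> E) (c : C R) :
  holomorphic p (fun _ => c).
Proof. by move=> V _; exists (cst c) => // y _; exact: differentiable_cst. Qed.

Lemma holomorphicD (X : topologicalType) (p : X -> E) (f h : X -> C R) :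
  holomorphic p f -> holomorphic p h -> holomorphic p (f + h).
Proof.
move=> hf hh V cV; have [g fg dg] := hf V cV; have [l hl dl] := hh V cV.
exists (g + l) => y Vy; first by rewrite !fctE fg// hl.
by apply: differentiableD; [exact: dg | exact: dl].
Qed.

Lemma holomorphicM (X : topologicalType) (p : X -> E) (f h : X -> C R) :
  holomorphic p f -> holomorphic p h -> holomorphic p (f * h).
Proof.
move=> hf hh V cV; have [g fg dg] := hf V cV; have [l hl dl] := hh V cV.
exists (g * l) => y Vy; first by rewrite !fctE fg// hl.
by apply: differentiableM; [exact: dg | exact: dl].
Qed.

Lemma bounded_inP (T : Type) (f : T -> C R) (A : set T) :
  [bounded f u | u in A] <-> exists M : R, forall u, A u -> `|f u| <= M%:C%C.
Proof.
split.
- move=> [M [Mreal HM]].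
  have : M < M + 1 by rewrite ltrDl.
  move=> /HM AM.
  have Mr : M + 1 \is Num.real by rewrite realD.
  exists (complex.Re (M + 1)) => u Au.
  suff -> : ((complex.Re (M + 1))%:C%C = M + 1) by exact: AM.
  by apply: RRe_real.
- move=> [M HM]; exists M%:C%C; split; first by rewrite complex_real.
  by move=> x Mx u Au; exact: le_trans (HM u Au) (ltW Mx).
Qed.

Lemma is_Hb_cst (c : C R) : is_Hb (fun _ => c).
Proof.
split; first exact: holomorphic_cst.
move=> A _; apply/bounded_inP; exists (complex.Re `|c|) => u _.
by rewrite RRe_real.
Qed.

Lemma is_HbD (f h : U -> C R) : is_Hb f -> is_Hb h -> is_Hb (f + h).
Proof.
move=> [hf bf] [hh bh]; split; first exact: holomorphicD.
move=> A uA; apply/bounded_inP.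
have /bounded_inP[M HM] := bf A uA; have /bounded_inP[N HN] := bh A uA.
exists (M + N) => u Au; rewrite fctE rmorphD/=.
by rewrite (le_trans (ler_normD _ _))// lerD ?HM ?HN.
Qed.

Lemma is_HbM (f h : U -> C R) : is_Hb f -> is_Hb h -> is_Hb (f * h).
Proof.
move=> [hf bf] [hh bh]; split; first exact: holomorphicM.
move=> A uA; apply/bounded_inP.
have /bounded_inP[M HM] := bf A uA; have /bounded_inP[N HN] := bh A uA.
exists (M * N) => u Au; rewrite fctE rmorphM/= normrM.
by rewrite ler_pM ?HM ?HN.
Qed.

Lemma Hb_subring_closed : subring_closed Hb_pred.
Proof.
split; first by apply/asboolP; exact: is_Hb_cst.
- move=> f h /asboolP hf /asboolP hh; apply/asboolP.
  rewrite (_ : f - h = f + (fun _ => -1) * h).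
    by apply: is_HbD => //; apply: is_HbM => //; exact: is_Hb_cst.
  by apply/funext => u; rewrite !fctE mulN1r.
- by move=> f h /asboolP hf /asboolP hh; apply/asboolP; exact: is_HbM.
Qed.

Lemma Hb_scaler_closed :
  scaler_closed (Hb_pred : {pred (U -> C R : lmodType R[i])}).
Proof.
move=> a f /asboolP hf; apply/asboolP.
rewrite (_ : a *: f = (fun _ => a) * f) //.
by apply: is_HbM => //; exact: is_Hb_cst.
Qed.

Lemma Hb_submod_closed :
  subsemimod_closed (Hb_pred : {pred (U -> C R : lmodType R[i])}).
Proof.
split; last exact: Hb_scaler_closed.
split; first by apply/asboolP; exact: is_Hb_cst.
by move=> f h /asboolP hf /asboolP hh; apply/asboolP; exact: is_HbD.
Qed.

Record Hb := MkHb { Hb_val :> U -> C R ; _ : Hb_val \in Hb_pred }.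

HB.instance Definition _ := [isSub for Hb_val].
HB.instance Definition _ := [Choice of Hb by <:].
HB.instance Definition _ :=
  GRing.SubChoice_isSubComPzRing.Build (U -> C R) Hb_pred Hb
    Hb_subring_closed.
HB.instance Definition _ :=
  GRing.SubZmodule_isSubLmodule.Build R[i] (U -> C R) Hb_pred Hb
    Hb_submod_closed.

HB.instance Definition _ := Topological.copy Hb
  (initial_topology (fun f : Hb => Hb_val f : {family Ubounded_sub, U -> C R})).

Definition Mb : set (Hb -> C R) :=
  [set phi : Hb -> C R |
    [/\ exists f, phi f != 0, linear phi,
        {morph phi : f g / f * g} & continuous phi]].

Definition prec (phi : Hb -> C R) (A : set E) : Prop :=
  forall f : Hb, ((rnorm (phi f))%:E <= esupnorm f (set_val @^-1` A))%E.

Definition Hb_extension (Y : topologicalType) (q : Y -> E) (t : U -> Y) :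
    Prop :=
  [/\ riemann_domain q, morphism set_val q t &
      forall f : Hb, exists! g : Y -> C R, holomorphic q g /\ g \o t = f].

Definition Hb_envelope (Y : topologicalType) (q : Y -> E) (t : U -> Y) :
    Prop :=
  Hb_extension q t /\
  forall (Z : topologicalType) (r : Z -> E) (n : U -> Z), Hb_extension r n ->
    exists m : Z -> Y, morphism r q m /\ m \o n = t.

End Hb.

Section Hulls.
Variables (R : realType) (E : normedModType R[i]).

Definition balanced (U : set E) : Prop :=
  forall (a : R[i]) (x : E), `|a| <= 1 -> U x -> U (a *: x).

Definition poly_hull (A : set E) : set E :=
  [set x | forall P : E -> C R, continuous_polynomial P ->
     ((rnorm (P x))%:E <= esupnorm P A)%E].

Definition fundamental_sequence (U : set E) (Un : nat -> set E) : Prop :=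
  (forall n, Ubounded U (Un n)) /\
  forall A, Ubounded U A -> exists n, A `<=` Un n.

Definition exhaustion (U : set E) (n : nat) : set E :=
  [set x | [/\ U x, forall y, ~ U y -> n.+1%:R^-1 <= `|x - y| &
               `|x| <= n.+1%:R]].

Definition domain_hull (U : set E) : set E :=
  \bigcup_n poly_hull (exhaustion U n).

Lemma esupnorm_subset (T : Type) (f : T -> C R) (A B : set T) :
  A `<=` B -> (esupnorm f A <= esupnorm f B)%E.
Proof. by move=> AB; apply: ereal_sup_le; exact: image_subset. Qed.

Lemma poly_hullS (A B : set E) : A `<=` B -> poly_hull A `<=` poly_hull B.
Proof.
by move=> AB x Ax P /Ax /le_trans; apply; exact: esupnorm_subset.
Qed.

Lemma sub_poly_hull (A : set E) : A `<=` poly_hull A.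
Proof. by move=> x Ax P _; apply: ereal_sup_ubound; exists x. Qed.

Lemma exhaustion_Ubounded (U : set E) n : Ubounded U (exhaustion U n).
Proof.
split; first by move=> x [].
- exists n.+1%:R; split; first exact: realn.
  by move=> M ltM x [_ _ xn]; exact: le_trans xn (ltW ltM).
- by exists n.+1%:R^-1; [rewrite invr_gt0 | move=> x y [_ + _]; apply].
Qed.

Lemma le_natC (x : R[i]) : x \is Num.real ->
  exists N, forall n, (N <= n)%N -> x <= n%:R.
Proof.
move=> /RRe_real <-; set r := complex.Re x.
have [N] : exists N : nat, r < N%:R.
  by exists (Num.bound `|r|); apply: le_lt_trans (ler_norm r) (archi_boundP _).
move=> rN; exists N => n Nn.
rewrite -(rmorph_nat (real_complex R)) lecR (le_trans (ltW rN))//.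
by rewrite ler_nat.
Qed.

Lemma exhaustion_fundamental (U : set E) :
  fundamental_sequence U (exhaustion U).
Proof.
split=> [n|A [AU [M [Mreal HM]] [r r0 Hr]]]; first exact: exhaustion_Ubounded.
have [n1 Hn1] := le_natC (realD Mreal (real1 _)).
have rV : r^-1 \is Num.real by rewrite realV gtr0_real.
have [n2 Hn2] := le_natC rV.
exists (maxn n1 n2) => x Ax; split; first exact: AU.
- move=> y Uy; apply: le_trans (Hr x y Ax Uy).
  rewrite -[leRHS]invrK lef_pV2 ?posrE ?invr_gt0//; apply: Hn2.
  by rewrite leqW// leq_maxr.
- apply: (@le_trans _ _ (M + 1)); first by apply: HM => //; rewrite ltrDl.
  by apply: Hn1; rewrite leqW// leq_maxl.
Qed.

Lemma domain_hullE (U : set E) (Un : nat -> set E) :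
  fundamental_sequence U Un -> domain_hull U = \bigcup_n poly_hull (Un n).
Proof.
move=> [UnU Unf]; apply/seteqP; split=> x [n _ hx].
- have [m nm] := Unf _ (exhaustion_Ubounded U n).
  by exists m => //; exact: poly_hullS hx.
- have [_ ef] := exhaustion_fundamental U.
  have [m nm] := ef _ (UnU n).
  by exists m => //; exact: poly_hullS hx.
Qed.

Lemma sub_domain_hull (U : set E) : open U -> U `<=` domain_hull U.
Proof.
move=> oU x Ux.
have /nbhs_ballP[r r0 xrU] : nbhs x U by exact: open_nbhs_nbhs.
have [_ ef] := exhaustion_fundamental U.
have [|n xn] := ef [set x].
  split; first by move=> _ ->.
  - exists `|x|; split; first exact: normr_real.
    by move=> M xM _ ->; exact: ltW.
  - exists r => // _ y -> Uy.
    have [//|xy] := real_leP (gtr0_real r0) (normr_real (x - y)).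
    by exfalso; apply: Uy; apply: xrU; rewrite -ball_normE.
by exists n => //; apply: sub_poly_hull; exact: xn.
Qed.

Definition hull_inclusion (U : set E) (oU : open U) (u : U) : domain_hull U :=
  SigSub (mem_set (sub_domain_hull oU (set_valP u))).

(* Characterizes [delta_z]: restricting a continuous polynomial to U gives an
   element [f] of H_b(U), at which [phi] takes the value [P z]. *)
Definition evaluates_polynomials_at (U : set E) (z : E) (phi : Hb U -> C R) :
    Prop :=
  forall (P : E -> C R) (f : Hb U), continuous_polynomial P ->
    (forall u : U, f u = P (set_val u)) -> phi f = P z.

Definition is_delta (U : set E) (z : E) (phi : Hb U -> C R) : Prop :=
  Mb phi /\ evaluates_polynomials_at z phi.

End Hulls.

(* Main.v *)
Require Import Defs.
From HB Require Import structures.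
From mathcomp Require Import all_boot all_order all_algebra complex.
From mathcomp Require Import all_classical all_reals all_analysis.
From mathcomp Require Import ring lra.

Set Implicit Arguments.
Unset Strict Implicit.
Unset Printing Implicit Defensive.

Import Order.TTheory GRing.Theory Num.Theory.
Import numFieldNormedType.Exports.

Local Open Scope classical_set_scope.
Local Open Scope ring_scope.

(** Why the theorem holds. Let f be in H_b(U), with U balanced. The Taylor series
    of f at 0 converges to f on U, and its terms are continuous homogeneous
    polynomials. If A is U-bounded, then so is the set of all a x with x in A and
    |a| <= 1 + e, for some e > 0 ([Ubounded_dilation]), so Cauchy's estimates on
    the discs of radius 1 + e bound the k-th term on A by M / (1 + e)^k. As the
    terms are polynomials, the bounds persist on the polynomial hull of A
    ([taylor_component_geometric]). Hence the series converges on the hull of U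
    to a holomorphic extension of f ([extension_to_hull]), which is a uniform
    limit of polynomials on the hull of A and is therefore bounded there by the
    supremum of |f| over A ([extension_ler]). The hull of U is balanced, so the
    identity theorem on lines through 0 makes the extension unique
    ([hull_identity]). Evaluating it at z gives delta_z, dominated by A, and the
    density of the polynomials gives the uniqueness of delta_z ([unique_delta]).

    For the envelope, let Z be an H_b-extension of U. The points of Z over the
    hull near which the functions on Z agree with the extensions to the hull form
    an open set that contains the image of U. It is also closed: near a limit
    point, every function of bounded type on the hull continues to a ball of
    fixed radius, and such a ball lies in the hull, because a gliding hump gives,
    for a point y of the ball outside the hull, a function whose Taylor series
    cannot converge at y ([continuation_ball_in_hull]). So the indicator function
    of the complement is holomorphic and vanishes on U, and is 0 by the
    uniqueness of extensions ([agreement_setT]): Z maps to the hull.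

    The function theory is built on complex differentiability alone, with finite
    averages in place of integrals. Riemann sums along the boundary of a
    rectangle tend to 0 by Goursat's bisection ([contour_sum_cvg0]); the
    exponential carries this to circles, whose means have a limit independent of
    the radius ([circle_mean_cvg]); Fejer kernels on the roots of unity then give
    the power series ([taylor_series]). On a normed space everything is reduced
    to complex lines: Cauchy's estimates bound differentials and remainders
    ([hol_ball_estimates]), so that uniform limits of holomorphic functions are
    holomorphic ([uniform_limit_differentiable]), and in particular directional
    derivatives are ([hol_on_directional]). The k-th Taylor component is thus the
    diagonal of an iterated differential, which is multilinear
    ([taylor_component_homogeneous]). *)

(** * The complex field over the reals *)

Section Embedding.
Context {R : realType}.

(** The embedding of R with values in the regular module [C R]: without the
    type constraint, products would mix the ring structures of R[i] and of
    R[i]^o. *)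
Definition toC (r : R) : C R := (r%:C)%C.

Lemma toC_is_zmod_morphism : zmod_morphism toC.
Proof. exact: (rmorphB (real_complex R)). Qed.

Lemma toC_is_monoid_morphism : monoid_morphism toC.
Proof. by split=> //; exact: (rmorphM (real_complex R)). Qed.

HB.instance Definition _ :=
  GRing.isZmodMorphism.Build R (C R) toC toC_is_zmod_morphism.
HB.instance Definition _ :=
  GRing.isMonoidMorphism.Build R (C R) toC toC_is_monoid_morphism.

Definition iC : C R := 'i%C.

Lemma iC2 : iC * iC = -1.
Proof. by rewrite -expr2; exact: sqr_i. Qed.

Lemma toC_eq0 r : (toC r == 0) = (r == 0).
Proof. exact: fmorph_eq0. Qed.

End Embedding.

(** * Real-valued norms *)

Section Rnorm.
Context {R : realType}.

Section Module.
Context {V : normedModType R[i]}.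
Implicit Types x y : V.

Lemma normE x : `|x| = ((rnorm x)%:C)%C.
Proof. by rewrite /rnorm RRe_real ?normr_real. Qed.

Lemma rnorm_ge0 x : 0 <= rnorm x.
Proof. by rewrite -lecR -normE normr_ge0. Qed.

Lemma rnorm0 : rnorm (0 : V) = 0.
Proof. by rewrite /rnorm normr0. Qed.

Lemma rnorm0_eq0 x : rnorm x = 0 -> x = 0.
Proof. by move=> x0; apply/eqP; rewrite -normr_eq0 normE x0. Qed.

Lemma rnorm_gt0 x : x != 0 -> 0 < rnorm x.
Proof.
move=> x0; rewrite lt_def rnorm_ge0 andbT.
by apply: contra_neq x0; exact: rnorm0_eq0.
Qed.

Lemma ler_rnormD x y : rnorm (x + y) <= rnorm x + rnorm y.
Proof. by rewrite -lecR rmorphD /= -!normE ler_normD. Qed.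

Lemma rnormN x : rnorm (- x) = rnorm x.
Proof. by rewrite /rnorm normrN. Qed.

Lemma rdistC x y : rnorm (x - y) = rnorm (y - x).
Proof. by rewrite /rnorm distrC. Qed.

Lemma ler_rnormB x y : rnorm (x - y) <= rnorm x + rnorm y.
Proof. by rewrite (le_trans (ler_rnormD _ _))// rnormN. Qed.

Lemma ler_rdistD z x y : rnorm (x - y) <= rnorm (x - z) + rnorm (z - y).
Proof. by rewrite (le_trans _ (ler_rnormD _ _))// subrKA. Qed.

Lemma rnorm_le x (r : R) : (`|x| <= r%:C%C) = (rnorm x <= r).
Proof. by rewrite normE lecR. Qed.

Lemma rnorm_lt x (r : R) : (`|x| < r%:C%C) = (rnorm x < r).
Proof. by rewrite normE ltcR. Qed.

Lemma ler_rnorm_sum (I : Type) (s : seq I) (P : pred I) (F : I -> V) :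
  rnorm (\sum_(i <- s | P i) F i) <= \sum_(i <- s | P i) rnorm (F i).
Proof.
elim/big_rec2 : _ => [|i u v _ uv]; first by rewrite rnorm0.
by rewrite (le_trans (ler_rnormD _ _))// lerD2l.
Qed.

End Module.

Lemma rnormZ (V : normedModType R[i]) (a : C R) (x : V) :
  rnorm (a *: x) = rnorm a * rnorm x.
Proof. by apply/complexI; rewrite rmorphM /= -!normE normrZ. Qed.

Lemma rnormM (a b : C R) : rnorm (a * b) = rnorm a * rnorm b.
Proof. by apply/complexI; rewrite rmorphM /= -!normE normrM. Qed.

Lemma rnorm1 : rnorm (1 : C R) = 1.
Proof. by rewrite /rnorm normr1. Qed.

Lemma rnormX (a : C R) n : rnorm (a ^+ n) = rnorm a ^+ n.
Proof. by elim: n => [|n IH]; rewrite ?expr0 ?rnorm1// !exprS rnormM IH. Qed.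

Lemma rnormV (a : C R) : rnorm (a^-1) = (rnorm a)^-1.
Proof.
have [->|a0] := eqVneq a 0; first by rewrite invr0 rnorm0 invr0.
apply: (mulfI (lt0r_neq0 (rnorm_gt0 a0))).
by rewrite -rnormM !mulfV ?rnorm1// lt0r_neq0// rnorm_gt0.
Qed.

Lemma rnormE (z : C R) :
  rnorm z = Num.sqrt (complex.Re z ^+ 2 + complex.Im z ^+ 2).
Proof. by rewrite /rnorm normc_def. Qed.

Lemma rnormC (r : R) : rnorm (toC r) = `|r|.
Proof. by rewrite rnormE /= expr0n addr0 sqrtr_sqr. Qed.

Lemma rnormi : rnorm (iC : C R) = 1.
Proof. by rewrite rnormE /= expr0n add0r expr1n sqrtr1. Qed.

End Rnorm.

(** * Differentiability in terms of real-valued norms *)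

Section Differentials.
Context {R : realType}.

Lemma nbhs_rnormP (V : normedModType R[i]) (x : V) (P : set V) :
  nbhs x P <-> exists2 r : R, 0 < r & forall y, rnorm (y - x) < r -> P y.
Proof.
rewrite -nbhs_ballE; split.
- move=> [e /= e0 He]; exists (complex.Re e).
    by move: e0; rewrite ltcE /= => /andP[].
  move=> y yx; apply: He; rewrite -ball_normE /= distrC.
  have -> : e = ((complex.Re e)%:C)%C by rewrite RRe_real// gtr0_real.
  by rewrite rnorm_lt.
- move=> [r r0 Hr]; exists (r%:C)%C => /=; first by rewrite ltcR.
  by move=> y; rewrite -ball_normE /= distrC rnorm_lt; exact: Hr.
Qed.

Lemma open_rnormP (V : normedModType R[i]) (A : set V) :
  open A <-> forall x, A x ->
    exists2 r : R, 0 < r & forall y, rnorm (y - x) < r -> A y.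
Proof.
rewrite openE; split=> [H x /H /nbhs_rnormP//|H x /H]; last first.
  by move=> ?; apply/nbhs_rnormP.
Qed.

Lemma continuous_rnormP (V W : normedModType R[i]) (f : V -> W) (x : V) :
  {for x, continuous f} <-> forall e : R, 0 < e ->
    exists2 d : R, 0 < d & forall y, rnorm (y - x) < d -> rnorm (f y - f x) < e.
Proof.
split=> [cf e e0|H A /nbhs_rnormP[e e0 He]].
  have /cf/nbhs_rnormP// : nbhs (f x) [set y | rnorm (y - f x) < e].
  by apply/nbhs_rnormP; exists e.
have [d d0 Hd] := H e e0.
by apply/nbhs_rnormP; exists d => // y /Hd; exact: He.
Qed.

Lemma linear_rnorm_bounded (V W : normedModType R[i]) (l : {linear V -> W}) :
  {for 0, continuous l} -> exists2 K : R, 0 <= K &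
    forall h, rnorm (l h) <= K * rnorm h.
Proof.
move=> /continuous_rnormP/(_ 1 ltr01)[d d0 Hd].
exists (2 / d) => [|h]; first by rewrite divr_ge0 ?ltW.
have [->|h0] := eqVneq h 0; first by rewrite linear0 !rnorm0 mulr0.
have nh := rnorm_gt0 h0.
set a := toC (d / 2 / rnorm h).
have na : rnorm a = d / 2 / rnorm h.
  by rewrite rnormC ger0_norm// !divr_ge0// ltW.
have := Hd (a *: h); rewrite subr0 linear0 subr0 linearZ_LR !rnormZ na.
rewrite -mulrA mulVf ?gt_eqF// mulr1 => /(_ _)/wrap[|/ltW].
  by rewrite ltr_pdivrMr// mulr_natr mulr2n ltrDl.
rewrite -ler_pdivlMl ?divr_gt0// mulr1 => /le_trans; apply.
by rewrite !invf_div mulrA [_ * 2]mulrC mulrAC.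
Qed.

(** The form in which differentials are estimated: bounded, with a remainder
    that is small with respect to the increment. *)
Lemma differentiable_rnormP (V W : normedModType R[i]) (g : V -> W) (u : V) :
  differentiable g u ->
  (exists2 K : R, 0 <= K & forall h, rnorm ('d g u h) <= K * rnorm h) /\
  forall e : R, 0 < e -> exists2 d : R, 0 < d &
    forall h, rnorm h < d ->
      rnorm (g (u + h) - g u - 'd g u h) <= e * rnorm h.
Proof.
move=> dg; split.
  by apply: linear_rnorm_bounded; exact: diff_continuous.
move=> e e0; have /eqaddoP := diff_locally dg.
move=> /(_ (e%:C)%C); rewrite ltcR => /(_ e0)/nbhs_rnormP[d d0 Hd].
exists d => // h hd; have := Hd h; rewrite subr0 => /(_ hd).
by rewrite !fctE /= !normE -rmorphM lecR [h + u]addrC opprD addrA.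
Qed.

Lemma rnormP_differentiable (V W : normedModType R[i]) (g : V -> W) (u : V)
    (l : {linear V -> W}) (K : R) :
  (forall h, rnorm (l h) <= K * rnorm h) ->
  (forall e : R, 0 < e -> exists2 d : R, 0 < d &
    forall h, rnorm h < d -> rnorm (g (u + h) - g u - l h) <= e * rnorm h) ->
  differentiable g u /\ 'd g u = l :> (V -> W).
Proof.
move=> lK Hl.
have cl : continuous l.
  move=> x; apply/continuous_rnormP => e e0.
  exists (e / (`|K| + 1)); first by rewrite divr_gt0// ltr_wpDl.
  move=> y; rewrite ltr_pdivlMr ?ltr_wpDl// => yx.
  rewrite -linearB (le_lt_trans (lK _))//.
  apply: le_lt_trans yx; rewrite mulrC ler_wpM2l ?rnorm_ge0//.
  by rewrite (le_trans (ler_norm _))// lerDl.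
have ol : g \o shift u = cst (g u) + l +o_ (0 : V) id.
  apply/eqaddoP => e e0.
  have er : e = ((complex.Re e)%:C)%C by rewrite RRe_real ?gtr0_real.
  have e0' : 0 < complex.Re e by move: e0; rewrite {1}er ltcR.
  have [d d0 Hd] := Hl _ e0'.
  apply/nbhs_rnormP; exists d => // h; rewrite subr0 => /Hd.
  by rewrite !fctE /= !normE er -rmorphM lecR [h + u]addrC opprD addrA.
split; last exact: diff_unique.
apply/diff_locallyP.
by rewrite (diff_unique cl ol).
Qed.

(** Cauchy's estimates produce bounds of this form; the bound on [l] near 0 is a
    global one by homogeneity. *)
Lemma quadratic_differentiable (V W : normedModType R[i]) (g l : V -> W)
    (u : V) (r K : R) : linear l -> 0 < r ->
  (forall h, rnorm h < r -> rnorm (l h) <= K * rnorm h) ->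
  (forall h, rnorm h < r -> rnorm (g (u + h) - g u - l h) <= K * rnorm h ^+ 2) ->
  differentiable g u /\ 'd g u = l :> (V -> W).
Proof.
move=> ll r0 lK Hl.
pose l' : {linear V -> W} := HB.pack l (GRing.isLinear.Build _ _ _ _ l ll).
have lK' h : rnorm (l' h) <= K * rnorm h.
  have [->|h0] := eqVneq h 0; first by rewrite linear0 !rnorm0 mulr0.
  have nh := rnorm_gt0 h0.
  have c0 : 0 < r / 2 / rnorm h by rewrite !divr_gt0.
  set a := toC (r / 2 / rnorm h).
  have na : rnorm a = r / 2 / rnorm h by rewrite rnormC gtr0_norm.
  have /lK : rnorm (a *: h) < r.
    by rewrite rnormZ na -mulrA mulVf ?gt_eqF// mulr1 ltr_pdivrMr// ltr_pMr// ltr1n.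
  have -> : l (a *: h) = a *: l h by exact: (linearZ_LR l').
  by rewrite !rnormZ na mulrCA ler_pM2l.
apply: (rnormP_differentiable (l := l') lK') => e e0.
have K0 : 0 < `|K| + 1 by rewrite ltr_wpDl.
exists (Num.min r (e / (`|K| + 1))); first by rewrite lt_min r0 divr_gt0.
move=> h; rewrite lt_min => /andP[/Hl hl]; rewrite ltr_pdivlMr// => he.
rewrite (le_trans hl)// expr2 mulrA ler_wpM2r ?rnorm_ge0//.
apply: le_trans (ltW he); rewrite mulrC ler_wpM2l ?rnorm_ge0//.
by rewrite (le_trans (ler_norm _))// lerDl.
Qed.

End Differentials.

(** * Bisection of rectangles *)

Section Bisection.
Context {R : realType}.

Lemma exists_dyadic_lt (a d : R) : 0 < d ->
  exists k, forall j, (k <= j)%N -> a / 2 ^+ j < d.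
Proof.
move=> d0; exists (Num.bound `|a / d|) => j kj.
rewrite ltr_pdivrMr ?exprn_gt0// mulrC -ltr_pdivrMr//.
rewrite (le_lt_trans (ler_norm _))// (lt_le_trans (archi_boundP _))//.
apply: (@le_trans _ _ j%:R); first by rewrite ler_nat. rewrite -natrX ler_nat ltnW// ltn_expl//.
Qed.

Lemma nested_intervals (s : nat -> R) (a : R) : 0 <= a ->
  (forall k, s k <= s k.+1 /\ s k.+1 + a / 2 ^+ k.+1 <= s k + a / 2 ^+ k) ->
  exists c, forall k, s k <= c <= s k + a / 2 ^+ k.
Proof.
move=> a0 H.
have s_nd : {homo s : i j / (i <= j)%N >-> i <= j}.
  by apply: homo_leq => // [i j k|k]; [exact: le_trans | have [] := H k].
have t_ni : {homo (fun k => s k + a / 2 ^+ k) : i j / (i <= j)%N >-> j <= i}.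
  apply: homo_leq => // [i j k ij jk|k]; first exact: le_trans jk ij.
  by have [] := H k.
have st i j : s i <= s j + a / 2 ^+ j.
  apply: (le_trans (s_nd _ _ (leq_maxl i j))).
  apply: le_trans (t_ni _ _ (leq_maxr i j)).
  by rewrite lerDl divr_ge0// exprn_ge0.
exists (sup (range s)) => k; apply/andP; split.
  apply: ub_le_sup; last by exists k.
  by exists (s 0 + a / 2 ^+ 0) => _ [j _ <-].
by apply: sup_le_ub; [exists (s 0), 0%N | move=> _ [j _ <-]].
Qed.

(** Cousin's lemma: bisecting a counterexample would produce nested
    counterexamples that shrink to a point. With [b = 0] this is the compactness
    of a segment. *)
Lemma rectangle_bisection (P : R -> R -> R -> R -> Prop) (x y a b : R) :
  0 <= a -> 0 <= b ->
  (forall x y a b, P x y (a / 2) (b / 2) -> P (x + a / 2) y (a / 2) (b / 2) ->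
     P x (y + b / 2) (a / 2) (b / 2) ->
     P (x + a / 2) (y + b / 2) (a / 2) (b / 2) -> P x y a b) ->
  (forall s t, x <= s <= x + a -> y <= t <= y + b ->
     exists2 d : R, 0 < d & forall x' y' k, a / 2 ^+ k < d -> b / 2 ^+ k < d ->
       x' <= s <= x' + a / 2 ^+ k -> y' <= t <= y' + b / 2 ^+ k ->
       P x' y' (a / 2 ^+ k) (b / 2 ^+ k)) ->
  P x y a b.
Proof.
move=> a0 b0 quarters small; apply: contrapT => nP.
have half (c : R) k : c / 2 ^+ k.+1 = c / 2 ^+ k / 2 by rewrite exprSr invfM mulrA.
have step (kp : nat * (R * R)) : exists q : R * R,
    [/\ ~ P kp.2.1 kp.2.2 (a / 2 ^+ kp.1) (b / 2 ^+ kp.1) ->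
          ~ P q.1 q.2 (a / 2 ^+ kp.1.+1) (b / 2 ^+ kp.1.+1),
        kp.2.1 <= q.1 /\ q.1 + a / 2 ^+ kp.1.+1 <= kp.2.1 + a / 2 ^+ kp.1 &
        kp.2.2 <= q.2 /\ q.2 + b / 2 ^+ kp.1.+1 <= kp.2.2 + b / 2 ^+ kp.1].
  case: kp => k [s t] /=; rewrite !half.
  set a' := a / 2 ^+ k; set b' := b / 2 ^+ k.
  have a'0 : 0 <= a' by rewrite divr_ge0// exprn_ge0.
  have b'0 : 0 <= b' by rewrite divr_ge0// exprn_ge0.
  have [p1|p1] := pselect (P s t (a' / 2) (b' / 2)); last first.
    by exists (s, t) => /=; split=> //; split; lra.
  have [p2|p2] := pselect (P (s + a' / 2) t (a' / 2) (b' / 2)); last first.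
    by exists (s + a' / 2, t) => /=; split=> //; split; lra.
  have [p3|p3] := pselect (P s (t + b' / 2) (a' / 2) (b' / 2)); last first.
    by exists (s, t + b' / 2) => /=; split=> //; split; lra.
  exists (s + a' / 2, t + b' / 2) => /=; split; try by split; lra.
  by move=> nP' p4; apply: nP'; apply: quarters.
have [F HF] := choice step.
pose c := fix c k := if k is k'.+1 then F (k', c k') else (x, y).
have cP k : ~ P (c k).1 (c k).2 (a / 2 ^+ k) (b / 2 ^+ k).
  elim: k => [|k IH]; first by rewrite !expr0 !divr1.
  by have [/(_ IH)] := HF (k, c k).
have [k|s Hs] := @nested_intervals (fun k => (c k).1) a a0.
  by have [_ ? _] := HF (k, c k).
have [k|t Ht] := @nested_intervals (fun k => (c k).2) b b0.
  by have [_ _ ?] := HF (k, c k).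
have [||d d0 Hd] := small s t.
- by have := Hs 0; rewrite expr0 divr1.
- by have := Ht 0; rewrite expr0 divr1.
have [ka Ha] := exists_dyadic_lt a d0.
have [kb Hb] := exists_dyadic_lt b d0.
apply: (cP (maxn ka kb)); apply: Hd => //.
- by apply: Ha; exact: leq_maxl.
- by apply: Hb; exact: leq_maxr.
Qed.

End Bisection.

(** * Riemann sums along the boundary of a rectangle *)

Section Goursat.
Context {R : realType}.
Implicit Types (u v : R -> C R) (H : R -> R -> C R).

Definition left_sum u (n : nat) (x a : R) : C R :=
  toC (a / n%:R) * \sum_(i < n) u (x + a * (i%:R / n%:R)).

Lemma left_sum_halves u n x a : (0 < n)%N ->
  left_sum u (n + n) x a = left_sum u n x (a / 2) + left_sum u n (x + a / 2) (a / 2).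
Proof.
move=> n0; have nn : n%:R != 0 :> R by rewrite pnatr_eq0 -lt0n.
rewrite /left_sum big_split_ord /= natrD -mulrDr.
have nn2 : n%:R + n%:R != 0 :> R by rewrite -mulr2n mulrn_eq0.
have -> : a / (n%:R + n%:R) = a / 2 / n%:R by field; rewrite nn.
congr (_ * (_ + _)); apply: eq_bigr => i _; congr u; first by field; rewrite nn.
by rewrite natrD; field; rewrite nn.
Qed.

Lemma left_sumD u v n x a :
  left_sum (fun s => u s + v s) n x a = left_sum u n x a + left_sum v n x a.
Proof. by rewrite /left_sum big_split mulrDr. Qed.

Lemma left_sumB u v n x a :
  left_sum (fun s => u s - v s) n x a = left_sum u n x a - left_sum v n x a.
Proof. by rewrite /left_sum sumrB mulrBr. Qed.

Lemma left_sum_cst (c : C R) n x a : (0 < n)%N ->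
  left_sum (fun=> c) n x a = toC a * c.
Proof.
move=> n0; rewrite /left_sum sumr_const card_ord -[c *+ n]mulr_natr mulrCA [RHS]mulrC.
congr (_ * _); rewrite -(rmorph_nat toC) -rmorphM mulfVK//.
by rewrite pnatr_eq0 -lt0n.
Qed.

Lemma ler_left_sum u n x a M : (0 < n)%N -> 0 <= a ->
  (forall s, x <= s <= x + a -> rnorm (u s) <= M) ->
  rnorm (left_sum u n x a) <= a * M.
Proof.
move=> n0 a0 uM; have n0' : 0 < n%:R :> R by rewrite ltr0n.
rewrite /left_sum rnormM rnormC ger0_norm ?divr_ge0//.
rewrite -mulrA ler_wpM2l// ler_pdivrMl// mulr_natl.
rewrite (le_trans (ler_rnorm_sum _ _ _))//.
rewrite -[X in _ <= _ *+ X]card_ord -sumr_const; apply: ler_sum => i _.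
apply: uM; rewrite lerDl mulr_ge0 ?divr_ge0 ?(ltW n0')//= lerD2l ler_piMr//.
by rewrite ler_pdivrMr// mul1r ler_nat ltnW.
Qed.

(** The left Riemann sum, with [n] nodes on each side, of the integral of [H] ds
    along the boundary of a rectangle of the plane. *)
Definition contour_sum H (n : nat) (x y a b : R) : C R :=
  left_sum (H^~ y) n x a - left_sum (H^~ (y + b)) n x a +
  iC * (left_sum (H (x + a)) n y b - left_sum (H x) n y b).

Lemma contour_sum_quarters H n x y a b : (0 < n)%N ->
  contour_sum H (n + n) x y a b =
    contour_sum H n x y (a / 2) (b / 2) +
    contour_sum H n (x + a / 2) y (a / 2) (b / 2) +
    contour_sum H n x (y + b / 2) (a / 2) (b / 2) +
    contour_sum H n (x + a / 2) (y + b / 2) (a / 2) (b / 2).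
Proof.
move=> n0; rewrite /contour_sum !left_sum_halves//.
have -> s c : s + c / 2 + c / 2 = s + c :> R by field.
have -> s c : s + c / 2 + c / 2 = s + c :> R by field.
ring.
Qed.

Lemma contour_sumD H G n x y a b :
  contour_sum (fun s t => H s t + G s t) n x y a b =
  contour_sum H n x y a b + contour_sum G n x y a b.
Proof. by rewrite /contour_sum !left_sumD; ring. Qed.

Lemma contour_sum_affine (c D : C R) n x y a b : (0 < n)%N ->
  contour_sum (fun s t => c + D * (toC s + iC * toC t)) n x y a b = 0.
Proof.
move=> n0; rewrite /contour_sum -!left_sumB.
under [X in left_sum X n x a]funext => s.
  rewrite (_ : _ - _ = - (D * iC * toC b)); last by rewrite rmorphD /=; ring.
  over.
under [X in left_sum X n y b]funext => s.
  rewrite (_ : _ - _ = D * toC a); last by rewrite rmorphD /=; ring.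
  over.
by rewrite !left_sum_cst//; ring.
Qed.

Lemma ler_contour_sum H n x y a b M : (0 < n)%N -> 0 <= a -> 0 <= b ->
  (forall s t, x <= s <= x + a -> y <= t <= y + b -> rnorm (H s t) <= M) ->
  rnorm (contour_sum H n x y a b) <= 2 * (a + b) * M.
Proof.
move=> n0 a0 b0 HM.
have xl : x <= x <= x + a by rewrite lexx lerDl.
have xr : x <= x + a <= x + a by rewrite lexx lerDl a0.
have yl : y <= y <= y + b by rewrite lexx lerDl.
have yr : y <= y + b <= y + b by rewrite lexx lerDl b0.
rewrite (le_trans (ler_rnormD _ _))//.
rewrite (le_trans (lerD (ler_rnormB _ _) (lexx _)))//.
rewrite rnormM rnormi mul1r (le_trans (lerD (lexx _) (ler_rnormB _ _)))//.
have -> : 2 * (a + b) * M = a * M + a * M + (b * M + b * M) by ring.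
by rewrite !lerD// ler_left_sum// => s Hs; apply: HM.
Qed.

(** Goursat's theorem for Riemann sums: sums over the four quarters add up
    exactly, affine functions have sum zero exactly, so on a small rectangle
    only the error of the first order expansion counts. *)
Lemma contour_sum_cvg0 H x y a b e : 0 < a -> 0 < b -> 0 < e ->
  (forall s t, x <= s <= x + a -> y <= t <= y + b ->
    exists D : C R, forall e : R, 0 < e -> exists2 d : R, 0 < d &
      forall s' t', `|s' - s| < d -> `|t' - t| < d ->
      rnorm (H s' t' - H s t - D * (toC (s' - s) + iC * toC (t' - t)))
        <= e * (`|s' - s| + `|t' - t|)) ->
  exists k0, forall k, (k0 <= k)%N ->
    rnorm (contour_sum H (2 ^ k) x y a b) <= e * (a * b).
Proof.
move=> a0 b0 e0 dH.
apply: (@rectangle_bisection _ (fun x y a b => exists k0, forall k,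
  (k0 <= k)%N -> rnorm (contour_sum H (2 ^ k) x y a b) <= e * (a * b))).
- exact: ltW.
- exact: ltW.
- move=> {dH a0 b0 x y a b} x y a b [k1 H1] [k2 H2] [k3 H3] [k4 H4].
  exists (maxn (maxn k1 k2) (maxn k3 k4)).+1 => -[//|k].
  rewrite ltnS !geq_max => /andP[/andP[h1 h2] /andP[h3 h4]].
  rewrite expnS mul2n -addnn contour_sum_quarters ?expn_gt0//.
  rewrite (_ : a * b = a / 2 * (b / 2) + a / 2 * (b / 2) + a / 2 * (b / 2) +
    a / 2 * (b / 2)); last by field.
  rewrite !mulrDr.
  apply: le_trans (ler_rnormD _ _) _; apply: lerD; last exact: H4.
  apply: le_trans (ler_rnormD _ _) _; apply: lerD; last exact: H3.
  apply: le_trans (ler_rnormD _ _) _; apply: lerD; last exact: H2.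
  exact: H1.
- move=> s t xs yt; have [D HD] := dH s t xs yt.
  (* With e' for the first order error, the bound perimeter times maximum is
     2 (a + b)^2 e' / 4^k, which has to be e times the area a b / 4^k. *)
  set e' := e * (a * b) / (2 * (a + b) ^+ 2).
  have ab0 : 0 < a + b by rewrite addr_gt0.
  have e'0 : 0 < e' by rewrite divr_gt0 ?mulr_gt0// exprn_gt0.
  have [d d0 Hd] := HD _ e'0; exists d => // x' y' k ak bk xs' yt'.
  exists 0%N => j _; have k0 : 0 < 2 ^+ k :> R by rewrite exprn_gt0.
  set c : C R := H s t - D * (toC s + iC * toC t).
  set G := fun s' t' => H s' t' - (c + D * (toC s' + iC * toC t')).
  rewrite (_ : H = fun s' t' =>
    (c + D * (toC s' + iC * toC t')) + G s' t'); last first.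
    by apply/funext => s'; apply/funext => t'; rewrite /G addrC subrK.
  rewrite contour_sumD contour_sum_affine ?expn_gt0// add0r.
  apply: (@le_trans _ _ (2 * (a / 2 ^+ k + b / 2 ^+ k) *
                        (e' * (a / 2 ^+ k + b / 2 ^+ k)))); last first.
    rewrite le_eqVlt; apply/orP; left; apply/eqP; rewrite /e'.
    by field; rewrite !gt_eqF.
  apply: ler_contour_sum; rewrite ?expn_gt0 ?divr_ge0// ?ltW// => s' t' Hs' Ht'.
  have s's : `|s' - s| <= a / 2 ^+ k by rewrite ler_norml; lra.
  have t't : `|t' - t| <= b / 2 ^+ k by rewrite ler_norml; lra.
  have -> : G s' t' = H s' t' - H s t -
      D * (toC (s' - s) + iC * toC (t' - t)).
    by rewrite /G /c !rmorphB /=; ring.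
  apply: le_trans (Hd s' t' _ _) _; try exact: le_lt_trans ak; try exact: le_lt_trans bk.
  by rewrite ler_wpM2l ?(ltW e'0)// lerD.
Qed.

End Goursat.

(** * Convergence of sequences *)

Section Tends.
Context {R : realType}.

(** Distances are compared in R, as the norm of a complex normed space takes its
    values in R[i]. *)
Definition tends (V : normedModType R[i]) (u : nat -> V) (c : V) : Prop :=
  forall e : R, 0 < e -> exists N, forall n, (N <= n)%N -> rnorm (u n - c) <= e.

Lemma ler_addgt0 (x y : R) : (forall e, 0 < e -> x <= y + e) -> x <= y.
Proof. by move=> H; apply/ler_addgt0Pr => e /H. Qed.

Section Module.
Context {V : normedModType R[i]}.
Implicit Types (u v : nat -> V) (a c d : V).

Lemma tends_cst c : tends (fun=> c) c.
Proof. by move=> e e0; exists 0%N => n _; rewrite subrr rnorm0 ltW. Qed.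

Lemma tends_le u c a (M : R) (N : nat) : tends u c ->
  (forall n, (N <= n)%N -> rnorm (u n - a) <= M) -> rnorm (c - a) <= M.
Proof.
move=> uc uM; apply: ler_addgt0 => e /uc[N' HN'].
rewrite (le_trans (ler_rdistD (u (maxn N N')) _ _))// addrC lerD//.
  by apply: uM; exact: leq_maxl.
by rewrite rdistC HN'// leq_maxr.
Qed.

Lemma tends_le0 u c (M : R) (N : nat) : tends u c ->
  (forall n, (N <= n)%N -> rnorm (u n) <= M) -> rnorm c <= M.
Proof.
move=> uc uM; rewrite -[c]subr0; apply: (tends_le uc (N := N)) => n Nn.
by rewrite subr0 uM.
Qed.

Lemma tends_unique u c d : tends u c -> tends u d -> c = d.
Proof.
move=> uc ud; apply/eqP; rewrite -subr_eq0; apply/eqP/rnorm0_eq0/eqP.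
rewrite eq_le rnorm_ge0 andbT; apply: ler_addgt0 => e /ud[N HN].
by rewrite add0r; exact: tends_le uc HN.
Qed.

Lemma tendsD u v c d : tends u c -> tends v d ->
  tends (fun n => u n + v n) (c + d).
Proof.
move=> uc vd e e0; have e20 : 0 < e / 2 by rewrite divr_gt0.
have [N HN] := uc _ e20; have [M HM] := vd _ e20.
exists (maxn N M) => n; rewrite geq_max => /andP[/HN un /HM vn].
rewrite opprD addrACA (le_trans (ler_rnormD _ _))//.
by rewrite (le_trans (lerD un vn))// -splitr.
Qed.

Lemma tends_ext u v c : u =1 v -> tends u c -> tends v c.
Proof. by move=> /funext ->. Qed.

End Module.

Lemma tendsZ (V : normedModType R[i]) (u : nat -> V) c (a : C R) :
  tends u c -> tends (fun n => a *: u n) (a *: c).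
Proof.
move=> uc e e0; have a0 : 0 < rnorm a + 1 by rewrite ltr_wpDl// rnorm_ge0.
have [|N HN] := uc (e / (rnorm a + 1)); first by rewrite divr_gt0.
exists N => n /HN; rewrite ler_pdivlMr// -scalerBr rnormZ; apply: le_trans.
by rewrite mulrC ler_wpM2l ?rnorm_ge0// lerDl.
Qed.

Lemma tendsMl (u : nat -> C R) c a :
  tends u c -> tends (fun n => a * u n) (a * c).
Proof. exact: (@tendsZ (C R)). Qed.

Lemma tendsN (V : normedModType R[i]) (u : nat -> V) c :
  tends u c -> tends (fun n => - u n) (- c).
Proof.
by move=> /(tendsZ (-1)); rewrite scaleN1r; apply: tends_ext => n; rewrite scaleN1r.
Qed.

Lemma tendsB (V : normedModType R[i]) (u v : nat -> V) c d :
  tends u c -> tends v d -> tends (fun n => u n - v n) (c - d).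
Proof. by move=> uc /tendsN; exact: tendsD. Qed.

Lemma tends_sum (V : normedModType R[i]) (I : Type) (s : seq I) (P : pred I)
    (F : I -> nat -> V) (c : I -> V) : (forall i, P i -> tends (F i) (c i)) ->
  tends (fun n => \sum_(i <- s | P i) F i n) (\sum_(i <- s | P i) c i).
Proof.
move=> H; elim: s => [|i s IH].
  by rewrite big_nil; under [X in tends X]funext => n do rewrite big_nil; exact: tends_cst.
rewrite big_cons; under [X in tends X]funext => n do rewrite big_cons.
by case: ifPn => // /H; move/tendsD; exact.
Qed.

Lemma ler_Re_rnorm (z : C R) : `|complex.Re z| <= rnorm z.
Proof. by rewrite -lecR -normE; exact: normc_ge_Re. Qed.

Lemma ReD (z w : C R) : complex.Re (z + w) = complex.Re z + complex.Re w.
Proof. by case: z w => [a b] [c d]. Qed.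

Lemma ReB (z w : C R) : complex.Re (z - w) = complex.Re z - complex.Re w.
Proof. by case: z w => [a b] [c d]. Qed.

Lemma ImD (z w : C R) : complex.Im (z + w) = complex.Im z + complex.Im w.
Proof. by case: z w => [a b] [c d]. Qed.

Lemma ImB (z w : C R) : complex.Im (z - w) = complex.Im z - complex.Im w.
Proof. by case: z w => [a b] [c d]. Qed.

Lemma ReIm (z : C R) : z = toC (complex.Re z) + iC * toC (complex.Im z).
Proof. exact: complexE. Qed.

Lemma Re_cart (s t : R) : complex.Re (toC s + iC * toC t) = s.
Proof. by rewrite /toC /iC /=; ring. Qed.

Lemma Im_cart (s t : R) : complex.Im (toC s + iC * toC t) = t.
Proof. by rewrite /toC /iC /=; ring. Qed.

Lemma ler_Im_rnorm (z : C R) : `|complex.Im z| <= rnorm z.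
Proof. by rewrite rnormE -sqrtr_sqr ler_wsqrtr// lerDr sqr_ge0. Qed.

Lemma ler_rnorm_ReIm (z : C R) : rnorm z <= `|complex.Re z| + `|complex.Im z|.
Proof. by rewrite {1}[z]ReIm (le_trans (ler_rnormD _ _))// rnormM rnormi mul1r !rnormC. Qed.

Lemma cauchy_real (u : nat -> R) :
  (forall e, 0 < e -> exists N, forall n, (N <= n)%N -> `|u n - u N| <= e) ->
  exists c, forall e, 0 < e -> exists N, forall n, (N <= n)%N -> `|u n - c| <= e.
Proof.
move=> Hu.
have : cauchy (u @ \oo).
  apply/cauchy_exP => e e0.
  have [N HN] := Hu _ (divr_gt0 e0 (ltr0n R 2)).
  exists (u N); exists N => // n /= /HN un.
  rewrite -ball_normE /= distrC (le_lt_trans un)//.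
  by rewrite ltr_pdivrMr// ltr_pMr// ltr1n.
move=> /cauchy_cvgP/cvg_ex[c /cvgrPdist_le uc]; exists c => e /uc[N _ HN].
by exists N => n /HN /=; rewrite distrC.
Qed.

Lemma tends_cauchy (u : nat -> C R) :
  (forall e, 0 < e -> exists N, forall n, (N <= n)%N -> rnorm (u n - u N) <= e) ->
  exists c, tends u c.
Proof.
move=> Hu.
have [e e0|a Ha] := @cauchy_real (fun n => complex.Re (u n)).
  have [N HN] := Hu e e0; exists N => n /HN; apply: le_trans.
  by rewrite -ReB ler_Re_rnorm.
have [e e0|b Hb] := @cauchy_real (fun n => complex.Im (u n)).
  have [N HN] := Hu e e0; exists N => n /HN; apply: le_trans.
  by rewrite -ImB ler_Im_rnorm.
exists (toC a + iC * toC b) => e e0; have e20 : 0 < e / 2 by rewrite divr_gt0.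
have [N HN] := Ha _ e20; have [M HM] := Hb _ e20.
exists (maxn N M) => n; rewrite geq_max => /andP[/HN un /HM vn].
rewrite (le_trans (ler_rnorm_ReIm _))// ReB ImB Re_cart Im_cart.
by rewrite (le_trans (lerD un vn))// -splitr.
Qed.

End Tends.

(** * The complex exponential *)

Section ComplexExponential.
Context {R : realType}.

Definition cexp (z : C R) : C R :=
  toC (expR (complex.Re z)) *
  (toC (cos (complex.Im z)) + iC * toC (sin (complex.Im z))).

Lemma cexpD z w : cexp (z + w) = cexp z * cexp w.
Proof.
rewrite /cexp ReD ImD expRD cosD sinD.
rewrite !(rmorphM toC) (rmorphB toC) (rmorphD toC) !(rmorphM toC).
have i2 := @iC2 R; ring: i2.
Qed.

Lemma cexp_toC x : cexp (toC x) = toC (expR x).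
Proof. by rewrite /cexp /= cos0 sin0 rmorph0 rmorph1 mulr0 addr0 mulr1. Qed.

Lemma cexp0 : cexp 0 = 1.
Proof. by rewrite -[0](rmorph0 toC) cexp_toC expR0 rmorph1. Qed.

Lemma cexp_im t : cexp (iC * toC t) = toC (cos t) + iC * toC (sin t).
Proof.
rewrite /cexp -[iC * toC t]add0r -[X in X + _](rmorph0 toC) Re_cart Im_cart.
by rewrite expR0 rmorph1 mul1r.
Qed.

Lemma rnorm_cexp z : rnorm (cexp z) = expR (complex.Re z).
Proof.
rewrite /cexp rnormM rnormC ger0_norm ?expR_ge0// rnormE Re_cart Im_cart.
by rewrite cos2Dsin2 sqrtr1 mulr1.
Qed.

Lemma cexp_neq0 z : cexp z != 0.
Proof.
by apply/eqP => z0; have := rnorm_cexp z; rewrite z0 rnorm0; move: (expR_gt0 (complex.Re z)) => /[swap] <-; rewrite ltxx.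
Qed.

Lemma cexp_2pi : cexp (iC * toC (2 * pi)) = 1.
Proof. by rewrite cexp_im mulr_natl cos2pi sin2pi rmorph0 rmorph1 mulr0 addr0. Qed.

Lemma cexpMn z n : cexp (z *+ n) = cexp z ^+ n.
Proof. by elim: n => [|n IH]; rewrite ?cexp0// mulrS exprS cexpD IH. Qed.

Lemma is_derive_rnorm (f : R -> R) (x D : R) : is_derive x 1 f D ->
  forall e, 0 < e -> exists2 d : R, 0 < d &
    forall h, `|h| < d -> `|f (x + h) - f x - D * h| <= e * `|h|.
Proof.
move=> df e e0.
have dfx : differentiable f x by apply/derivable1_diffP; exact: ex_derive.
have /eqaddoP/(_ _ e0) := diff_locally dfx.
move=> /nbhs_ballP[d /= d0 Hd]; exists d => // h hd.
have := Hd h; rewrite -ball_normE /= sub0r normrN => /(_ hd).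
rewrite !fctE /= diff1E// derive1E derive_val.
by rewrite [h + x]addrC opprD addrA [h *: D]mulrC.
Qed.

Lemma cexp_first_order e : 0 < e -> exists2 d : R, 0 < d &
  forall h, rnorm h < d -> rnorm (cexp h - 1 - h) <= e * rnorm h.
Proof.
move=> e0; pose e' := Num.min e 1 / 6.
have e'0 : 0 < e' by rewrite divr_gt0// lt_min e0 ltr01.
have e'6 : e' * 6 <= e by rewrite divfK// ge_min lexx.
have e'1 : e' <= 1.
  by rewrite ler_pdivrMr// mul1r ge_min ler1n orbT.
have [d1 d10 H1] := @is_derive_rnorm expR 0 1 (is_derive_eq (is_derive_expR 0) (expR0 R)) _ e'0.
have [d2 d20 H2] := is_derive_rnorm (is_derive_cos (0 : R)) e'0.
have [d3 d30 H3] := is_derive_rnorm (is_derive_sin (0 : R)) e'0.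
exists (Num.min (Num.min d1 (e' / 2)) (Num.min d2 d3)).
  by rewrite !lt_min d10 d20 d30 divr_gt0.
move=> h; rewrite !lt_min => /andP[/andP[h1 he] /andP[h2 h3]].
set s := complex.Re h; set t := complex.Im h.
have sh : `|s| <= rnorm h by exact: ler_Re_rnorm.
have th : `|t| <= rnorm h by exact: ler_Im_rnorm.
have := H1 s (le_lt_trans sh h1); rewrite add0r expR0 mul1r => Hs.
have := H2 t (le_lt_trans th h2); rewrite add0r cos0 sin0 oppr0 mul0r subr0 => Ht.
have := H3 t (le_lt_trans th h3); rewrite add0r cos0 sin0 subr0 mul1r => Ht'.
have es1 : `|expR s - 1| <= e'.
  have : `|expR s - 1| <= `|expR s - 1 - s| + `|s|.
    by rewrite -{1}[expR s - 1](subrK s) ler_normD.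
  have : e' * `|s| <= `|s| by rewrite ler_piMl.
  by lra.
have es2 : `|expR s| <= 2.
  have := ler_normD (expR s - 1) 1; rewrite subrK normr1; lra.
have -> : cexp h - 1 - h = toC (expR s - 1 - s) +
    (toC (expR s) * (toC (cos t - 1) + iC * toC (sin t - t)) +
     iC * toC ((expR s - 1) * t)).
  rewrite {2}[h]ReIm /cexp -/s -/t.
  by rewrite !(rmorphB toC) !(rmorphM toC) !(rmorphB toC) (rmorph1 toC); ring.
rewrite (le_trans (ler_rnormD _ _))// rnormC.
have A : rnorm (toC (expR s) * (toC (cos t - 1) + iC * toC (sin t - t))) <=
    2 * (e' * `|t| + e' * `|t|).
  rewrite rnormM rnormC ler_pM// ?rnorm_ge0//.
  by rewrite (le_trans (ler_rnormD _ _))// rnormM rnormi mul1r !rnormC lerD.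
have B : rnorm (iC * toC ((expR s - 1) * t)) <= e' * `|t|.
  by rewrite rnormM rnormi mul1r rnormC normrM ler_wpM2r.
have D := ler_rnormD (toC (expR s) * (toC (cos t - 1) + iC * toC (sin t - t)))
  (iC * toC ((expR s - 1) * t)).
have E1 : e' * `|s| <= e' * rnorm h by rewrite ler_wpM2l// ltW.
have E2 : e' * `|t| <= e' * rnorm h by rewrite ler_wpM2l// ltW.
have E3 : e' * 6 * rnorm h <= e * rnorm h by rewrite ler_wpM2r// rnorm_ge0.
lra.
Qed.

Lemma differentiable_cexp z : differentiable cexp z.
Proof.
pose l : C R -> C R := fun h => cexp z * h.
have ll : linear l by move=> a u v; rewrite /l /GRing.scale /=; ring.
pose l' : {linear C R -> C R} := HB.pack l (GRing.isLinear.Build _ _ _ _ l ll).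
apply: (@rnormP_differentiable _ _ _ cexp z l' (rnorm (cexp z)) _ _).1.
  by move=> h; rewrite /= rnormM.
move=> e e0; have z0 : 0 < rnorm (cexp z) by rewrite rnorm_gt0// cexp_neq0.
have [d d0 Hd] := cexp_first_order (divr_gt0 e0 z0).
exists d => // h /Hd hd; rewrite /= /l cexpD.
have -> : cexp z * cexp h - cexp z - cexp z * h = cexp z * (cexp h - 1 - h) by ring.
by rewrite rnormM mulrC -ler_pdivlMr// mulrAC.
Qed.

Lemma polar_form (z : C R) : exists2 t, 0 <= t <= 2 * pi &
  z = toC (rnorm z) * cexp (iC * toC t).
Proof.
have [->|z0] := eqVneq z 0.
  exists 0; first by rewrite lexx mulr_ge0// pi_ge0.
  by rewrite rnorm0 rmorph0 mul0r.
have n0 := rnorm_gt0 z0; set r := rnorm z; set x := complex.Re z / r.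
set y := complex.Im z / r.
have xy : x ^+ 2 + y ^+ 2 = 1.
  rewrite /x /y !expr_div_n -mulrDl -[_ + _](sqr_sqrtr (addr_ge0 (sqr_ge0 _) (sqr_ge0 _))).
  by rewrite -rnormE divff// expf_neq0// gt_eqF.
have x1 : -1 <= x <= 1.
  rewrite -ler_norml -(@expr_le1 _ 2)// real_normK ?num_real//.
  by rewrite -xy lerDl sqr_ge0.
have zE : z = toC r * (toC x + iC * toC y).
  rewrite {1}[z]ReIm /x /y !(rmorphM toC) fmorphV mulrDr mulrCA [iC * (_ * _)]mulrA.
  by rewrite [toC r * (_ * _)]mulrCA !divff ?toC_eq0 ?gt_eqF// !mulr1.
have sa : sin (acos x) = `|y|.
  rewrite sin_acos// -xy [x ^+ 2 + _]addrC addrK sqrtr_sqr//.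
have [y0|y0] := leP 0 y.
  exists (acos x).
    rewrite acos_ge0//= (le_trans (acos_lepi x1))// mulr_natl mulr2n lerDl pi_ge0//.
  by rewrite cexp_im sa ger0_norm// acosK// in_itv.
exists (2 * pi - acos x).
  have := acos_lepi x1; have := acos_ge0 x1; have := pi_ge0 R; lra.
rewrite cexp_im mulr_natl -[pi *+ 2 - _]addrC cosD2pi sinD2pi cosN sinN sa ltr0_norm// opprK.
by rewrite acosK// in_itv.
Qed.

End ComplexExponential.

(** * Means of periodic functions over vertical segments *)

Section PeriodicMeans.
Context {R : realType}.
Implicit Types (F : C R -> C R).

Definition line_mean F (N : nat) (z : C R) : C R :=
  toC (N%:R^-1) * \sum_(j < N) F (z + iC * toC (2 * pi * (j%:R / N%:R))).

Lemma differentiable_cart (V : normedModType R[i]) (F : C R -> V) (s t : R) :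
  differentiable F (toC s + iC * toC t) ->
  exists D : V, forall e, 0 < e -> exists2 d : R, 0 < d &
      forall s' t', `|s' - s| < d -> `|t' - t| < d ->
      rnorm (F (toC s' + iC * toC t') - F (toC s + iC * toC t) -
             (toC (s' - s) + iC * toC (t' - t)) *: D)
        <= e * (`|s' - s| + `|t' - t|).
Proof.
move=> /differentiable_rnormP[_ dF].
exists ('d F (toC s + iC * toC t) 1) => e e0; have [d d0 Hd] := dF e e0.
exists (d / 2); first by rewrite divr_gt0.
move=> s' t' ss' tt'; set h : C R := toC (s' - s) + iC * toC (t' - t).
have hst : rnorm h <= `|s' - s| + `|t' - t|.
  by rewrite (le_trans (ler_rnorm_ReIm _))// Re_cart Im_cart.
have hd : rnorm h < d by rewrite (le_lt_trans hst)// [d]splitr ltrD.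
have := Hd h hd; rewrite {1}/h.
have -> : toC s + iC * toC t + (toC (s' - s) + iC * toC (t' - t)) =
  toC s' + iC * toC t' by rewrite !rmorphB; ring.
have -> : 'd F (toC s + iC * toC t) h = h *: 'd F (toC s + iC * toC t) 1.
  by rewrite -linearZ /= /GRing.scale /= mulr1.
by move=> /le_trans; apply; rewrite ler_wpM2l// ltW.
Qed.

Lemma uniform_continuity_vertical F x :
  (forall s, differentiable F (toC x + iC * toC s)) ->
  forall A e, 0 <= A -> 0 < e -> exists2 d : R, 0 < d & forall t t', 0 <= t <= A ->
    `|t' - t| < d ->
    rnorm (F (toC x + iC * toC t') - F (toC x + iC * toC t)) <= e.
Proof.
move=> dF A e A0 e0; rewrite -[A]add0r.
apply: (@rectangle_bisection _ (fun x0 _ a _ => exists2 d : R, 0 < d &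
  forall t t', x0 <= t <= x0 + a -> `|t' - t| < d ->
  rnorm (F (toC x + iC * toC t') - F (toC x + iC * toC t)) <= e) 0 0 A 0) => //.
- move=> x1 _ a _ [d d0 Hd] [d' d'0 Hd'] _ _.
  exists (Num.min d d'); first by rewrite lt_min d0.
  move=> t t' /andP[xt tx]; rewrite lt_min => /andP[td td'].
  have [ta|ta] := leP t (x1 + a / 2); first by apply: Hd => //; rewrite xt.
  by apply: Hd' => //; rewrite ltW//=; lra.
- move=> s t0 _ _; have := differentiable_continuous (dF s).
  move=> /continuous_rnormP/(_ (e / 2))/(_ (divr_gt0 e0 (ltr0n R 2)))[d d0 Hd].
  have Hd' t : `|t - s| < d ->
      rnorm (F (toC x + iC * toC t) - F (toC x + iC * toC s)) < e / 2.
    move=> ts; apply: Hd; rewrite opprD addrACA subrr add0r -mulrBr -rmorphB.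
    by rewrite rnormM rnormi mul1r rnormC.
  exists (d / 2); first by rewrite divr_gt0.
  move=> x' _ k kd _ xs _; exists (d / 2); first by rewrite divr_gt0.
  move=> t t' xt tt'; have ts : `|t - s| < d / 2 by rewrite ltr_norml; lra.
  have t's : `|t' - s| < d by move: tt' ts; rewrite !ltr_norml; lra.
  rewrite (le_trans (ler_rdistD (F (toC x + iC * toC s)) _ _))// [e]splitr lerD//.
    by rewrite ltW// Hd'.
  by rewrite rdistC ltW// Hd'// (lt_trans ts)// ltr_pdivrMr// ltr_pMr// ltr1n.
Qed.

Lemma sum_even_odd (V : nmodType) (g : nat -> V) n :
  \sum_(j < n + n) g j = \sum_(j < n) g (j + j)%N + \sum_(j < n) g (j + j).+1.
Proof.
elim: n => [|n IH]; first by rewrite !big_ord0 addr0.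
rewrite addSn addnS !big_ord_recr /= IH.
by rewrite -addrA [RHS]addrACA.
Qed.

Section Periodic.
Variables (F : C R -> C R).
Hypothesis F_periodic : forall z, F (z + iC * toC (2 * pi)) = F z.

Lemma line_mean_shift N z : (0 < N)%N ->
  line_mean F N (z + iC * toC (2 * pi / N%:R)) = line_mean F N z.
Proof.
move=> N0; have NN : N%:R != 0 :> R by rewrite pnatr_eq0 -lt0n.
pose g j := F (z + iC * toC (2 * pi * (j%:R / N%:R))).
rewrite /line_mean; congr (_ * _).
transitivity (\sum_(j < N) g j.+1).
  apply: eq_bigr => j _; rewrite /g -addrA -mulrDr -rmorphD; congr (F (_ + _ * toC _)).
  by rewrite -natr1; ring.
rewrite -[RHS]/(\sum_(j < N) g j).
have gN : g N = g 0%N.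
  by rewrite /g divff// mulr1 F_periodic mul0r mulr0 rmorph0 mulr0 addr0.
case: N N0 g gN {NN} => // N _ g gN.
by rewrite big_ord_recr big_ord_recl /= gN addrC.
Qed.

Lemma line_mean_shifts N k z : (0 < N)%N ->
  line_mean F N (z + iC * toC (k%:R * (2 * pi / N%:R))) = line_mean F N z.
Proof.
move=> N0; elim: k z => [|k IH] z; first by rewrite mul0r rmorph0 mulr0 addr0.
rewrite -natr1 mulrDl mul1r rmorphD mulrDr addrA line_mean_shift//.
Qed.

Lemma line_mean_double N z : (0 < N)%N ->
  line_mean F (N + N) z =
  toC 2^-1 * (line_mean F N z + line_mean F N (z + iC * toC (pi / N%:R))).
Proof.
move=> N0; have NN : N%:R != 0 :> R by rewrite pnatr_eq0 -lt0n.
have NN2 : N%:R + N%:R != 0 :> R by rewrite -mulr2n mulrn_eq0.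
pose g j := F (z + iC * toC (2 * pi * (j%:R / (N + N)%:R))).
rewrite {1}/line_mean -[X in _ * X]/(\sum_(j < N + N) g j) sum_even_odd.
rewrite /line_mean -mulrDr mulrA -rmorphM; congr (toC _ * (_ + _)).
- by rewrite natrD; field; rewrite NN.
- apply: eq_bigr => j _; rewrite /g !natrD; congr (F (_ + _ * toC _)).
  by field; rewrite NN NN2.
- apply: eq_bigr => j _; rewrite /g -addrA -mulrDr -rmorphD.
  congr (F (_ + _ * toC _)).
  by rewrite -natr1 !natrD; field; rewrite NN NN2.
Qed.

(** The means of a periodic function converge: moving the base point by less
    than one step changes each term little, by a whole step changes nothing, and
    doubling the number of points averages two such means. *)
Lemma line_mean_cvg x : (forall s, differentiable F (toC x + iC * toC s)) ->
  exists c, forall t, 0 <= t ->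
    tends (fun p => line_mean F (2 ^ p) (toC x + iC * toC t)) c.
Proof.
move=> dF.
have pi0 := pi_gt0 R; have p20 : 0 < 2 * pi :> R by rewrite mulr_gt0.
have near_base e : 0 < e -> exists p0, forall N t, (2 ^ p0 <= N)%N -> 0 <= t ->
    rnorm (line_mean F N (toC x + iC * toC t) -
           line_mean F N (toC x)) <= e.
  move=> e0; have [|d d0 Hd] := @uniform_continuity_vertical F x dF (2 * pi) e _ e0.
    exact: ltW.
  have [p0 Hp0] := exists_dyadic_lt (2 * pi) d0; exists p0 => N t pN t0.
  have N0 : (0 < N)%N by rewrite (leq_trans _ pN)// expn_gt0.
  have N0' : 0 < N%:R :> R by rewrite ltr0n.
  pose h : R := 2 * pi / N%:R; have h0 : 0 < h by rewrite divr_gt0.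
  have hd : h < d.
    apply: le_lt_trans (Hp0 p0 (leqnn _)).
    rewrite ler_wpM2l ?(ltW p20)// lef_pV2 ?posrE ?exprn_gt0// -natrX ler_nat//.
  pose k := Num.truncn (t / h); pose s := t - k%:R * h.
  have /andP[ks sk] := truncn_itv (divr_ge0 t0 (ltW h0)).
  have s0 : 0 <= s by rewrite subr_ge0 -ler_pdivlMr.
  have sh : s < h by move: sk; rewrite ltr_pdivrMr// -natr1 /s -/k; lra.
  have -> : t = s + k%:R * h by rewrite /s subrK.
  rewrite rmorphD mulrDr addrA line_mean_shifts// /line_mean -mulrBr -sumrB.
  rewrite rnormM rnormC ger0_norm ?invr_ge0 ?(ltW N0')// ler_pdivrMl// [N%:R * e]mulr_natl.
  rewrite (le_trans (ler_rnorm_sum _ _ _))//.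
  rewrite -[X in _ <= _ *+ X]card_ord -sumr_const; apply: ler_sum => j _.
  rewrite -addrA -mulrDr -rmorphD; apply: Hd.
    rewrite mulr_ge0 ?(ltW p20) ?divr_ge0//= ler_piMr ?(ltW p20)//.
    by rewrite ler_pdivrMr// mul1r ler_nat ltnW.
  by rewrite addrK ger0_norm// (lt_trans sh).
have cauchy e : 0 < e -> exists p0, forall p t, (p0 <= p)%N -> 0 <= t ->
    rnorm (line_mean F (2 ^ p) (toC x + iC * toC t) -
           line_mean F (2 ^ p0) (toC x)) <= e.
  move=> /near_base[p0 Hp0]; exists p0 => p t /subnK <-.
  elim: (p - p0)%N t => {p} [|q IH] t t0; first exact: Hp0.
  rewrite addSn expnS mul2n -addnn line_mean_double ?expn_gt0//.
  have := IH t t0; have := IH (t + pi / (2 ^ (q + p0))%:R).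
  rewrite addr_ge0 ?divr_ge0 ?(ltW pi0)// rmorphD mulrDr addrA => /(_ isT).
  set u := line_mean F _ _; set w := line_mean F _ _; set v := line_mean F _ _.
  move=> uw vw; have -> : toC 2^-1 * (v + u) - w = toC 2^-1 * ((v - w) + (u - w)).
    have -> : toC 2^-1 = 2^-1 :> C R by rewrite fmorphV rmorph_nat.
    by field.
  rewrite rnormM rnormC ger0_norm ?invr_ge0// ler_pdivrMl//.
  by rewrite (le_trans (ler_rnormD _ _))// mulr_natl mulr2n lerD.
have [|c Hc] := @tends_cauchy _ (fun p => line_mean F (2 ^ p) (toC x)).
  move=> e /cauchy[p0 Hp0]; exists p0 => p pp0.
  by have := Hp0 p 0 pp0 (lexx 0); rewrite rmorph0 mulr0 addr0.
exists c => t t0 e e0; have e20 : 0 < e / 2 by rewrite divr_gt0.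
have [p0 Hp0] := cauchy _ e20; exists p0 => p pp0.
rewrite (le_trans (ler_rdistD (line_mean F (2 ^ p0) (toC x)) _ _))//.
rewrite [e]splitr lerD ?Hp0// rdistC.
apply: (tends_le Hc (N := p0)) => n np0.
by have := Hp0 n 0 np0 (lexx 0); rewrite rmorph0 mulr0 addr0.
Qed.

(** Goursat's theorem on a full period: the horizontal sides cancel, so the
    limit mean does not depend on the vertical line. *)
Lemma line_mean_const x a c c' : 0 < a ->
  (forall s t, x <= s <= x + a -> differentiable F (toC s + iC * toC t)) ->
  tends (fun p => line_mean F (2 ^ p) (toC x)) c ->
  tends (fun p => line_mean F (2 ^ p) (toC (x + a))) c' -> c = c'.
Proof.
move=> a0 dF xc xc'; apply/esym/eqP; rewrite -subr_eq0; apply/eqP.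
apply: (tends_unique (tendsB xc' xc)) => e e0.
have p20 : 0 < 2 * pi :> R by rewrite mulr_gt0 ?pi_gt0.
have ea : 0 < e / a by rewrite divr_gt0.
have [s t xs _|k0 Hk0] := @contour_sum_cvg0 R (fun s t => F (toC s + iC * toC t))
    x 0 a (2 * pi) (e / a) a0 p20 ea.
  have [D HD] := differentiable_cart (dF s t xs).
  exists D => e' /HD[d d0 Hd]; exists d => // s' t' ? ?.
  by rewrite [D * _]mulrC; exact: Hd.
exists k0 => k /Hk0; rewrite subr0.
set N := (2 ^ k)%N; have N0 : (0 < N)%N by rewrite expn_gt0.
have -> : contour_sum (fun s t => F (toC s + iC * toC t)) N x 0 a (2 * pi) =
    iC * toC (2 * pi) *
      (line_mean F N (toC (x + a)) - line_mean F N (toC x)).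
  rewrite /contour_sum add0r.
  have -> : left_sum (fun s => F (toC s + iC * toC (2 * pi))) N x a =
      left_sum (fun s => F (toC s + iC * toC 0)) N x a.
    by congr left_sum; apply/funext => s; rewrite F_periodic rmorph0 mulr0 addr0.
  rewrite subrr add0r -mulrA [toC _ * (_ - _)]mulrBr; congr (_ * (_ - _)).
    rewrite /left_sum /line_mean mulrA -rmorphM; congr (_ * _).
    by apply: eq_bigr => j _; rewrite add0r.
  rewrite /left_sum /line_mean mulrA -rmorphM; congr (_ * _).
  by apply: eq_bigr => j _; rewrite add0r.
rewrite !rnormM rnormi mul1r rnormC gtr0_norm//.
have -> : e / a * (a * (2 * pi)) = 2 * pi * e by field; rewrite gt_eqF.
by rewrite ler_pM2l.
Qed.

End Periodic.
End PeriodicMeans.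

(** * Geometric series *)

Section GeometricTails.
Context {R : realType}.

Lemma geometric_tail (u : nat -> C R) (K q : R) (m n : nat) :
  0 <= q < 1 -> (forall i, rnorm (u i) <= K * q ^+ i) -> (m <= n)%N ->
  rnorm (\sum_(i < n) u i - \sum_(i < m) u i) <= K * q ^+ m / (1 - q).
Proof.
move=> /andP[q0 q1] uK mn; have q1' : 0 < 1 - q by rewrite subr_gt0.
have K0 : 0 <= K by have := uK 0%N; rewrite expr0 mulr1; exact: le_trans (rnorm_ge0 _).
rewrite ler_pdivlMr//.
suff : rnorm (\sum_(i < n) u i - \sum_(i < m) u i) * (1 - q) <=
    K * q ^+ m - K * q ^+ n.
  by move=> /le_trans; apply; rewrite gerBl mulr_ge0// exprn_ge0.
rewrite -(subnK mn); elim: (n - m)%N => [|k IH].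
  by rewrite add0n !subrr rnorm0 mul0r.
rewrite addSn big_ord_recr /= -addrA [u _ + _]addrC addrA.
have := ler_rnormD (\sum_(i < k + m) u i - \sum_(i < m) u i) (u (k + m)%N).
rewrite -(ler_pM2r q1') => /le_trans; apply; rewrite mulrDl.
apply: le_trans (lerD IH (ler_wpM2r (ltW q1') (uK _))) _.
by rewrite exprS; lra.
Qed.

Lemma expr_cvg0 (K q e : R) : 0 <= q < 1 -> 0 < e ->
  exists N, forall n, (N <= n)%N -> K * q ^+ n <= e.
Proof.
move=> /andP[q0 q1] e0.
have K0 : 0 < `|K| + 1 by rewrite ltr_wpDl.
have /cvgrPdist_le/(_ (e / (`|K| + 1)))/(_ (divr_gt0 e0 K0)) :
    (fun n => q ^+ n) @ \oo --> (0 : R).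
  by apply: cvg_expr; rewrite ger0_norm.
move=> [N _ HN]; exists N => n /HN /=.
rewrite sub0r normrN ger0_norm ?exprn_ge0// ler_pdivlMr// mulrC; apply: le_trans.
by rewrite ler_wpM2r ?exprn_ge0// (le_trans (ler_norm _))// lerDl.
Qed.

Lemma geometric_tends (u : nat -> C R) (K q : R) :
  0 <= q < 1 -> (forall i, rnorm (u i) <= K * q ^+ i) ->
  exists2 s, tends (fun n => \sum_(i < n) u i) s &
    forall m, rnorm (s - \sum_(i < m) u i) <= K * q ^+ m / (1 - q).
Proof.
move=> q01 uK; have [|s us] := @tends_cauchy _ (fun n => \sum_(i < n) u i).
  move=> e e0; have [N HN] := expr_cvg0 (K / (1 - q)) q01 e0.
  exists N => n Nn; apply: le_trans (geometric_tail q01 uK Nn) _.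
  by rewrite mulrAC HN.
exists s => // m; apply: (tends_le us (N := m)) => n mn.
exact: geometric_tail.
Qed.

End GeometricTails.

(** * Averages over roots of unity *)

Section RootsOfUnity.
Context {R : realType}.
Implicit Types (N : nat) (g : nat -> C R).

Definition unity N : C R := cexp (iC * toC (2 * pi / N%:R)).

Lemma unity_neq0 N : unity N != 0.
Proof. exact: cexp_neq0. Qed.

Lemma rnorm_unity N : rnorm (unity N) = 1.
Proof.
rewrite rnorm_cexp -[iC * _]add0r -[X in X + _](rmorph0 toC) Re_cart.
exact: expR0.
Qed.

Lemma unityX N k : unity N ^+ k = cexp (iC * toC (2 * pi * (k%:R / N%:R))).
Proof.
rewrite -cexpMn -mulrnAr -rmorphMn; congr (cexp (_ * toC _)).
by rewrite -mulr_natr; ring.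
Qed.

Lemma unityXN N : (0 < N)%N -> unity N ^+ N = 1.
Proof.
by move=> N0; rewrite unityX divff ?mulr1 ?cexp_2pi// pnatr_eq0 -lt0n.
Qed.

Lemma cexp_im_neq1 (t : R) : 0 < t < 2 * pi -> cexp (iC * toC t) != 1.
Proof.
move=> /andP[t0 tp]; apply/eqP => tE.
have : cexp (iC * toC (t / 2)) ^+ 2 = 1.
  rewrite -cexpMn -mulrnAr -rmorphMn -tE; congr (cexp (_ * toC _)).
  by rewrite -mulr_natr divfK.
move=> /eqP; rewrite sqrf_eq1 cexp_im => th.
have : sin (t / 2) = 0.
  by rewrite -(Im_cart (cos (t / 2)) (sin (t / 2))); case/orP: th => /eqP ->; rewrite /= ?oppr0.
have /sin_gt0_pi : 0 < t / 2 < pi.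
  by rewrite divr_gt0//= ltr_pdivrMr// mulrC.
by move=> /gt_eqF/eqP.
Qed.

Lemma unityX_neq1 N k : (0 < k < N)%N -> unity N ^+ k != 1.
Proof.
move=> /andP[k0 kN]; rewrite unityX; apply: cexp_im_neq1.
have N0 : 0 < N%:R :> R by rewrite ltr0n (ltn_trans k0).
have p0 : 0 < 2 * pi :> R by rewrite mulr_gt0// pi_gt0.
apply/andP; split; first by rewrite mulr_gt0// divr_gt0// ltr0n.
by rewrite gtr_pMr// ltr_pdivrMr// mul1r ltr_nat.
Qed.

Definition average N g : C R := toC N%:R^-1 * \sum_(j < N) g j.

Lemma averageD N g h : average N (fun j => g j + h j) = average N g + average N h.
Proof. by rewrite /average big_split mulrDr. Qed.

Lemma averageMl N c g : average N (fun j => c * g j) = c * average N g.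
Proof. by rewrite /average -mulr_sumr mulrCA. Qed.

Lemma averageMr N c g : average N (fun j => g j * c) = average N g * c.
Proof. by rewrite /average -mulr_suml mulrA. Qed.

Lemma average_sum N (I : finType) (g : I -> nat -> C R) :
  average N (fun j => \sum_i g i j) = \sum_i average N (g i).
Proof. by rewrite /average exchange_big /= mulr_sumr. Qed.

Lemma average_cst N c : (0 < N)%N -> average N (fun=> c) = c.
Proof.
move=> N0; rewrite /average sumr_const card_ord -[c *+ N]mulr_natl mulrA.
rewrite -(rmorph_nat toC) -rmorphM mulVf ?rmorph1 ?mul1r//.
by rewrite pnatr_eq0 -lt0n.
Qed.

Lemma ler_average N g (v : nat -> R) (M : R) : (0 < N)%N ->
  (forall j, rnorm (g j) <= v j) -> \sum_(j < N) v j <= N%:R * M ->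
  rnorm (average N g) <= M.
Proof.
move=> N0 gv vM; rewrite /average rnormM rnormC ger0_norm ?invr_ge0//.
rewrite ler_pdivrMl ?ltr0n// (le_trans (ler_rnorm_sum _ _ _))//.
by apply: le_trans vM; apply: ler_sum.
Qed.

Lemma ler_average_cst N g (M : R) : (0 < N)%N ->
  (forall j, rnorm (g j) <= M) -> rnorm (average N g) <= M.
Proof.
move=> N0 gM; apply: (ler_average (v := fun=> M)) => //.
by rewrite sumr_const card_ord mulr_natl.
Qed.

Lemma average_geometric N (z : C R) : (0 < N)%N -> z ^+ N = 1 -> z != 1 ->
  average N (fun j => z ^+ j) = 0.
Proof.
move=> N0 zN z1; rewrite /average.
suff -> : \sum_(j < N) z ^+ j = 0 by rewrite mulr0.
have z10 : z - 1 != 0 by rewrite subr_eq0.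
by apply: (mulfI z10); rewrite -subrX1 zN subrr mulr0.
Qed.

Lemma average_unity N a b : (a < N)%N -> (b < N)%N ->
  average N (fun j => unity N ^+ (a * j) * (unity N ^+ (b * j))^-1) = (a == b)%:R.
Proof.
move=> aN bN; have N0 : (0 < N)%N by apply: leq_trans aN.
have w0 := unity_neq0 N.
have [->|ab] := eqVneq a b.
  under [X in average _ X]funext => j do rewrite divff ?expf_neq0//.
  exact: average_cst.
pose z := unity N ^+ a / unity N ^+ b.
under [X in average _ X]funext => j.
  rewrite (_ : _ / _ = z ^+ j); last by rewrite /z expr_div_n -!exprM.
  over.
apply: average_geometric => //.
  by rewrite /z expr_div_n -!exprM mulnC exprM unityXN// expr1n mulnC exprM unityXN// expr1n divr1.
rewrite -subr_eq0 /z; case/orP: (leq_total a b) => le.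
- have ba : (0 < b - a < N)%N.
    rewrite subn_gt0 ltn_neqAle ab le /= (leq_ltn_trans (leq_subr _ _))//.
  have := unityX_neq1 ba; apply: contra => /eqP/subr0_eq.
  move=> /(congr1 (fun x => x * unity N ^+ b)).
  rewrite divfK ?expf_neq0// mul1r -[in RHS](subnK le) exprD => /eqP.
  by rewrite eq_sym -subr_eq0 -{2}[unity N ^+ a]mul1r -mulrBl mulf_eq0 subr_eq0 expf_eq0 (negPf w0) andbF orbF.
- have ba : (0 < a - b < N)%N.
    rewrite subn_gt0 ltn_neqAle eq_sym ab le /= (leq_ltn_trans (leq_subr _ _))//.
  have := unityX_neq1 ba; apply: contra => /eqP/subr0_eq.
  by rewrite -[in X in X / _](subnK le) exprD mulfK ?expf_neq0// => ->.
Qed.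

End RootsOfUnity.

(** * Means over circles *)

Section CircleMeans.
Context {R : realType}.
Implicit Types (f psi : C R -> C R).

Definition circle_mean psi N (z : C R) : C R :=
  average N (fun j => psi (z * unity N ^+ j)).

Lemma circle_mean_cexp psi N (z : C R) :
  circle_mean psi N (cexp z) = line_mean (psi \o cexp) N z.
Proof.
rewrite /circle_mean /line_mean /average; congr (_ * _).
by apply: eq_bigr => j _; rewrite unityX -cexpD.
Qed.

(** The exponential carries vertical segments of length 2 pi to circles about 0,
    so Goursat's theorem makes the limit mean the same for all circles. The point
    0 is left out, so that [psi] may be a function divided by a power of z. *)
Lemma circle_mean_cvg psi (rho : R) :
  (forall z, 0 < rnorm z < rho -> differentiable psi z) ->
  exists c, forall z, 0 < rnorm z < rho ->
    tends (fun p => circle_mean psi (2 ^ p) z) c.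
Proof.
move=> dpsi; have [rho0|rho0] := leP rho 0.
  by exists 0 => z /andP[z0 zr]; have := lt_trans z0 (lt_le_trans zr rho0); rewrite ltxx.
pose F := psi \o cexp.
have Fp z : F (z + iC * toC (2 * pi)) = F z by rewrite /F /= cexpD cexp_2pi mulr1.
have dF s t : s < ln rho -> differentiable F (toC s + iC * toC t).
  move=> srho; apply: differentiable_comp; first exact: differentiable_cexp.
  apply: dpsi; rewrite rnorm_cexp Re_cart expR_gt0/=.
  by rewrite -(lnK rho0) ltr_expR.
have [//|c0 Hc0] := line_mean_cvg Fp (x := ln rho - 1) => [s|].
  by apply: dF; rewrite ltrBlDr ltrDl.
have base x c : (forall t, 0 <= t ->
    tends (fun p => line_mean F (2 ^ p) (toC x + iC * toC t)) c) ->
    tends (fun p => line_mean F (2 ^ p) (toC x)) c.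
  by move=> /(_ 0 (lexx _)); rewrite rmorph0 mulr0 addr0.
exists c0 => z /andP[z0 zrho]; have [t /andP[t0 _] zE] := polar_form z.
set x := ln (rnorm z); have xE : toC (rnorm z) = cexp (toC x).
  by rewrite cexp_toC lnK.
have xrho : x < ln rho by rewrite ltr_ln.
have [|c Hc] := line_mean_cvg Fp (x := x) => [s|]; first exact: dF.
have -> : c0 = c.
  have [xl|xl|xE'] := ltgtP x (ln rho - 1).
  - apply/esym; apply: (@line_mean_const _ F Fp x (ln rho - 1 - x)).
    + by rewrite subr_gt0.
    + move=> s t' /andP[_]; rewrite addrC subrK => sx.
      by apply: dF; rewrite (le_lt_trans sx)// ltrBlDr ltrDl.
    + exact: base.
    + by rewrite addrC subrK; exact: base.
  - apply: (@line_mean_const _ F Fp (ln rho - 1) (x - (ln rho - 1))).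
    + by rewrite subr_gt0.
    + move=> s t' /andP[_]; rewrite addrC subrK => sx.
      by apply: dF; rewrite (le_lt_trans sx).
    + exact: base.
    + by rewrite addrC subrK; exact: base.
  - apply: (tends_unique (base _ _ Hc0)); rewrite -xE'; exact: base.
rewrite zE xE -cexpD.
by apply: tends_ext (Hc t t0) => p; rewrite circle_mean_cexp.
Qed.

Lemma differentiable_bounded_circle f (r : R) :
  (forall z, rnorm z = r -> differentiable f z) ->
  exists M, forall z, rnorm z = r -> rnorm (f z) <= M.
Proof.
move=> df; have [r0|r0] := leP r 0.
  exists (rnorm (f 0)) => z zr; rewrite [z](@rnorm0_eq0 _ (C R))//.
  by apply/eqP; rewrite eq_le rnorm_ge0 zr r0.
pose e t := toC r * cexp (iC * toC t).
have re t : rnorm (e t) = r.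
  rewrite rnormM rnormC gtr0_norm// rnorm_cexp (_ : iC * _ = toC 0 + iC * toC t).
    by rewrite Re_cart expR0 mulr1.
  by rewrite rmorph0 add0r.
have [M HM] : exists M, forall t, 0 <= t <= 0 + 2 * pi -> rnorm (f (e t)) <= M.
  have p0 : 0 <= 2 * pi :> R by rewrite mulr_ge0// pi_ge0.
  apply: (@rectangle_bisection _ (fun x _ a _ => exists M, forall t,
    x <= t <= x + a -> rnorm (f (e t)) <= M) 0 0 (2 * pi) 0) => //.
  - move=> x _ a _ [M HM] [M' HM'] _ _; exists (Num.max M M') => t /andP[xt tx].
    rewrite le_max; have [ta|ta] := leP t (x + a / 2).
      by rewrite HM// xt.
    by rewrite HM' ?orbT// ltW//=; lra.
  - move=> s t0 _ _.
    have ds : differentiable (f \o (fun z => toC r * cexp z)) (iC * toC s).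
      apply: differentiable_comp; last by apply: df; exact: re.
      exact: (differentiableZ (toC r) (differentiable_cexp _)).
    have /continuous_rnormP/(_ 1 ltr01)[d d0 Hd] := differentiable_continuous ds.
    exists d => // x' _ k kd _ xs _; exists (rnorm (f (e s)) + 1) => t xt.
    have -> : f (e t) = (f (e t) - f (e s)) + f (e s) by rewrite subrK.
    rewrite (le_trans (ler_rnormD _ _))// addrC lerD// ltW//.
    have := Hd (iC * toC t); rewrite /= -mulrBr -rmorphB rnormM rnormi mul1r rnormC.
    by apply; rewrite ltr_norml; lra.
exists M => z zr; have [t tp ->] := polar_form z.
by rewrite zr; apply: HM; rewrite add0r.
Qed.

End CircleMeans.

(** * Complex conjugation *)

Section Conjugation.
Context {R : realType}.
Implicit Types (z w : C R).

Definition cconj z : C R := conjc z.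

Lemma conjD z w : cconj (z + w) = cconj z + cconj w.
Proof. exact: (rmorphD (@conjc R)). Qed.

Lemma conj0 : cconj 0 = 0.
Proof. exact: (rmorph0 (@conjc R)). Qed.

Lemma mul_conj z : z * cconj z = toC (rnorm z ^+ 2).
Proof.
rewrite rmorphXn /cconj -[LHS]sqr_normc.
exact: (congr1 (fun x => x ^+ 2) (normE (z : C R))).
Qed.

Lemma conj_unity z : rnorm z = 1 -> cconj z = z^-1.
Proof.
move=> z1; have z0 : z != 0.
  by apply/eqP => z0; move: z1; rewrite z0 rnorm0 => /esym/eqP; rewrite oner_eq0.
by apply: (mulfI z0); rewrite mul_conj z1 expr1n rmorph1 mulfV.
Qed.

Lemma conj_sum (I : Type) (s : seq I) (F : I -> C R) :
  cconj (\sum_(i <- s) F i) = \sum_(i <- s) cconj (F i).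
Proof. by apply: (big_morph cconj conjD conj0). Qed.

End Conjugation.

(** * Power series of functions differentiable on a disc *)

Section TaylorSeries.
Context {R : realType}.
Implicit Types (f : C R -> C R).

Definition psum (a : nat -> C R) f (T : R) : Prop :=
  forall z : C R, rnorm z < T -> tends (fun n => \sum_(i < n) a i * z ^+ i) (f z).

(** The means of f(w) / w^k and of f(w) w^k over circles do not depend on the
    radius; for the second function the limit vanishes, as small circles show. *)
Lemma taylor_coefficients f (rho : R) :
  (forall z, rnorm z < rho -> differentiable f z) ->
  exists a : nat -> C R, forall z : C R, 0 < rnorm z < rho ->
   (forall k, tends (fun p => average (2 ^ p) (fun j =>
     f (z * unity (2 ^ p) ^+ j) * (unity (2 ^ p) ^+ (k * j))^-1)) (a k * z ^+ k)) /\
   (forall k, (0 < k)%N -> tends (fun p => average (2 ^ p) (fun j =>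
     f (z * unity (2 ^ p) ^+ j) * unity (2 ^ p) ^+ (k * j))) 0).
Proof.
move=> df.
have dX k (z : C R) : differentiable (fun w : C R => w ^+ k : C R) z.
  elim: k => [|k IH].
    by rewrite (_ : (fun w => _) = cst 1)//; apply/funext => w; rewrite expr0.
  rewrite (_ : (fun w => _) = id * (fun w => w ^+ k)); last first.
    by apply/funext => w; rewrite exprS.
  exact: (@differentiableM _ _ id (fun w => w ^+ k)).
have pos k : exists c, forall z, 0 < rnorm z < rho ->
    tends (fun p => circle_mean (fun w => f w * (w ^+ k)^-1) (2 ^ p) z) c.
  apply: circle_mean_cvg => z /andP[z0 zrho].
  apply: (@differentiableM _ _ f (fun w => (w ^+ k)^-1)); first exact: df.
  apply: (@differentiableV R[i] (C R) (fun w => w ^+ k) z (dX k z)).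
  by rewrite expf_neq0//; apply/eqP => zE; move: z0; rewrite zE rnorm0 ltxx.
have [a Ha] := choice pos; exists a => z zrho; split=> k.
  have z0 : z != 0.
    by apply/eqP => zE; move: zrho; rewrite zE rnorm0 ltxx.
  have := tendsMl (z ^+ k) (Ha k z zrho); rewrite mulrC.
  apply: tends_ext => p; rewrite /circle_mean -averageMl; congr average.
  apply/funext => j; rewrite [(z * _) ^+ k]exprMn invfM -exprM [(j * k)%N]mulnC.
  by rewrite mulrCA [z ^+ k * _]mulrA mulfV ?expf_neq0// mul1r.
move=> k0.
have [c Hc] : exists c, forall z, 0 < rnorm z < rho ->
    tends (fun p => circle_mean (fun w => f w * w ^+ k) (2 ^ p) z) c.
  apply: circle_mean_cvg => w /andP[w0 wrho].
  by apply: (@differentiableM _ _ f (fun w => w ^+ k)); [exact: df|exact: dX].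
have rho0 : 0 < rho by case/andP: zrho => ? /(lt_trans _); apply.
have c0 : c = 0.
  have /differentiable_continuous/continuous_rnormP/(_ 1 ltr01)[d d0 Hd] :=
    df 0 (eq_ind_r (fun x => is_true (x < rho)) rho0 rnorm0).
  apply: rnorm0_eq0; apply/eqP; rewrite eq_le rnorm_ge0 andbT.
  apply: ler_addgt0 => e e0; rewrite add0r.
  set B := rnorm (f 0) + 1; have B0 : 0 < B by rewrite ltr_wpDl// rnorm_ge0.
  set t := Num.min (Num.min (d / 2) (rho / 2)) (Num.min 1 (e / B)).
  have t0 : 0 < t by rewrite !lt_min !divr_gt0 // ltr01.
  have td : t < d.
    by rewrite !gt_min (_ : d / 2 < d)// ltr_pdivrMr// ltr_pMr// ltr1n.
  have trho : t < rho.
    by rewrite !gt_min (_ : rho / 2 < rho) ?orbT// ltr_pdivrMr// ltr_pMr// ltr1n.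
  have t1 : t <= 1 by rewrite !ge_min lexx !orbT.
  have te : t <= e / B by rewrite !ge_min lexx !orbT.
  have nt : rnorm (toC t) = t by rewrite rnormC gtr0_norm.
  have /Hc Hct : 0 < rnorm (toC t) < rho by rewrite nt t0.
  apply: (tends_le0 Hct (N := 0)) => p _.
  apply: ler_average_cst; rewrite ?expn_gt0// => j.
  have nw : rnorm (toC t * unity (2 ^ p) ^+ j) = t.
    by rewrite rnormM rnormX rnorm_unity expr1n mulr1.
  rewrite rnormM rnormX nw.
  have fB : rnorm (f (toC t * unity (2 ^ p) ^+ j)) <= B.
    rewrite -[f _](subrK (f 0)) (le_trans (ler_rnormD _ _))// addrC lerD//.
    by apply/ltW/Hd; rewrite subr0 nw.
  have tk : t ^+ k <= t by rewrite -{2}[t]expr1 ler_wiXn2l// ltW.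
  rewrite (le_trans (ler_pM (rnorm_ge0 _) _ fB tk)) ?exprn_ge0// ?(ltW t0)//.
  by rewrite mulrC -ler_pdivlMr.
have := tendsMl (z ^- k) (Hc z zrho); rewrite c0 mulr0.
have z0 : z != 0.
  by apply/eqP => zE; move: zrho; rewrite zE rnorm0 ltxx.
apply: tends_ext => p; rewrite /circle_mean -averageMl; congr average.
apply/funext => j; rewrite [(z * _) ^+ k]exprMn -exprM [(j * k)%N]mulnC.
by rewrite mulrCA [z ^- k * _]mulrA mulVf ?expf_neq0// mul1r.
Qed.

Definition dirichlet (K N j : nat) : C R := \sum_(a < K) unity N ^+ (a * j).

Lemma mul_conj_dirichlet K N j : dirichlet K N j * cconj (dirichlet K N j) =
  \sum_(a < K) \sum_(b < K) unity N ^+ (a * j) * (unity N ^+ (b * j))^-1.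
Proof.
rewrite /dirichlet conj_sum mulr_suml; apply: eq_bigr => a _.
rewrite mulr_sumr; apply: eq_bigr => b _; rewrite conj_unity//.
by rewrite rnormX rnorm_unity expr1n.
Qed.

Lemma average_fejer K N : (K <= N)%N ->
  average N (fun j => dirichlet K N j * cconj (dirichlet K N j)) = K%:R.
Proof.
move=> KN; under [X in average _ X]funext => j do rewrite mul_conj_dirichlet.
rewrite average_sum.
under eq_bigr => a _.
  rewrite average_sum (bigD1 a)//= average_unity ?(leq_trans (ltn_ord _))// eqxx.
  rewrite big1 => [|b ba]; last first.
    rewrite average_unity ?(leq_trans (ltn_ord _))//.
    by rewrite (_ : (_ == _) = false)//; apply/negbTE; rewrite eq_sym.
  rewrite addr0; over.
by rewrite sumr_const card_ord.
Qed.

Lemma sum_sqr_dirichlet K N : (0 < N)%N -> (K <= N)%N ->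
  \sum_(j < N) rnorm (dirichlet K N j) ^+ 2 = N%:R * K%:R.
Proof.
move=> N0 /average_fejer; rewrite /average => KE.
have NN : toC N%:R != 0 :> C R by rewrite toC_eq0 pnatr_eq0 -lt0n.
apply: (fmorph_inj (@toC R)); rewrite rmorphM !rmorph_nat -KE rmorph_sum.
rewrite fmorphV rmorph_nat mulrA mulfV ?mul1r -?(rmorph_nat toC)//.
by apply: eq_bigr => j _; rewrite mul_conj.
Qed.

Lemma unity_sub1_dirichlet K N j :
  rnorm (unity N ^+ j - 1) * rnorm (dirichlet K N j) <= 2.
Proof.
rewrite -rnormM (_ : _ * _ = (unity N ^+ j) ^+ K - 1); last first.
  by rewrite [RHS]subrX1; congr (_ * _); apply: eq_bigr => a _; rewrite -exprM mulnC.
rewrite (le_trans (ler_rnormB _ _))// !rnormX rnorm_unity !expr1n rnorm1.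
by rewrite -natr1.
Qed.

Lemma partial_sums_diagonal (u : nat -> C R) K :
  \sum_(a < K) \sum_(b < K) (if (a <= b)%N then u (b - a)%N else 0) =
  \sum_(b < K) \sum_(i < b.+1) u i.
Proof.
rewrite exchange_big /=; apply: eq_bigr => b _.
transitivity (\sum_(i < b.+1) u (b - i)%N).
  by rewrite (big_ord_widen K (fun i => u (b - i)%N) (ltn_ord b)) [RHS]big_mkcond.
by rewrite (reindex_inj rev_ord_inj); apply: eq_bigr => i _ /=; rewrite subSS subKn// -ltnS.
Qed.

(** Convolution with Fejer kernels on regular polygons expresses the Cesaro means
    of the series through values of [f]. These means tend to the sum of the
    series, which converges geometrically, and to [f z], since the kernels
    concentrate at 1. *)
Theorem taylor_series f (rho : R) :
  (forall z, rnorm z < rho -> differentiable f z) -> exists a, psum a f rho.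
Proof.
move=> df; have [a Ha] := taylor_coefficients df; exists a => z zrho.
have dfc (r : R) : r < rho -> exists M, forall w, rnorm w = r -> rnorm (f w) <= M.
  by move=> rr; apply: differentiable_bounded_circle => w wr; apply: df; rewrite wr.
have rho0 : 0 < rho by exact: le_lt_trans (rnorm_ge0 _) zrho.
(* A circle between z and the boundary gives geometric bounds. *)
pose r := (rnorm z + rho) / 2.
have zr : rnorm z < r by rewrite /r; lra.
have rrho : r < rho by rewrite /r; lra.
have r0 : 0 < r by exact: le_lt_trans (rnorm_ge0 _) zr.
have [M HM] := dfc r rrho.
have ar k : rnorm (a k) * r ^+ k <= M.
  have nr : rnorm (toC r) = r by rewrite rnormC gtr0_norm.
  have [|/(_ k) ark _] := Ha (toC r); first by rewrite nr r0.
  rewrite -{1}nr -rnormX -rnormM; apply: (tends_le0 ark (N := 0)) => p _.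
  apply: ler_average_cst; rewrite ?expn_gt0// => j.
  rewrite rnormM rnormV rnormX rnorm_unity expr1n invr1 mulr1; apply: HM.
  by rewrite rnormM rnormX rnorm_unity expr1n mulr1.
have M0 : 0 <= M by have := ar 0%N; rewrite expr0 mulr1; exact: le_trans (rnorm_ge0 _).
pose q := rnorm z / r.
have q01 : 0 <= q < 1 by rewrite divr_ge0 ?rnorm_ge0 ?(ltW r0)//= ltr_pdivrMr// mul1r.
have M1 : 0 <= M / (1 - q).
  by rewrite divr_ge0// subr_ge0; case/andP: q01 => _ /ltW.
have uq k : rnorm (a k * z ^+ k) <= M * q ^+ k.
  rewrite rnormM rnormX /q expr_div_n mulrA mulrAC ler_wpM2r ?exprn_ge0 ?rnorm_ge0//.
  by rewrite ler_pdivlMr// exprn_gt0.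
have [s us Hs] := geometric_tends q01 uq.
suff -> : f z = s by [].
have [z0|z0] := eqVneq z 0.
  have -> : s = a 0%N.
    apply: (tends_unique us) => e e0; exists 1%N => -[//|n] _.
    rewrite big_ord_recl expr0 mulr1 big1 => [|i _]; last first.
      by rewrite z0 exprS mul0r mulr0.
    by rewrite addr0 subrr rnorm0 ltW.
  (* The mean over a small circle is close to f 0 and has limit a 0. *)
  apply/esym/eqP; rewrite -subr_eq0; apply/eqP/rnorm0_eq0/eqP.
  rewrite eq_le rnorm_ge0 andbT; apply: ler_addgt0 => e e0; rewrite add0r.
  have /differentiable_continuous/continuous_rnormP/(_ e e0)[d d0 Hd] := df z zrho.
  pose t := Num.min d rho / 2.
  have m0 : 0 < Num.min d rho by rewrite lt_min d0.
  have tm : t < Num.min d rho by rewrite ltr_pdivrMr// ltr_pMr// ltr1n.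
  move: tm; rewrite lt_min => /andP[td trho].
  have t0 : 0 < t by rewrite divr_gt0.
  have nt : rnorm (toC t) = t by rewrite rnormC gtr0_norm.
  have [|/(_ 0%N) at0 _] := Ha (toC t); first by rewrite nt t0.
  rewrite expr0 mulr1 in at0; apply: (tends_le at0 (N := 0)) => p _.
  have N0 : (0 < 2 ^ p)%N by rewrite expn_gt0.
  rewrite -[X in _ - X](average_cst _ N0) -[- average _ _]mulN1r -averageMl -averageD.
  apply: ler_average_cst => // j.
  rewrite mul0n expr0 invr1 mulr1 mulN1r; apply/ltW/Hd; rewrite z0 subr0.
  by rewrite rnormM rnormX rnorm_unity expr1n mulr1 nt.
have z0' : 0 < rnorm z by exact: rnorm_gt0.
have [|posz negz] := Ha z; first by rewrite z0'.
(* A Lipschitz bound at z along the circle: the differential controls the points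
   near z, the maximum of f the others. *)
have [L L0 HL] : exists2 L, 0 <= L & forall w, rnorm w = rnorm z ->
    rnorm (f w - f z) <= L * rnorm (w - z).
  have [M' HM'] := dfc _ zrho.
  have [[K K0 HK] /(_ 1 ltr01)[d d0 Hd]] := differentiable_rnormP (df z zrho).
  have M'0 : 0 <= M' by exact: le_trans (rnorm_ge0 _) (HM' z erefl).
  have L20 : 0 <= M' + M' by rewrite addr_ge0.
  exists (1 + K + (M' + M') / d); first by rewrite !addr_ge0// divr_ge0// ltW.
  move=> w wz; have [wd|wd] := ltP (rnorm (w - z)) d.
    have := Hd _ wd; rewrite [z + (w - z)]addrC subrK => Hw.
    rewrite -[f w - f z](subrK ('d f z (w - z))).
    rewrite (le_trans (ler_rnormD _ _))// (le_trans (lerD Hw (HK _)))//.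
    by rewrite -mulrDl ler_wpM2r ?rnorm_ge0// lerDl divr_ge0// ltW.
  apply: (@le_trans _ _ (M' + M')).
    by rewrite (le_trans (ler_rnormB _ _))// lerD// HM'.
  rewrite mulrDl ler_wpDl//; first by rewrite mulr_ge0 ?rnorm_ge0// addr_ge0.
  by rewrite mulrAC ler_pdivlMr// ler_wpM2l.
set A := 2 * (L * rnorm z); have A0 : 0 <= A by rewrite !mulr_ge0// rnorm_ge0.
set B := M / (1 - q) / (1 - q).
(* The sum of the first n^2 partial sums is within O(n) of n^2 f z and within
   O(1) of n^2 s. *)
have bound (n : nat) : (0 < n)%N -> n%:R ^+ 2 * rnorm (f z - s) <= A * n%:R + B.
  move=> n0; have n0' : 0 < n%:R :> R by rewrite ltr0n.
  set K := (n * n)%N; have KE : K%:R = n%:R ^+ 2 :> R by rewrite natrM.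
  pose G b c := if (b <= c)%N then a (c - b)%N * z ^+ (c - b) else 0.
  have fejer : tends (fun p => average (2 ^ p) (fun j =>
      f (z * unity (2 ^ p) ^+ j) *
      (dirichlet K (2 ^ p) j * cconj (dirichlet K (2 ^ p) j))))
      (\sum_(b < K) \sum_(c < K) G b c).
    apply: (tends_ext (u := fun p => \sum_(b < K) \sum_(c < K)
      average (2 ^ p) (fun j => f (z * unity (2 ^ p) ^+ j) *
        (unity (2 ^ p) ^+ (b * j) * (unity (2 ^ p) ^+ (c * j))^-1)))).
      move=> p; under eq_bigr do rewrite -average_sum.
      rewrite -average_sum; congr average; apply/funext => j.
      rewrite mul_conj_dirichlet mulr_sumr; apply: eq_bigr => b _.
      by rewrite mulr_sumr.
    apply: tends_sum => b _; apply: tends_sum => c _; rewrite /G.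
    have w0 p := @unity_neq0 R (2 ^ p).
    case: leqP => bc.
      apply: tends_ext (posz (c - b)%N) => p; congr average; apply/funext => j.
      congr (_ * _); rewrite -{2}(subnK bc) mulnDl exprD invfM mulrCA.
      by rewrite mulfV ?mulr1// expf_neq0.
    have cb : (0 < b - c)%N by rewrite subn_gt0.
    apply: tends_ext (negz _ cb) => p; congr average; apply/funext => j.
    by congr (_ * _); rewrite -{2}(subnK (ltnW bc)) mulnDl exprD mulfK// expf_neq0.
  have near_f : rnorm (\sum_(b < K) \sum_(c < K) G b c - K%:R * f z) <= A * n%:R.
    apply: (tends_le fejer (N := K)) => p Kp.
    have N0 : (0 < 2 ^ p)%N by rewrite expn_gt0.
    have KN : (K <= 2 ^ p)%N by rewrite (leq_trans Kp)// ltnW// ltn_expl.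
    move: (2 ^ p)%N N0 KN => N N0 KN.
    rewrite -(average_fejer KN) -averageMr -[- average _ _]mulN1r -averageMl -averageD.
    (* The factor |w - 1| of the Lipschitz bound absorbs one Dirichlet kernel D,
       and 2 |D| <= n + |D|^2 / n leaves a square, whose average is known. *)
    apply: (@ler_average _ _ _ (fun j => L * rnorm z *
        (n%:R + rnorm (dirichlet K N j) ^+ 2 / n%:R))) => // [j|].
      set D := dirichlet K N j.
      have -> : f (z * unity N ^+ j) * (D * cconj D) + -1 * (D * cconj D * f z) =
        (f (z * unity N ^+ j) - f z) * toC (rnorm D ^+ 2) by rewrite mul_conj; ring.
      rewrite rnormM rnormC ger0_norm ?sqr_ge0//.
      have /HL fL : rnorm (z * unity N ^+ j) = rnorm z.
        by rewrite rnormM rnormX rnorm_unity expr1n mulr1.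
      have D0 := rnorm_ge0 D.
      apply: le_trans (ler_wpM2r (sqr_ge0 _) fL) _.
      have -> : z * unity N ^+ j - z = z * (unity N ^+ j - 1) by ring.
      rewrite rnormM -!mulrA ler_wpM2l// ler_wpM2l ?rnorm_ge0//.
      rewrite [leLHS](_ : _ = rnorm (unity N ^+ j - 1) * rnorm D * rnorm D); last by ring.
      apply: le_trans (ler_wpM2r D0 (unity_sub1_dirichlet _ _ _)) _.
      rewrite -/D -subr_ge0.
      have -> : n%:R + rnorm D * (rnorm D / n%:R) - 2 * rnorm D =
        (rnorm D - n%:R) ^+ 2 / n%:R by field; rewrite gt_eqF.
      by rewrite divr_ge0 ?sqr_ge0// ltW.
    rewrite -mulr_sumr big_split /= sumr_const card_ord -mulr_suml sum_sqr_dirichlet//.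
    rewrite KE le_eqVlt; apply/orP; left; apply/eqP; rewrite /A -mulr_natl.
    by field; rewrite gt_eqF.
  have near_s : rnorm (\sum_(b < K) \sum_(c < K) G b c - K%:R * s) <= B.
    rewrite (partial_sums_diagonal (fun i => a i * z ^+ i)).
    have -> : K%:R * s = \sum_(b < K) s by rewrite sumr_const card_ord mulr_natl.
    rewrite -sumrB (le_trans (ler_rnorm_sum _ _ _))//.
    apply: (@le_trans _ _ (\sum_(b < K) M / (1 - q) * q ^+ b)).
      apply: ler_sum => b _; rewrite rdistC (le_trans (Hs _))//.
      rewrite mulrAC ler_wpM2l//.
      by case/andP: q01 => q0 /ltW q1; rewrite ler_wiXn2l.
    rewrite -mulr_sumr ler_wpM2l//.
    case/andP: q01 => q0 q1; rewrite -[leRHS]mul1r ler_pdivlMr ?subr_gt0//.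
    by rewrite mulrC -[1 - q]opprB mulNr -subrX1 opprB gerBl exprn_ge0.
  rewrite -KE -[K%:R]ger0_norm// -rnormC rmorph_nat -rnormM mulrBr.
  have -> : K%:R * f z - K%:R * s = (\sum_(b < K) \sum_(c < K) G b c - K%:R * s) -
     (\sum_(b < K) \sum_(c < K) G b c - K%:R * f z) by ring.
  by rewrite (le_trans (ler_rnormB _ _))// addrC lerD.
have B0 : 0 <= B.
  by case/andP: q01 => _ /ltW q1; rewrite /B !divr_ge0// subr_ge0.
apply/eqP; rewrite -subr_eq0; apply/eqP/rnorm0_eq0/eqP.
rewrite eq_le rnorm_ge0 andbT leNgt; apply/negP => X0.
set X := rnorm (f z - s) in bound X0.
have AB : (A + B) / X < (Num.bound ((A + B) / X))%:R.
  by apply: le_lt_trans (archi_boundP _); rewrite ?divr_ge0 ?addr_ge0// ltW.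
move: (Num.bound _) AB => n; rewrite ltr_pdivrMr// => AB.
have n0 : (0 < n)%N.
  by rewrite lt0n; apply/eqP => n0; move: AB; rewrite n0 mul0r ltNge addr_ge0.
have := bound n n0; rewrite expr2 => Hn.
have n1 : 1 <= n%:R :> R by rewrite ler1n.
have : n%:R * (n%:R * X) <= n%:R * (A + B).
  by rewrite mulrA (le_trans Hn)// mulrDr mulrC lerD2l ler_peMl.
by rewrite ler_pM2l ?ltr0n// leNgt AB.
Qed.

End TaylorSeries.

(** * Coefficients and remainders of power series *)

Section PowerSeries.
Context {R : realType}.
Implicit Types (a b : nat -> C R) (f g : C R -> C R) (T : R).

Lemma psumB a b f g T : psum a f T -> psum b g T ->
  psum (fun k => a k - b k) (fun z => f z - g z) T.
Proof.
move=> af bg z zT; apply: tends_ext (tendsB (af z zT) (bg z zT)) => n.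
by rewrite -sumrB; apply: eq_bigr => i _; rewrite mulrBl.
Qed.

Lemma psumZ a f T (c : C R) : psum a f T ->
  psum (fun k => c * a k) (fun z => c * f z) T.
Proof.
move=> af z zT; apply: tends_ext (tendsMl c (af z zT)) => n.
by rewrite mulr_sumr; apply: eq_bigr => i _; rewrite mulrA.
Qed.

Lemma psum_le a f T T' : T' <= T -> psum a f T -> psum a f T'.
Proof. by move=> TT' af z zT; apply: af; exact: lt_le_trans TT'. Qed.

Lemma psum_ext a f g T : (forall z, rnorm z < T -> f z = g z) -> psum a f T ->
  psum a g T.
Proof. by move=> fg af z zT; rewrite -fg//; exact: af. Qed.

Lemma psum_polynomial a (n : nat) T :
  psum (fun k => if (k < n)%N then a k else 0) (fun z => \sum_(k < n) a k * z ^+ k) T.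
Proof.
move=> z _ e e0; exists n => m nm; rewrite (big_ord_widen m (fun k => a k * z ^+ k) nm).
rewrite [X in _ - X]big_mkcond /= (_ : _ - _ = 0) ?rnorm0 ?(ltW e0)//.
apply/eqP; rewrite subr_eq0; apply/eqP; apply: eq_bigr => i _.
by case: ifP => // _; rewrite mul0r.
Qed.

Lemma psum_dilate a f T (s : R) : 0 < s -> psum a f T ->
  psum (fun k => a k * toC s ^+ k) (fun z => f (toC s * z)) (T / s).
Proof.
move=> s0 af z; rewrite ltr_pdivlMr// => zT.
have /af/tends_ext : rnorm (toC s * z) < T.
  by rewrite rnormM rnormC gtr0_norm// mulrC.
apply => n; apply: eq_bigr => i _.
by rewrite exprMn mulrA.
Qed.

Lemma tends_bounded (u : nat -> C R) c : tends u c ->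
  exists B, forall n, rnorm (u n) <= B.
Proof.
move=> /(_ 1 ltr01)[N HN].
exists (\sum_(i < N) rnorm (u i) + (rnorm c + 1)) => n.
have [nN|Nn] := ltnP n N.
  rewrite (bigD1 (Ordinal nN))//= -addrA lerDl addr_ge0 ?addr_ge0 ?rnorm_ge0//.
  by apply: sumr_ge0 => i _; exact: rnorm_ge0.
apply: ler_wpDl; first by apply: sumr_ge0 => i _; exact: rnorm_ge0.
by rewrite -[u n](subrK c) (le_trans (ler_rnormD _ _))// addrC lerD// HN.
Qed.

Lemma psum_coef_bounded a f T (r : R) : psum a f T -> 0 <= r < T ->
  exists B, forall k, rnorm (a k) * r ^+ k <= B.
Proof.
move=> af /andP[r0 rT]; have nr : rnorm (toC r) = r by rewrite rnormC ger0_norm.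
have [|B HB] := tends_bounded (af (toC r) _); first by rewrite nr.
exists (B + B) => k; rewrite -{1}nr -rnormX -rnormM.
have -> : a k * toC r ^+ k =
    \sum_(i < k.+1) a i * toC r ^+ i - \sum_(i < k) a i * toC r ^+ i.
  by rewrite big_ord_recr /= addrAC subrr add0r.
by rewrite (le_trans (ler_rnormB _ _))// lerD.
Qed.

(** Cauchy's estimates are proved on circles of radius r < T; by Bernoulli's
    inequality they extend to the radius T. *)
Lemma ler_expr_approx (A T M : R) k : 0 <= A -> 0 < T ->
  (forall r, 0 < r < T -> A * r ^+ k <= M) -> A * T ^+ k <= M.
Proof.
move=> A0 T0 H; have AT : 0 <= A * T ^+ k by rewrite mulr_ge0// exprn_ge0// ltW.
have bernoulli (e : R) n : 0 <= e <= 1 -> 1 - n%:R * e <= (1 - e) ^+ n.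
  move=> /andP[e0 e1]; elim: n => [|n IH]; first by rewrite mul0r subr0 expr0.
  have := ler_wpM2l (_ : 0 <= 1 - e) IH; rewrite subr_ge0 => /(_ e1).
  rewrite exprS => /(le_trans _); apply; rewrite -natr1.
  have : 0 <= n%:R * (e * e) by rewrite mulr_ge0// mulr_ge0.
  by lra.
apply: ler_addgt0 => d d0; pose e := Num.min (1 / 2) (d / (k%:R * (A * T ^+ k) + 1)).
have D0 : 0 < k%:R * (A * T ^+ k) + 1 by rewrite ltr_wpDl// mulr_ge0.
have e0 : 0 < e by rewrite lt_min !divr_gt0.
have e1 : e <= 1 / 2 by rewrite ge_min lexx.
have e2 : e * (k%:R * (A * T ^+ k)) <= d.
  apply: (@le_trans _ _ (e * (k%:R * (A * T ^+ k) + 1))).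
    by rewrite ler_wpM2l ?(ltW e0)// lerDl.
  by rewrite -ler_pdivlMr// ge_min lexx orbT.
have /H : 0 < (1 - e) * T < T.
  by rewrite mulr_gt0 ?gtr_pMl//=; lra.
rewrite exprMn mulrCA => Hr.
have /(bernoulli e k) : 0 <= e <= 1 by lra.
move=> /(ler_wpM2r AT) Hb; have := le_trans Hb Hr; lra.
Qed.

(** Averaging over the N-th roots of unity extracts the exact coefficient of the
    partial sum of order N, which is uniformly close to [f] on a circle of radius
    smaller than [T]. *)
Lemma cauchy_estimate a f T M k : 0 < T -> psum a f T ->
  (forall z, rnorm z < T -> rnorm (f z) <= M) -> rnorm (a k) * T ^+ k <= M.
Proof.
move=> T0 af fM; apply: ler_expr_approx => //; first exact: rnorm_ge0.
move=> r /andP[r0 rT]; pose r' := (r + T) / 2.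
have rr' : r < r' by rewrite /r'; lra.
have r'T : r' < T by rewrite /r'; lra.
have r'0 : 0 < r' by exact: lt_trans rr'.
have [|B HB] := psum_coef_bounded af (r := r'); first by rewrite (ltW r'0).
pose q := r / r'.
have q01 : 0 <= q < 1 by rewrite divr_ge0 ?(ltW r0) ?(ltW r'0)//= ltr_pdivrMr// mul1r.
have uq (z : C R) i : rnorm z = r -> rnorm (a i * z ^+ i) <= B * q ^+ i.
  move=> zr; rewrite rnormM rnormX zr /q expr_div_n mulrA mulrAC.
  by rewrite ler_wpM2r ?exprn_ge0 ?(ltW r0)// ler_pdivlMr// exprn_gt0.
apply: ler_addgt0 => e e0.
have [p0 Hp0] := expr_cvg0 (B / (1 - q)) q01 e0.
set N := (2 ^ maxn p0 k)%N.
have N0 : (0 < N)%N by rewrite expn_gt0.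
have kN : (k < N)%N by rewrite (leq_ltn_trans (leq_maxr p0 k))// ltn_expl.
have pN : (p0 <= N)%N by rewrite (leq_trans (leq_maxl p0 k))// ltnW// ltn_expl.
pose z j : C R := toC r * unity N ^+ j.
have zr j : rnorm (z j) = r.
  by rewrite rnormM rnormX rnorm_unity expr1n mulr1 rnormC gtr0_norm.
have tail j : rnorm (f (z j) - \sum_(i < N) a i * z j ^+ i) <= e.
  have [s us Hs] := geometric_tends q01 (fun i => uq (z j) i (zr j)).
  rewrite (tends_unique (af (z j) _) us) ?zr//.
  by rewrite (le_trans (Hs N))// mulrAC Hp0.
have -> : rnorm (a k) * r ^+ k = rnorm (average N (fun j =>
    (\sum_(i < N) a i * z j ^+ i) * (unity N ^+ (k * j))^-1)).
  have -> : average N (fun j =>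
      (\sum_(i < N) a i * z j ^+ i) * (unity N ^+ (k * j))^-1) =
      \sum_(i < N) average N (fun j =>
        (a i * toC r ^+ i) * (unity N ^+ (i * j) * (unity N ^+ (k * j))^-1)).
    rewrite -average_sum; congr average; apply/funext => j.
    rewrite mulr_suml; apply: eq_bigr => i _; rewrite /z.
    by rewrite [(toC r * _) ^+ i]exprMn -exprM [(j * i)%N]mulnC !mulrA.
  rewrite (bigD1 (Ordinal kN))//= averageMl average_unity// eqxx mulr1.
  rewrite big1 ?addr0 => [|i ik]; last first.
    rewrite averageMl average_unity// (_ : (_ == _) = false) ?mulr0//.
    by apply/negbTE; exact: ik.
  by rewrite rnormM rnormX rnormC gtr0_norm.
apply: ler_average_cst => // j.
rewrite rnormM rnormV rnormX rnorm_unity expr1n invr1 mulr1.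
rewrite -[\sum_(i < N) _](subrK (f (z j))) (le_trans (ler_rnormD _ _))//.
by rewrite rdistC addrC lerD// fM// zr.
Qed.

Lemma psum_unique a b f T : 0 < T -> psum a f T -> psum b f T -> a = b.
Proof.
move=> T0 af bf; apply/funext => k; apply/eqP; rewrite -subr_eq0; apply/eqP.
apply: rnorm0_eq0; apply/eqP; rewrite eq_le rnorm_ge0 andbT.
have := @cauchy_estimate _ _ _ 0 k T0 (psumB af bf) _.
rewrite pmulr_lle0 ?exprn_gt0//; apply => z _.
by rewrite subrr rnorm0.
Qed.

Lemma psum_tail a f T M (z : C R) m : 0 < T -> psum a f T ->
  (forall z, rnorm z < T -> rnorm (f z) <= M) -> rnorm z < T ->
  rnorm (f z - \sum_(i < m) a i * z ^+ i) <=
    M * (rnorm z / T) ^+ m / (1 - rnorm z / T).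
Proof.
move=> T0 af fM zT.
have q01 : 0 <= rnorm z / T < 1.
  by rewrite divr_ge0 ?rnorm_ge0 ?(ltW T0)//= ltr_pdivrMr// mul1r.
have [i|s us Hs] := @geometric_tends _ (fun i => a i * z ^+ i) M _ q01.
  rewrite rnormM rnormX expr_div_n mulrA mulrAC.
  rewrite ler_wpM2r ?exprn_ge0 ?rnorm_ge0// ler_pdivlMr ?exprn_gt0//.
  exact: cauchy_estimate af fM.
by rewrite (tends_unique (af z zT) us).
Qed.

Lemma psum_at0 a f T : 0 < T -> psum a f T -> f 0 = a 0%N.
Proof.
move=> T0 af; apply: (tends_unique (af 0 _)); first by rewrite rnorm0.
move=> e e0; exists 1%N => -[//|n] _; rewrite big_ord_recl expr0 mulr1.
rewrite big1 => [|i _]; first by rewrite addr0 subrr rnorm0 ltW.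
by rewrite exprS mul0r mulr0.
Qed.

Lemma psum_second_order a f T M (z : C R) : 0 < T -> psum a f T ->
  (forall z, rnorm z < T -> rnorm (f z) <= M) -> rnorm z <= T / 2 ->
  rnorm (f z - f 0 - a 1%N * z) <= 2 * M * (rnorm z / T) ^+ 2.
Proof.
move=> T0 af fM zT.
have zT' : rnorm z < T by rewrite (le_lt_trans zT)// ltr_pdivrMr// ltr_pMr// ltr1n.
have := psum_tail 2 T0 af fM zT'.
rewrite 2!big_ord_recl big_ord0 addr0 expr0 expr1 mulr1 opprD addrA (psum_at0 T0 af).
move=> /le_trans; apply.
have M0 : 0 <= M by apply: le_trans (fM 0 _); rewrite ?rnorm_ge0 ?rnorm0.
have q2 : rnorm z / T <= 1 / 2 by rewrite ler_pdivrMr//; lra.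
have q0 : 0 <= rnorm z / T by rewrite divr_ge0 ?rnorm_ge0// ltW.
move: (rnorm z / T) q2 q0 => q q2 q0; rewrite ler_pdivrMr; last by lra.
have : 0 <= M * q ^+ 2 * (1 - 2 * q).
  by rewrite !mulr_ge0 ?exprn_ge0//; lra.
by lra.
Qed.

End PowerSeries.

(** * Holomorphic functions restricted to complex lines *)

Section Slices.
Context {R : realType}.

Lemma le0_small (x K : R) : (forall e, 0 < e < 1 -> x <= K * e) -> x <= 0.
Proof.
move=> H; apply: ler_addgt0 => d d0; rewrite add0r.
have K0 : 0 < `|K| + 1 by rewrite ltr_wpDl.
pose e := Num.min (1 / 2) (d / (`|K| + 1)).
have e0 : 0 < e by rewrite lt_min !divr_gt0.
have e1 : e < 1 by rewrite gt_min (_ : 1 / 2 < 1)//; lra.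
have ed : e * (`|K| + 1) <= d by rewrite -ler_pdivlMr// ge_min lexx orbT.
have /H/le_trans : 0 < e < 1 by rewrite e0.
apply; apply: le_trans ed; rewrite mulrC ler_wpM2l ?(ltW e0)//.
by rewrite (le_trans (ler_norm _))// lerDl.
Qed.

Lemma differentiable_bounded_near (V : normedModType R[i]) (g : V -> C R) u :
  differentiable g u ->
  exists2 d : R, 0 < d & exists M, forall x, rnorm (x - u) < d -> rnorm (g x) <= M.
Proof.
move=> /differentiable_continuous/continuous_rnormP/(_ 1 ltr01)[d d0 Hd].
exists d => //; exists (rnorm (g u) + 1) => x /Hd xu.
by rewrite -[g x](subrK (g u)) (le_trans (ler_rnormD _ _))// addrC lerD// ltW.
Qed.

Lemma psum_derivative a (f : C R -> C R) T : 0 < T -> psum a f T ->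
  differentiable f 0 -> a 1%N = 'd f 0 1.
Proof.
move=> T0 af df; apply/eqP; rewrite -subr_eq0; apply/eqP/rnorm0_eq0/eqP.
rewrite eq_le rnorm_ge0 andbT; apply: ler_addgt0 => e e0; rewrite add0r.
have [d d0 [M HM]] := differentiable_bounded_near df.
have [_ /(_ (e / 2))] := differentiable_rnormP df.
rewrite divr_gt0// => /(_ isT)[d' d'0 Hd'].
pose S := Num.min d T; have S0 : 0 < S by rewrite lt_min d0.
have fM z : rnorm z < S -> rnorm (f z) <= M.
  by rewrite lt_min => /andP[zd _]; apply: HM; rewrite subr0.
have M0 : 0 <= M by apply: le_trans (rnorm_ge0 _) (fM 0 _); rewrite rnorm0.
pose K := 2 * M / S ^+ 2; have K0 : 0 <= K by rewrite divr_ge0 ?exprn_ge0 ?mulr_ge0 ?(ltW S0).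
pose t := Num.min (Num.min (d' / 2) (S / 2)) (e / 2 / (K + 1)).
have K1 : 0 < K + 1 by rewrite ltr_wpDl.
have t0 : 0 < t by rewrite !lt_min !divr_gt0.
have td : t < d'.
  by rewrite !gt_min (_ : d' / 2 < d')// ltr_pdivrMr// ltr_pMr// ltr1n.
have tS : t <= S / 2 by rewrite !ge_min lexx orbT.
have te : K * t <= e / 2.
  have : t * (K + 1) <= e / 2 by rewrite -ler_pdivlMr// ge_min lexx orbT.
  by apply: le_trans; rewrite mulrC ler_wpM2l ?(ltW t0)// lerDl.
have nt : rnorm (toC t) = t by rewrite rnormC gtr0_norm.
have aS : psum a f S by apply: psum_le af; rewrite ge_min lexx orbT.
have := psum_second_order S0 aS fM (z := toC t); rewrite nt => /(_ tS) H1.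
have := Hd' (toC t); rewrite nt add0r => /(_ td).
have -> : 'd f 0 (toC t) = toC t * 'd f 0 1.
  by rewrite -[toC t in LHS]mulr1; exact: linearZ.
move=> H2; rewrite -(ler_pM2l t0) -{1}nt -rnormM.
have -> : toC t * (a 1%N - 'd f 0 1) =
  (f (toC t) - f 0 - toC t * 'd f 0 1) - (f (toC t) - f 0 - a 1%N * toC t) by ring.
rewrite (le_trans (ler_rnormB _ _))// (le_trans (lerD H2 H1))//.
have -> : 2 * M * (t / S) ^+ 2 = K * t * t.
  by rewrite /K; field; rewrite gt_eqF.
have := ler_wpM2r (ltW t0) te; lra.
Qed.

Lemma diff_linear_combination (V : normedModType R[i]) (f g : V -> C R) (a : C R) u :
  differentiable f u -> differentiable g u ->
  differentiable (fun x => a * f x + g x) u /\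
  forall h, 'd (fun x => a * f x + g x) u h = a * 'd f u h + 'd g u h.
Proof.
move=> df dg.
have [[K _ HK] Hf] := differentiable_rnormP df.
have [[K' _ HK'] Hg] := differentiable_rnormP dg.
move: ('d f u : {linear V -> C R}) ('d g u : {linear V -> C R}) HK Hf HK' Hg.
move=> k k' HK Hf HK' Hg; pose l h : C R := a * k h + k' h.
have ll : linear l.
  move=> b x y; have lP (k'' : {linear V -> C R}) : k'' (b *: x + y) = b * k'' x + k'' y.
    exact: linearP.
  by rewrite /l !lP /GRing.scale /=; ring.
pose l' : {linear V -> C R} := HB.pack l (GRing.isLinear.Build _ _ _ _ l ll).
have [||? dl] := @rnormP_differentiable R V (C R) (fun x => a * f x + g x) u l'
  (rnorm a * K + K').
- move=> h; rewrite (le_trans (ler_rnormD _ _))// mulrDl lerD//.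
  by rewrite rnormM -mulrA ler_wpM2l// rnorm_ge0.
- move=> e e0; have a1 : 0 < rnorm a + 1 by rewrite ltr_wpDl// rnorm_ge0.
  have e1 : 0 < e / (rnorm a + 1) by rewrite divr_gt0.
  have [d d0 Hd] := Hf _ e1; have [d' d'0 Hd'] := Hg _ e1.
  exists (Num.min d d'); first by rewrite lt_min d0.
  move=> h; rewrite lt_min => /andP[/Hd H1 /Hd' H2].
  have -> : a * f (u + h) + g (u + h) - (a * f u + g u) - l' h =
    a * (f (u + h) - f u - k h) + (g (u + h) - g u - k' h).
    by rewrite /= /l; ring.
  rewrite (le_trans (ler_rnormD _ _))// rnormM.
  rewrite (le_trans (lerD (ler_wpM2l (rnorm_ge0 _) H1) H2))//.
  by rewrite le_eqVlt; apply/orP; left; apply/eqP; field; rewrite gt_eqF.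
- by split=> // h; rewrite dl.
Qed.

Context {E : normedModType R[i]}.
Implicit Types (u h x : E) (g : E -> C R).

Definition hol_ball g u (rho : R) : Prop :=
  forall x, rnorm (x - u) < rho -> differentiable g x.

Lemma hol_ball_sub g u v (rho sigma : R) : rnorm (v - u) + sigma <= rho ->
  hol_ball g u rho -> hol_ball g v sigma.
Proof.
move=> vu gu x xv; apply: gu; apply: lt_le_trans vu.
by rewrite (le_lt_trans (ler_rdistD v _ _))// addrC ltrD2l.
Qed.

Lemma diff_slice g u h (z : C R) : differentiable g (u + z *: h) ->
  differentiable (fun z : C R => g (u + z *: h) : C R) z /\
  'd (fun z : C R => g (u + z *: h) : C R) z 1 = 'd g (u + z *: h) h.
Proof.
move=> /differentiable_rnormP[].
move: ('d g (u + z *: h) : {linear E -> C R}) => k [K K0 HK] Hk.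
pose l (w : C R) : C R := w * k h.
have ll : linear l by move=> b x y; rewrite /l /GRing.scale /=; ring.
pose l' : {linear C R -> C R} := HB.pack l (GRing.isLinear.Build _ _ _ _ l ll).
have [||df dl] := @rnormP_differentiable R (C R) (C R)
  (fun z : C R => g (u + z *: h) : C R) z l' (rnorm (k h)).
- by move=> w; rewrite /= rnormM mulrC.
- move=> e e0; have h1 : 0 < rnorm h + 1 by rewrite ltr_wpDl// rnorm_ge0.
  have [d d0 Hd] := Hk _ (divr_gt0 e0 h1).
  exists (d / (rnorm h + 1)); first by rewrite divr_gt0.
  move=> w; rewrite ltr_pdivlMr// => wd.
  have wh : rnorm (w *: h) <= rnorm w * (rnorm h + 1).
    by rewrite rnormZ ler_wpM2l ?rnorm_ge0// lerDl.
  have := Hd _ (le_lt_trans wh wd).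
  have -> : k (w *: h) = w * k h by exact: linearZ.
  rewrite -[u + _ + _]addrA -scalerDl => /le_trans; apply.
  by rewrite mulrAC ler_pdivrMr// -mulrA ler_wpM2l// ltW.
by split=> //; rewrite dl /= /l mul1r.
Qed.

Lemma hol_ball_slice g u h rho T : 0 < rho -> hol_ball g u rho -> 0 < T ->
  T * rnorm h <= rho ->
  exists2 a, psum a (fun z => g (u + z *: h)) T & a 1%N = 'd g u h.
Proof.
move=> rho0 gu T0 Th.
have dg (z : C R) : rnorm z < T ->
    differentiable (fun z : C R => g (u + z *: h) : C R) z.
  move=> zT; apply: (diff_slice _).1; apply: gu.
  rewrite addrAC subrr add0r rnormZ.
  have [->|h0] := eqVneq h 0; first by rewrite rnorm0 mulr0.
  by apply: lt_le_trans Th; rewrite ltr_pM2r// rnorm_gt0.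
have [a ag] := taylor_series dg; exists a => //.
rewrite (psum_derivative T0 ag); last by apply: dg; rewrite rnorm0.
have d0 : differentiable g (u + 0 *: h).
  by apply: gu; rewrite scale0r addr0 subrr rnorm0.
by rewrite (diff_slice d0).2 scale0r addr0.
Qed.

(** On the complex line through [u] and [u + h] these are Cauchy's estimates in
    one variable. *)
Lemma hol_ball_estimates g u rho M : 0 < rho -> hol_ball g u rho ->
  (forall x, rnorm (x - u) < rho -> rnorm (g x) <= M) -> forall h,
  rnorm ('d g u h) <= M / rho * rnorm h /\
  (rnorm h <= rho / 2 ->
    rnorm (g (u + h) - g u - 'd g u h) <= 2 * M / rho ^+ 2 * rnorm h ^+ 2).
Proof.
move=> rho0 gu gM h; have [->|h0] := eqVneq h 0.
  by rewrite linear0 !rnorm0 mulr0 addr0 subrr subr0 rnorm0 expr0n mulr0.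
have nh := rnorm_gt0 h0; pose T := rho / rnorm h.
have T0 : 0 < T by rewrite divr_gt0.
have Th : T * rnorm h = rho by rewrite /T divfK// gt_eqF.
have [|a ag <-] := @hol_ball_slice g u h rho T rho0 gu T0; first by rewrite Th.
have sM (z : C R) : rnorm z < T -> rnorm (g (u + z *: h)) <= M.
  by move=> zT; apply: gM; rewrite addrAC subrr add0r rnormZ -Th ltr_pM2r.
split.
  have := cauchy_estimate 1 T0 ag sM; rewrite expr1 -ler_pdivlMr//.
  by move=> /le_trans; apply; rewrite /T invf_div mulrA mulrAC.
move=> hr; have := psum_second_order (z := 1) T0 ag sM.
rewrite scale1r mulr1 scale0r addr0 rnorm1.
have -> : 1 / T = rnorm h / rho by rewrite /T div1r invf_div.
have -> : 1 <= T / 2 by rewrite /T mulrAC ler_pdivlMr// mul1r.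
move=> /(_ isT)/le_trans; apply; rewrite le_eqVlt; apply/orP; left; apply/eqP.
by field; rewrite gt_eqF.
Qed.

(** Weierstrass's theorem: [hol_ball_estimates], applied to differences
    [f m - f n], makes the differentials converge, and its bound on the remainders
    passes to the limit. *)
Lemma uniform_limit_differentiable (f : nat -> E -> C R) g u rho : 0 < rho ->
  (exists N, forall n, (N <= n)%N -> hol_ball (f n) u rho) ->
  (forall e, 0 < e -> exists N, forall n x, (N <= n)%N -> rnorm (x - u) < rho ->
     rnorm (f n x - g x) <= e) ->
  differentiable g u /\ forall h, tends (fun n => 'd (f n) u h) ('d g u h).
Proof.
move=> rho0 [N0 fh] fg.
have [N1 HN1] := fg 1 ltr01; pose N := maxn N0 N1.
have uu : rnorm (u - u) < rho by rewrite subrr rnorm0.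
have [d d0 [M HM]] := differentiable_bounded_near (fh N (leq_maxl _ _) u uu).
pose s := Num.min d rho; have s0 : 0 < s by rewrite lt_min d0.
have srho : s <= rho by rewrite ge_min lexx orbT.
have fM n x : (N <= n)%N -> rnorm (x - u) < s -> rnorm (f n x) <= M + 1 + 1.
  move=> Nn; rewrite lt_min => /andP[xd xr].
  have H1 := HN1 n x (leq_trans (leq_maxr _ _) Nn) xr.
  have H2 := HN1 N x (leq_maxr _ _) xr.
  have -> : f n x = f N x - (f N x - g x) + (f n x - g x) by ring.
  rewrite (le_trans (ler_rnormD _ _))// lerD// (le_trans (ler_rnormB _ _))// lerD//.
  exact: HM.
have fs n : (N <= n)%N -> hol_ball (f n) u s.
  move=> Nn x xs; apply: (fh n); first exact: leq_trans (leq_maxl _ _) Nn.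
  exact: lt_le_trans xs srho.
have Ef n (Nn : (N <= n)%N) := hol_ball_estimates s0 (fs n Nn) (fun x => fM n x Nn).
have dfu n : (N <= n)%N -> differentiable (f n) u.
  by move=> Nn; apply: (fs n Nn); rewrite subrr rnorm0.
have cauchy h : exists l, tends (fun n => 'd (f n) u h) l.
  apply: tends_cauchy => e e0.
  have h1 : 0 < rnorm h + 1 by rewrite ltr_wpDl// rnorm_ge0.
  have e1 : 0 < e * s / (rnorm h + 1) / 2 by rewrite !divr_gt0// mulr_gt0.
  have [N2 HN2] := fg _ e1; pose N' := maxn N N2; exists N' => n Nn.
  have NN' : (N <= N')%N by exact: leq_maxl.
  have Nn' : (N <= n)%N by exact: leq_trans Nn.
  have [_ dB] := diff_linear_combination (-1) (dfu N' NN') (dfu n Nn').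
  have -> : 'd (f n) u h - 'd (f N') u h = 'd (fun x => -1 * f N' x + f n x) u h.
    by apply: esym; apply: (etrans (dB h)); rewrite mulN1r addrC.
  have [|x xs|Hh _] := @hol_ball_estimates (fun x => -1 * f N' x + f n x) u s (e * s / (rnorm h + 1)) s0 _ _ h.
  - by move=> x xs; apply: (diff_linear_combination _ _ _).1; exact: fs xs.
  - have xr : rnorm (x - u) < rho by exact: lt_le_trans srho.
    rewrite (_ : -1 * f N' x + f n x = (f n x - g x) - (f N' x - g x)); last by ring.
    rewrite (le_trans (ler_rnormB _ _))// [leRHS]splitr lerD// HN2//.
      by rewrite (leq_trans _ Nn)// leq_maxr.
    by rewrite leq_maxr.
  apply: (le_trans Hh).
  have -> : e * s / (rnorm h + 1) / s = e / (rnorm h + 1).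
    by field; rewrite !gt_eqF.
  by rewrite mulrAC ler_pdivrMr// ler_wpM2l ?(ltW e0)// lerDl.
have [l Hl] := choice cauchy.
have ll : linear l.
  move=> a x y; apply: (tends_unique (Hl _)).
  apply: tends_ext (tendsD (tendsZ a (Hl x)) (Hl y)) => n.
  by rewrite linearP.
have M0 : 0 <= M + 1 + 1.
  by apply: le_trans (rnorm_ge0 _) (fM N u (leqnn _) _); rewrite subrr rnorm0.
pose K := (M + 1 + 1) / s + 2 * (M + 1 + 1) / s ^+ 2.
have K1 : (M + 1 + 1) / s <= K.
  by rewrite lerDl divr_ge0 ?exprn_ge0 ?mulr_ge0 ?(ltW s0).
have K2 : 2 * (M + 1 + 1) / s ^+ 2 <= K.
  by rewrite lerDr divr_ge0// ltW.
have gt x : rnorm (x - u) < rho -> tends (fun n => f n x) (g x).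
  by move=> xr e /fg[N2 HN2]; exists N2 => n Nn; exact: HN2.
have s20 : 0 < s / 2 by rewrite divr_gt0.
have [||dg dgl] := @quadratic_differentiable _ _ _ g l u (s / 2) K ll s20.
- move=> h _; apply: (tends_le0 (Hl h) (N := N)) => n Nn.
  apply: le_trans (Ef n Nn h).1 _.
  by rewrite ler_wpM2r ?rnorm_ge0.
- move=> h hs; have hs' : rnorm h < rho.
    by rewrite (lt_le_trans hs)// (le_trans _ srho)// ler_pdivrMr// ler_peMr ?ler1n// ltW.
  have Hlim : tends (fun n => f n (u + h) - f n u - 'd (f n) u h)
      (g (u + h) - g u - l h).
    apply: tendsB (Hl h); apply: tendsB; apply: gt => //.
    by rewrite addrAC subrr add0r.
  apply: (tends_le0 Hlim (N := N)) => n Nn.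
  apply: le_trans ((Ef n Nn h).2 (ltW hs)) _.
  by rewrite ler_wpM2r ?exprn_ge0 ?rnorm_ge0.
split=> // h; have dglh : l h = 'd g u h := esym (congr1 (fun k : E -> C R => k h) dgl).
by have := Hl h; rewrite [X in tends _ X]dglh.
Qed.

End Slices.

Opaque diff.

(** * Iterated directional derivatives *)

Section DirectionalDerivatives.
Context {R : realType} {E : normedModType R[i]}.
Implicit Types (u h x : E) (f g : E -> C R) (U : set E).

Definition hol_on U f : Prop := forall x, U x -> differentiable f x.

Lemma exists_harmonic_le (K e : R) : 0 < e ->
  exists N, forall n, (N <= n)%N -> K / n.+1%:R <= e.
Proof.
move=> e0; exists (Num.bound `|K / e|) => n Nn.
rewrite ler_pdivrMr ?ltr0n// mulrC -ler_pdivrMr// (le_trans (ler_norm _))//.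
rewrite ltW// (lt_le_trans (archi_boundP _))// ler_nat leqW//.
Qed.

Lemma diff_local f g u (d : R) : 0 < d ->
  (forall x, rnorm (x - u) < d -> f x = g x) -> differentiable f u ->
  differentiable g u /\ 'd g u = 'd f u :> (E -> C R).
Proof.
move=> d0 fg df; have [[K _ HK] Hf] := differentiable_rnormP df.
apply: (rnormP_differentiable HK) => e /Hf[d' d'0 Hd'].
exists (Num.min d d') => [|h]; first by rewrite lt_min d0.
rewrite lt_min => /andP[hd /Hd']; rewrite fg ?fg//; first by rewrite subrr rnorm0.
by rewrite addrAC subrr add0r.
Qed.

Lemma hol_on_ball U f u : open U -> U u -> hol_on U f ->
  exists2 r : R, 0 < r & hol_ball f u r /\ forall x, rnorm (x - u) < r -> U x.
Proof.
move=> /open_rnormP/(_ u) H /H[r r0 Hr] fU; exists r => //; split=> // x xu.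
by apply: fU; exact: Hr.
Qed.

(** The difference quotients converge locally uniformly, by the bound of
    [hol_ball_estimates] on the remainder. *)
Lemma hol_on_directional U f x : open U -> hol_on U f ->
  hol_on U (fun u => 'd f u x).
Proof.
move=> oU fU u Uu; have [r r0 [fr rU]] := hol_on_ball oU Uu fU.
have [d d0 [M HM]] := differentiable_bounded_near (fU u Uu).
pose s := Num.min r d / 2.
have m0 : 0 < Num.min r d by rewrite lt_min r0.
have s0 : 0 < s by rewrite divr_gt0.
have ss : s + s = Num.min r d by rewrite -splitr.
have near v : rnorm (v - u) < s -> hol_ball f v s /\
    forall y, rnorm (y - v) < s -> rnorm (f y) <= M.
  move=> vu; split.
    by apply: hol_ball_sub fr; rewrite (le_trans (lerD (ltW vu) (lexx s)))// ss ge_min lexx.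
  move=> y yv; apply: HM; apply: (@lt_le_trans _ _ (s + s)).
    by rewrite (le_lt_trans (ler_rdistD v _ _))// ltrD.
  by rewrite ss ge_min lexx orbT.
pose t (n : nat) : R := n.+1%:R^-1.
have t0 n : 0 < t n by rewrite invr_gt0.
pose g (n : nat) v := toC n.+1%:R * (f (v + toC (t n) *: x) - f v).
have M0 : 0 <= M.
  by apply: le_trans (rnorm_ge0 _) ((near u _).2 u _); rewrite subrr rnorm0.
have nt n : rnorm (toC (t n) *: x) = rnorm x / n.+1%:R.
  by rewrite rnormZ rnormC gtr0_norm// mulrC.
have [N0 HN0] := exists_harmonic_le (rnorm x) (divr_gt0 s0 (ltr0n R 2)).
have step n : (N0 <= n)%N -> rnorm (toC (t n) *: x) <= s / 2.
  by rewrite nt; exact: HN0.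
apply: (@uniform_limit_differentiable _ _ g _ u s s0 _ _).1.
- exists N0 => n Nn v vu; have [fv _] := near v vu.
  have fv0 : differentiable f v by apply: fv; rewrite subrr rnorm0.
  have fvt : differentiable f (v + toC (t n) *: x).
    apply: fv; rewrite addrAC subrr add0r (le_lt_trans (step n Nn))//.
    by rewrite ltr_pdivrMr// ltr_pMr// ltr1n.
  apply: (differentiableZ (toC n.+1%:R)); apply: differentiableB => //.
  apply: (@differentiable_comp _ _ _ _ (fun v => v + toC (t n) *: x)) => //.
- move=> e e0; pose K := 2 * M / s ^+ 2 * rnorm x ^+ 2.
  have [N1 HN1] := exists_harmonic_le K e0; exists (maxn N0 N1) => n v.
  rewrite geq_max => /andP[n0 n1] vu; have [fv fM] := near v vu.
  have [_ /(_ (step n n0))] := hol_ball_estimates s0 fv fM (toC (t n) *: x).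
  have -> : 'd f v (toC (t n) *: x) = toC (t n) * 'd f v x by exact: linearZ.
  have n0' : 0 < n.+1%:R :> R by [].
  have tn1 : toC n.+1%:R * toC (t n) = 1.
    by rewrite -rmorphM mulfV ?rmorph1// gt_eqF.
  have -> : g n v - 'd f v x = toC n.+1%:R *
      (f (v + toC (t n) *: x) - f v - toC (t n) * 'd f v x).
    by rewrite mulrBr mulrA tn1 mul1r.
  rewrite nt rnormM rnormC gtr0_norm// -(ler_pM2l n0') => /le_trans; apply.
  apply: le_trans (HN1 n n1); rewrite le_eqVlt /K; apply/orP; left; apply/eqP.
  by field; rewrite !gt_eqF.
Qed.

Fixpoint iter_diff (s : seq E) f : E -> C R :=
  if s is x :: s' then fun u => 'd (iter_diff s' f) u x else f.

Lemma iter_diff_cat s t f : iter_diff (s ++ t) f = iter_diff s (iter_diff t f).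
Proof. by elim: s => [//|x s IH]; rewrite /= IH. Qed.

Lemma hol_on_iter_diff U s f : open U -> hol_on U f -> hol_on U (iter_diff s f).
Proof. by move=> oU fU; elim: s => [//|x s IH]; exact: hol_on_directional. Qed.

Lemma iter_diff_local U s f g : open U -> hol_on U f ->
  (forall u, U u -> f u = g u) -> forall u, U u -> iter_diff s f u = iter_diff s g u.
Proof.
move=> oU fU fg; elim: s => [//|x s IH] u Uu.
have [r r0 [fr rU]] := hol_on_ball oU Uu (hol_on_iter_diff s oU fU).
have [||_ dE] := @diff_local (iter_diff s f) (iter_diff s g) u r r0.
- by move=> y yu; apply: IH; exact: rU.
- by apply: fr; rewrite subrr rnorm0.
- exact: (esym (congr1 (fun k : E -> C R => k x) dE)).
Qed.

Lemma hol_onZD U f g (a : C R) : hol_on U f -> hol_on U g ->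
  hol_on U (fun u => a * f u + g u).
Proof.
by move=> fU gU u Uu; apply: (diff_linear_combination _ _ _).1; [exact: fU|exact: gU].
Qed.

Lemma iter_diff_linear U s f g (a : C R) : open U -> hol_on U f -> hol_on U g ->
  forall u, U u ->
    iter_diff s (fun u => a * f u + g u) u = a * iter_diff s f u + iter_diff s g u.
Proof.
move=> oU fU gU; have fgU := hol_onZD a fU gU.
elim: s => [//|x s IH] u Uu.
have df := hol_on_iter_diff s oU fU Uu; have dg := hol_on_iter_diff s oU gU Uu.
have [r r0 [fr rU]] := hol_on_ball oU Uu (hol_on_iter_diff s oU fgU).
have [||_ dE] := @diff_local (iter_diff s (fun u => a * f u + g u))
    (fun u => a * iter_diff s f u + iter_diff s g u) u r r0.
- by move=> y yu; apply: IH; exact: rU.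
- by apply: fr; rewrite subrr rnorm0.
- apply: etrans (esym (congr1 (fun k : E -> C R => k x) dE)) _.
  exact: (diff_linear_combination a df dg).2.
Qed.

(** Linearity of a differential in its direction is an identity between
    holomorphic functions, which the differentials in [s] preserve. *)
Lemma iter_diff_slot_linear U s t f (a : C R) x y : open U -> hol_on U f ->
  forall u, U u -> iter_diff (s ++ (a *: x + y) :: t) f u =
    a * iter_diff (s ++ x :: t) f u + iter_diff (s ++ y :: t) f u.
Proof.
move=> oU fU u Uu; rewrite !iter_diff_cat.
have tU := hol_on_iter_diff t oU fU.
apply: etrans (@iter_diff_linear U s _ _ a oU (hol_on_directional x oU tU)
  (hol_on_directional y oU tU) u Uu).
apply: (iter_diff_local _ oU _ _ Uu); first exact: (hol_on_directional _ oU tU).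
by move=> v _; exact: linearP.
Qed.

End DirectionalDerivatives.

(** * Homogeneous Taylor components *)

Section TaylorComponents.
Context {R : realType}.

Lemma expr_second_order (e : R) n : 0 <= e <= 1 ->
  0 <= (1 + e) ^+ n - 1 - n%:R * e <= 4 ^+ n * e ^+ 2.
Proof.
move=> /andP[e0 e1]; elim: n => [|n /andP[IH0 IH1]].
  by rewrite !expr0 subrr sub0r mul0r oppr0 lexx mul1r exprn_ge0.
have n4 : n%:R <= 4 ^+ n :> R by rewrite -natrX ler_nat ltnW// ltn_expl.
have -> : (1 + e) ^+ n.+1 - 1 - n.+1%:R * e =
  (1 + e) * ((1 + e) ^+ n - 1 - n%:R * e) + n%:R * e ^+ 2.
  by rewrite exprS -natr1; ring.
apply/andP; split.
  by apply: addr_ge0; apply: mulr_ge0 => //; [rewrite addr_ge0|rewrite exprn_ge0].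
apply: (@le_trans _ _ (2 * (4 ^+ n * e ^+ 2) + 4 ^+ n * e ^+ 2)).
  apply: lerD; last by rewrite ler_wpM2r ?exprn_ge0.
  by apply: ler_pM => //; [rewrite addr_ge0|lra].
rewrite [4 ^+ n.+1]exprS; have : 0 <= 4 ^+ n * e ^+ 2 :> R by rewrite mulr_ge0 ?exprn_ge0.
by move: (4 ^+ n) (e ^+ 2) => w v; lra.
Qed.

Lemma psum_mulX (b : nat -> C R) f T : psum b f T ->
  psum (fun k => if k is k'.+1 then b k' else 0) (fun z => z * f z) T.
Proof.
move=> bf z zT e e0; have [N HN] := tendsMl z (bf z zT) e0.
exists N.+1 => -[//|n] Nn; rewrite big_ord_recl mul0r add0r.
rewrite (_ : \sum_(i < n) _ = z * \sum_(i < n) b i * z ^+ i); first exact: HN.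
by rewrite mulr_sumr; apply: eq_bigr => i _ /=; rewrite exprS mulrCA.
Qed.

(** The coefficients of the derivative, from the difference quotients
    (phi((1 + e) z) - phi(z)) / e, which converge uniformly to z phi'(z) and
    whose coefficients are those of phi times ((1 + e)^k - 1) / e. *)
Lemma psum_derivative_coefficients (a b : nat -> C R) (phi chi : C R -> C R) T k :
  0 < T -> psum a phi T -> psum b chi T ->
  (forall z : C R, rnorm z < T -> differentiable phi z /\ 'd phi z 1 = chi z) ->
  b k = k.+1%:R * a k.+1.
Proof.
move=> T0 aphi bchi dphi.
have [d d0 [M HM]] := differentiable_bounded_near (dphi 0 (eq_ind_r (fun x => x < T : Prop) T0 rnorm0)).1.
pose S := Num.min d T; have S0 : 0 < S by rewrite lt_min d0.
have Sd : S <= d by rewrite ge_min lexx.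
have ST : S <= T by rewrite ge_min lexx orbT.
pose K := 2 * M / (S / 2) ^+ 2 * S ^+ 2.
have est e : 0 < e < 1 ->
    rnorm (toC ((1 + e) ^+ k.+1 - 1) * a k.+1 - toC e * b k) * (S / 4) ^+ k.+1 <= K * e ^+ 2.
  move=> /andP[e0 e1].
  have S4 : 0 < S / 4 by rewrite divr_gt0.
  have p1 : psum (fun k => a k * toC (1 + e) ^+ k) (fun z => phi (toC (1 + e) * z)) (S / 4).
    apply: psum_le (psum_dilate _ aphi); last by rewrite addr_gt0.
    rewrite ler_pdivlMr ?addr_gt0//.
    by have : S * e <= S; [rewrite ler_piMr ?ltW|lra].
  have p2 : psum a phi (S / 4) by apply: psum_le aphi; lra.
  have p3 : psum (fun k => if k is k'.+1 then b k' else 0) (fun z => z * chi z) (S / 4).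
    by apply: psum_le (psum_mulX bchi); lra.
  have := cauchy_estimate k.+1 S4 (psumB (psumB p1 p2) (psumZ (toC e) p3)) (M := K * e ^+ 2).
  have -> : a k.+1 * toC (1 + e) ^+ k.+1 - a k.+1 - toC e * b k =
    toC ((1 + e) ^+ k.+1 - 1) * a k.+1 - toC e * b k.
    by rewrite rmorphB rmorphXn rmorph1; ring.
  apply => z zS.
  have hz : hol_ball (phi : (C R : normedModType R[i]) -> C R) z (S / 2).
    move=> w wz; apply: (dphi w _).1; apply: (@lt_le_trans _ _ S) => //.
    have := ler_rdistD z w 0; rewrite !subr0; lra.
  have Mz (w : C R) : rnorm (w - z) < S / 2 -> rnorm (phi w) <= M.
    move=> wz; apply: HM; apply: lt_le_trans Sd.
    have := ler_rdistD z w 0; rewrite !subr0; lra.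
  have ne : rnorm (toC e * z) = e * rnorm z by rewrite rnormM rnormC gtr0_norm.
  have ez : e * rnorm z <= rnorm z by rewrite ler_piMl ?rnorm_ge0// ltW.
  have S2 : 0 < S / 2 by rewrite divr_gt0.
  have [_ H] := hol_ball_estimates S2 hz Mz (toC e * z); move: H.
  have -> : 'd (phi : (C R : normedModType R[i]) -> C R) z (toC e * z) =
      toC e * (z * chi z).
    rewrite -(dphi z _).2 ?mulrA; last lra.
    rewrite -[X in 'd _ _ X]mulr1; exact: linearZ.
  rewrite ne => /(_ _)/wrap[|H]; first lra.
  have -> : toC (1 + e) * z = z + toC e * z by rewrite rmorphD rmorph1; ring.
  apply: (le_trans H).
  have M0 : 0 <= M by apply: le_trans (rnorm_ge0 _) (Mz z _); rewrite subrr rnorm0.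
  rewrite /K -[leRHS]mulrA -[S ^+ 2 * _]exprMn; apply: ler_wpM2l.
    by apply: divr_ge0; [apply: mulr_ge0|rewrite exprn_ge0 // ltW].
  have zS' : e * rnorm z <= S * e by rewrite mulrC ler_wpM2r ?(ltW e0)//; lra.
  by rewrite !expr2; apply: ler_pM => //; rewrite mulr_ge0 ?rnorm_ge0 ?(ltW e0).
pose s := S / 4; have s0 : 0 < s ^+ k.+1 by rewrite exprn_gt0// divr_gt0.
apply/eqP; rewrite eq_sym -subr_eq0; apply/eqP/rnorm0_eq0/eqP.
rewrite eq_le rnorm_ge0 andbT.
pose D := K / s ^+ k.+1 + 4 ^+ k.+1 * rnorm (a k.+1).
apply: (@le0_small _ _ D) => e e01; have /andP[e0 e1] := e01.
have := est e e01; rewrite -ler_pdivlMr// => H1.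
have e01' : 0 <= e <= 1 by rewrite (ltW e0) (ltW e1).
have /andP[q0 q1] := expr_second_order k.+1 e01'.
rewrite -(ler_pM2l e0) -{1}[e]gtr0_norm// -rnormC -rnormM.
move: ((1 + e) ^+ k.+1 - 1) H1 q0 q1 => w H1 q0 q1.
have -> : toC e * (k.+1%:R * a k.+1 - b k) =
    (toC w * a k.+1 - toC e * b k) - toC (w - k.+1%:R * e) * a k.+1.
  by rewrite rmorphB rmorphM rmorph_nat; ring.
rewrite (le_trans (ler_rnormB _ _))// rnormM rnormC ger0_norm//.
apply: le_trans (lerD H1 (ler_wpM2r (rnorm_ge0 _) q1)) _.
rewrite /D le_eqVlt; apply/orP; left; apply/eqP.
by move: (s ^+ k.+1) s0 => t t0; field; rewrite gt_eqF.
Qed.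

Context {E : normedModType R[i]}.
Implicit Types (u x y : E) (f : E -> C R) (U : set E).

Lemma nseqSr (T : Type) k (x : T) : nseq k.+1 x = nseq k x ++ [:: x].
Proof. by elim: k => //= k <-. Qed.

(** Along the line through 0 and [x] the derivative of [f] is the directional
    derivative along [x], so [psum_derivative_coefficients] allows an induction
    on [k]. *)
Lemma taylor_coefficient U f x T a k : open U -> hol_on U f -> 0 < T ->
  (forall z : C R, rnorm z < T -> U (z *: x)) ->
  psum a (fun z => f (z *: x)) T ->
  a k = toC (k`!%:R^-1) * iter_diff (nseq k x) f 0.
Proof.
move=> oU + T0 xU; elim: k f a => [|k IH] f a fU af.
  rewrite fact0 invr1 rmorph1 mul1r /= -(psum_at0 T0 af).
  by rewrite scale0r.
have dxU := hol_on_directional x oU fU.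
have sl (z : C R) : rnorm z < T -> differentiable (fun z : C R => f (z *: x) : C R) z /\
    'd (fun z : C R => f (z *: x) : C R) z 1 = 'd f (z *: x) x.
  move=> /xU Uz; have := @diff_slice _ _ f 0 x z; rewrite add0r => /(_ (fU _ Uz)).
  rewrite (_ : (fun z => f (0 + z *: x)) = (fun z => f (z *: x)))//.
  by apply/funext => w; rewrite add0r.
have dsl (z : C R) : rnorm z < T ->
    differentiable (fun z : C R => 'd f (z *: x) x : C R) z.
  move=> /xU Uz; have := @diff_slice _ _ (fun u => 'd f u x) 0 x z.
  rewrite add0r => /(_ (dxU _ Uz))[+ _].
  rewrite (_ : (fun z => 'd f (0 + z *: x) x) = (fun z => 'd f (z *: x) x))//.
  by apply/funext => w; rewrite add0r.
have [b bf] := taylor_series dsl.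
have := psum_derivative_coefficients k T0 af bf sl.
rewrite (IH _ _ dxU bf) nseqSr iter_diff_cat => ab.
have k0 : k.+1%:R != 0 :> C R by rewrite pnatr_eq0.
apply: (mulfI k0); rewrite -ab factS natrM invfM rmorphM mulrA.
by rewrite -(rmorph_nat toC) mulrA -rmorphM mulfV ?rmorph1 ?mul1r// pnatr_eq0.
Qed.

Definition taylor_component f k x : C R :=
  toC (k`!%:R^-1) * iter_diff (nseq k x) f 0.

Lemma taylor_component_psum U f x T : open U -> hol_on U f -> 0 < T ->
  (forall z : C R, rnorm z < T -> U (z *: x)) ->
  psum (taylor_component f ^~ x) (fun z => f (z *: x)) T.
Proof.
move=> oU fU T0 xU; have [z zT|a af] := @taylor_series R (fun z => f (z *: x)) T.
  have := @diff_slice _ _ f 0 x z; rewrite add0r => /(_ (fU _ (xU z zT)))[+ _].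
  rewrite (_ : (fun z => f (0 + z *: x)) = (fun z => f (z *: x)))//.
  by apply/funext => w; rewrite add0r.
rewrite (_ : taylor_component f ^~ x = a)//; apply/funext => k.
by rewrite (taylor_coefficient k oU fU T0 xU af).
Qed.

(** The form is the iterated differential at 0, one direction for each slot. *)
Lemma taylor_component_homogeneous U f k : open U -> hol_on U f -> U 0 ->
  homogeneous_polynomial k (taylor_component f k).
Proof.
move=> oU fU U0.
exists (fun v => toC (k`!%:R^-1) * iter_diff [seq v i | i <- enum 'I_k] f 0).
  move=> v i a x y; set c := toC _.
  have := enum_uniq 'I_k; case/splitPr: (mem_enum 'I_k i) => s t.
  rewrite cat_uniq /= => /and3P[_ + /andP[it _]].
  rewrite negb_or => /andP[si _].
  have eqv (r : seq 'I_k) : i \notin r -> forall w : E,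
      [seq (dfwith v i w : 'I_k -> E) j | j <- r] = [seq v j | j <- r].
    move=> ir w; apply/eq_in_map => j jr; apply: dfwithout.
    by apply: contraNneq ir => ->.
  rewrite !map_cat /= !dfwithin !eqv//.
  rewrite (iter_diff_slot_linear _ _ _ _ _ oU fU U0) /GRing.scale /=.
  by rewrite mulrDr mulrCA.
move=> x; rewrite /taylor_component; congr (_ * iter_diff _ _ _).
by rewrite -[in LHS](size_enum_ord k); elim: (enum _) => //= i s <-.
Qed.

End TaylorComponents.

(** * Operations on polynomials *)

Section PolynomialAlgebra.
Context {R : realType} {E : normedModType R[i]}.
Implicit Types (u x y h : E) (P Q : E -> C R).

Lemma multilinear_slot k (L : ('I_k -> E) -> C R) (v : 'I_k -> E) i (a : C R) x y :
  multilinear_form L ->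
  L (dfwith v i (a *: x + y)) = a * L (dfwith v i x) + L (dfwith v i y).
Proof. by move=> LL; have := LL v i a x y. Qed.

Lemma dfwith_id k (v : 'I_k -> E) i : dfwith v i (v i) = v.
Proof. by apply/funext => j; case: dfwithP. Qed.

Lemma multilinear_scale k (L : ('I_k -> E) -> C R) (v : 'I_k -> E) (a : C R) :
  multilinear_form L -> L (fun i => a *: v i) = a ^+ k * L v.
Proof.
move=> LL; pose w n (i : 'I_k) := if (i < n)%N then a *: v i else v i.
have scale (u : 'I_k -> E) i x : L (dfwith u i (a *: x)) = a * L (dfwith u i x).
  have L0 : L (dfwith u i 0) = 0.
    have := multilinear_slot u i 1 0 0 LL; rewrite scale1r addr0 mul1r => /eqP.
    by rewrite -subr_eq subrr => /eqP.
  by rewrite -[a *: x]addr0 multilinear_slot// L0 addr0.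
have Hw n : (n <= k)%N -> L (w n) = a ^+ n * L v.
  elim: n => [|n IH] nk; first by rewrite mul1r; congr L; apply/funext.
  pose i := Ordinal nk.
  have -> : w n.+1 = dfwith (w n) i (a *: v i).
    apply/funext => j; case: dfwithP => [|j' ij]; first by rewrite /w /= ltnS leqnn.
    rewrite /w ltnS leq_eqVlt (_ : (_ == _) = false)//.
    by apply/negbTE; apply: contra ij => /eqP ji; apply/eqP/val_inj.
  rewrite scale exprS -mulrA -IH ?(ltnW nk)//; congr (_ * L _).
  by rewrite -[RHS](dfwith_id _ i) {3}/w /= ltnn.
by rewrite -(Hw k)//; congr L; apply/funext => i; rewrite /w ltn_ord.
Qed.

Lemma homogeneousZ k P (a : C R) x : homogeneous_polynomial k P ->
  P (a *: x) = a ^+ k * P x.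
Proof. by move=> [L LL LP]; rewrite !LP -multilinear_scale. Qed.

Lemma homogeneous1_linear P : homogeneous_polynomial 1 P -> linear P.
Proof.
move=> [L LL LP] a x y.
have E1 z : P z = L (dfwith (fun=> 0) ord0 z).
  by rewrite LP; congr L; apply/funext => i; rewrite (ord1 i) dfwithin.
by rewrite !E1; exact: multilinear_slot.
Qed.

Lemma homogeneous0 k : homogeneous_polynomial k (fun _ : E => 0 : C R).
Proof. by exists (fun=> 0) => // v i a x y; rewrite scaler0 addr0. Qed.

Lemma homogeneous_cst (c : C R) : homogeneous_polynomial 0 (fun _ : E => c).
Proof. by exists (fun=> c) => // v []. Qed.

Lemma homogeneousM k l P Q : homogeneous_polynomial k P ->
  homogeneous_polynomial l Q -> homogeneous_polynomial (k + l) (fun x => P x * Q x).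
Proof.
move=> [L LL LP] [M MM MP].
exists (fun v => L (v \o @lshift k l) * M (v \o @rshift k l)); last first.
  by move=> x; rewrite LP MP.
move=> v i a x y; rewrite -[X in _ = X + _]/(a * _).
have [j ij|j ij] := splitP i.
- have -> : i = lshift l j by apply: val_inj.
  have E1 z : dfwith v (lshift l j) z \o @lshift k l = dfwith (v \o @lshift k l) j z.
    apply/funext => j' /=; have [<-|jj] := eqVneq j j'; first by rewrite !dfwithin.
    by rewrite !dfwithout// (inj_eq (@lshift_inj _ _)).
  have E2 z : dfwith v (lshift l j) z \o @rshift k l = v \o @rshift k l.
    by apply/funext => j' /=; rewrite dfwithout// eq_lrshift.
  by rewrite !E1 !E2 multilinear_slot// mulrDl mulrA.
- have -> : i = rshift k j by apply: val_inj.
  have E1 z : dfwith v (rshift k j) z \o @rshift k l = dfwith (v \o @rshift k l) j z.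
    apply/funext => j' /=; have [<-|jj] := eqVneq j j'; first by rewrite !dfwithin.
    by rewrite !dfwithout// (inj_eq (@rshift_inj _ _)).
  have E2 z : dfwith v (rshift k j) z \o @lshift k l = v \o @lshift k l.
    by apply/funext => j' /=; rewrite dfwithout// eq_rlshift.
  by rewrite !E1 !E2 multilinear_slot// mulrDr mulrCA.
Qed.

Lemma homogeneous_polynomial_map k P : homogeneous_polynomial k P -> polynomial_map P.
Proof.
move=> kP; exists k.+1, (fun j => if j == k then P else fun=> 0); split.
  by move=> j; case: eqP => [->//|_]; exact: homogeneous0.
move=> x; rewrite big_ord_recr /= eqxx big1 ?add0r// => i _.
by rewrite ltn_eqF.
Qed.

Lemma homogeneousD k P Q : homogeneous_polynomial k P ->
  homogeneous_polynomial k Q -> homogeneous_polynomial k (fun x => P x + Q x).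
Proof.
move=> [L LL LP] [M MM MP]; exists (fun v => L v + M v); last by move=> x; rewrite LP MP.
move=> v i a x y; rewrite -[X in _ = X + _]/(a * _) !multilinear_slot// mulrDr.
by rewrite addrACA.
Qed.

Lemma polynomial_mapD P Q : polynomial_map P -> polynomial_map Q ->
  polynomial_map (fun x => P x + Q x).
Proof.
move=> [m [F [hF FP]]] [n [G [hG GQ]]].
pose pad l (H : nat -> E -> C R) j := if (j < l)%N then H j else fun=> 0.
have padE l (H : nat -> E -> C R) x : (l <= maxn m n)%N ->
    \sum_(j < l) H j x = \sum_(j < maxn m n) pad l H j x.
  move=> lm; rewrite (big_ord_widen _ (fun j => H j x) lm) big_mkcond /=.
  by apply: eq_bigr => j _; rewrite /pad; case: ifP.
exists (maxn m n), (fun j x => pad m F j x + pad n G j x); split.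
  move=> k; rewrite /pad; apply: homogeneousD.
    by case: ifP => // _; exact: homogeneous0.
  by case: ifP => // _; exact: homogeneous0.
move=> x; rewrite FP GQ (padE m F x (leq_maxl _ _)) (padE n G x (leq_maxr _ _)).
by rewrite -big_split.
Qed.

Lemma polynomial_map_sum (I : Type) (s : seq I) (p : pred I) (F : I -> E -> C R) :
  (forall i, p i -> polynomial_map (F i)) ->
  polynomial_map (fun x => \sum_(i <- s | p i) F i x).
Proof.
move=> H; elim: s => [|i s IH].
  rewrite (_ : (fun x => _) = fun=> 0); last by apply/funext => x; rewrite big_nil.
  exact: homogeneous_polynomial_map (homogeneous0 0).
have [pi|pi] := boolP (p i).
  rewrite (_ : (fun x => _) = fun x => F i x + \sum_(j <- s | p j) F j x).
    by apply: polynomial_mapD; first exact: H.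
  by apply/funext => x; rewrite big_cons pi.
rewrite (_ : (fun x => _) = fun x => \sum_(j <- s | p j) F j x)//.
by apply/funext => x; rewrite big_cons (negPf pi).
Qed.

Lemma polynomial_mapM P Q : polynomial_map P -> polynomial_map Q ->
  polynomial_map (fun x => P x * Q x).
Proof.
move=> [m [F [hF FP]]] [n [G [hG GQ]]].
rewrite (_ : (fun x => _) = fun x => \sum_(i < m) \sum_(j < n) F i x * G j x).
  apply: polynomial_map_sum => i _; apply: polynomial_map_sum => j _.
  by apply: homogeneous_polynomial_map; exact: homogeneousM.
apply/funext => x; rewrite FP GQ mulr_suml; apply: eq_bigr => i _.
by rewrite mulr_sumr.
Qed.

Lemma polynomial_map_dilate P (a : C R) : polynomial_map P ->
  polynomial_map (fun x => P (a *: x)).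
Proof.
move=> [m [F [hF FP]]].
rewrite (_ : (fun x => _) = fun x => \sum_(i < m) a ^+ i * F i x).
  apply: polynomial_map_sum => i _; rewrite -[i : nat]add0n.
  apply: homogeneous_polynomial_map.
  exact: homogeneousM (homogeneous_cst _) (hF _).
by apply/funext => x; rewrite FP; apply: eq_bigr => i _; exact: homogeneousZ.
Qed.

(** Expanding L(x + h, ..., x + h) slot by slot: the slots in [A] are still to be
    expanded, those in [B] contain x and the others h. *)
Lemma polynomial_map_slots k (L : ('I_k -> E) -> C R) h (A B : {set 'I_k}) :
  multilinear_form L -> {in A, forall i, i \notin B} ->
  polynomial_map (fun x =>
    L (fun i => if i \in A then x + h else if i \in B then x else h)).
Proof.
move=> LL; move En : #|A| => n; elim: n A B En => [|n IH] A B An AB.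
  have A0 : A = finset.set0 by apply: cards0_eq.
  apply: (@homogeneous_polynomial_map #|B|).
  pose w (v : 'I_#|B| -> E) i :=
    if [pick j : 'I_#|B| | enum_val j == i] is Some j then v j else h.
  exists (fun v => L (w v)).
    move=> v j a x y; rewrite -[X in _ = X + _]/(a * _).
    have E1 z : w (dfwith v j z) = dfwith (w v) (enum_val j) z.
      apply/funext => i; rewrite {1}/w; case: pickP => [j' /eqP <-|nj].
        have [<-|jj] := eqVneq j j'; first by rewrite !dfwithin.
        rewrite !dfwithout ?(inj_eq enum_val_inj)// /w.
        case: pickP => [l /eqP/enum_val_inj ->//|].
        by move=> /(_ j'); rewrite eqxx.
      rewrite dfwithout; last by have /negbT := nj j.
      rewrite /w; case: pickP => // l; by rewrite nj.
    by rewrite !E1 multilinear_slot.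
  move=> x; congr L; apply/funext => i; rewrite A0 finset.in_set0 /w.
  case: pickP => [j /eqP <-|nj]; first by rewrite enum_valP.
  case: ifPn => // iB; have := nj (enum_rank_in iB i).
  by rewrite enum_rankK_in// eqxx.
have [i iA] : exists i, i \in A by apply/set0Pn; rewrite -card_gt0 An.
have iB : i \notin B by exact: AB.
pose A' := (A :\ i)%SET.
have A'n : #|A'| = n by move: An; rewrite (cardsD1 i A) iA => -[].
have d1 : {in A', forall j, j \notin B}.
  by move=> j; rewrite finset.in_setD1 => /andP[_ /AB].
have d2 : {in A', forall j, j \notin (i |: B)%SET}.
  move=> j; rewrite finset.in_setD1 finset.in_setU1 => /andP[ji /AB jB].
  by rewrite (negPf ji).
rewrite (_ : (fun x => _) = fun x =>
    L (fun j => if j \in A' then x + h else if j \in (i |: B)%SET then x else h) +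
    L (fun j => if j \in A' then x + h else if j \in B then x else h)).
  by apply: polynomial_mapD; exact: IH.
apply/funext => x.
set w := fun j => if j \in A' then x + h else if j \in B then x else h.
have -> : (fun j => if j \in A then x + h else if j \in B then x else h) =
    dfwith w i (1 *: x + h).
  apply/funext => j; case: dfwithP => [|j' ij]; first by rewrite iA scale1r.
  by rewrite /w finset.in_setD1 eq_sym ij.
have -> : (fun j => if j \in A' then x + h else if j \in (i |: B)%SET then x else h) =
    dfwith w i x.
  apply/funext => j; case: dfwithP => [|j' ij].
    by rewrite finset.in_setD1 eqxx finset.in_setU1 eqxx.
  by rewrite /w finset.in_setU1 [j' == i]eq_sym (negPf ij).
rewrite multilinear_slot// mul1r; congr (_ + L _).
have wi : w i = h by rewrite /w finset.in_setD1 eqxx /= (negPf iB).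
by rewrite -[X in dfwith w i X]wi dfwith_id.
Qed.

Lemma polynomial_map_shift P h : polynomial_map P ->
  polynomial_map (fun x => P (x + h)).
Proof.
move=> [m [F [hF FP]]].
rewrite (_ : (fun x => _) = fun x => \sum_(i < m) F i (x + h)); last first.
  by apply/funext => x; exact: FP.
apply: polynomial_map_sum => i _; have [L LL LP] := hF i.
have := @polynomial_map_slots i L h [set: 'I_i]%SET finset.set0 LL.
have d : {in [set: 'I_i]%SET, forall j, j \notin finset.set0}.
  by move=> j _; rewrite finset.in_set0.
move=> /(_ d).
rewrite (_ : (fun x => L _) = fun x => F i (x + h))//.
apply/funext => x; rewrite LP; congr L; apply/funext => j.
by rewrite finset.in_setT.
Qed.

End PolynomialAlgebra.

(** * Continuous polynomials *)

Section ContinuousPolynomials.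
Context {R : realType} {E : normedModType R[i]}.
Implicit Types (u x y h : E) (P Q : E -> C R).

Lemma polynomial_line_psum P u : polynomial_map P -> exists (m : nat) (Q : nat -> E -> C R),
  (forall k, homogeneous_polynomial k (Q k)) /\
  (forall h, P (u + h) = \sum_(k < m) Q k h) /\
  forall h T, psum (fun k => if (k < m)%N then Q k h else 0) (fun z => P (u + z *: h)) T.
Proof.
move=> /(polynomial_map_shift u) [m [Q [hQ QP]]]; exists m, Q; split=> //; split.
  by move=> h; rewrite addrC QP.
move=> h T; apply: (psum_ext _ (@psum_polynomial R (Q ^~ h) m T)) => z _.
by rewrite addrC QP; apply: eq_bigr => k _; rewrite (homogeneousZ _ _ (hQ k)) mulrC.
Qed.

(** Cauchy's estimates on lines bound the part of degree 1 at [u] and the sum of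
    the parts of higher degree. *)
Lemma polynomial_differentiable P u d M : polynomial_map P -> 0 < d ->
  (forall x, rnorm (x - u) < d -> rnorm (P x) <= M) -> differentiable P u.
Proof.
move=> /(polynomial_line_psum u)[m [Q [hQ [_ Qs]]]] d0 HM.
pose l h : C R := if (1 < m)%N then Q 1%N h else 0.
have ll : linear l.
  move=> a x y; rewrite /l; case: ifP => _; first exact: (homogeneous1_linear (hQ 1%N)).
  by rewrite scaler0 addr0.
have M0 : 0 <= M by apply: le_trans (rnorm_ge0 _) (HM u _); rewrite subrr rnorm0.
pose K := M / d + 2 * M / d ^+ 2.
have K1 : M / d <= K by rewrite lerDl divr_ge0 ?exprn_ge0 ?mulr_ge0 ?(ltW d0).
have K2 : 2 * M / d ^+ 2 <= K by rewrite lerDr divr_ge0 ?(ltW d0).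
have key h : rnorm h < d / 2 ->
  rnorm (l h) <= K * rnorm h /\ rnorm (P (u + h) - P u - l h) <= K * rnorm h ^+ 2.
  have [->|h0] := eqVneq h 0.
    have l0 : l 0 = 0.
      by have := ll (-1) 0 0; rewrite scaler0 addr0 scaleN1r addNr.
    by rewrite l0 !rnorm0 mulr0 addr0 subrr subr0 rnorm0 expr0n mulr0.
  move=> hd; have nh := rnorm_gt0 h0; pose T := d / rnorm h.
  have T0 : 0 < T by rewrite divr_gt0.
  have sM (z : C R) : rnorm z < T -> rnorm (P (u + z *: h)) <= M.
    move=> zT; apply: HM; rewrite addrAC subrr add0r rnormZ.
    by rewrite -ltr_pdivlMr.
  split.
    apply: (@le_trans _ _ (M / d * rnorm h)); last by rewrite ler_wpM2r ?rnorm_ge0.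
    have := cauchy_estimate 1 T0 (Qs h T) sM; rewrite expr1 -ler_pdivlMr//.
    by move=> /le_trans; apply; rewrite /T invf_div mulrA mulrAC.
  apply: (@le_trans _ _ (2 * M / d ^+ 2 * rnorm h ^+ 2)); last first.
    by rewrite ler_wpM2r ?exprn_ge0 ?rnorm_ge0.
  have := psum_second_order (z := 1) T0 (Qs h T) sM.
  rewrite scale1r mulr1 scale0r addr0 rnorm1.
  have -> : 1 / T = rnorm h / d by rewrite /T div1r invf_div.
  have -> : 1 <= T / 2 by rewrite /T mulrAC ler_pdivlMr// mul1r ltW.
  move=> /(_ isT)/le_trans; apply; rewrite le_eqVlt; apply/orP; left; apply/eqP.
  by field; rewrite gt_eqF.
apply: (@quadratic_differentiable _ _ _ P l u (d / 2) K ll (divr_gt0 d0 (ltr0n R 2)) _ _).1.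
  by move=> h /key[].
by move=> h /key[].
Qed.

Lemma continuous_polynomialP P :
  continuous_polynomial P <-> polynomial_map P /\ forall u, differentiable P u.
Proof.
split=> -[pP cP]; (split; first exact: pP) => u; last first.
  exact: (differentiable_continuous (cP u)).
have /continuous_rnormP/(_ 1 ltr01)[d d0 Hd] := cP u.
apply: (@polynomial_differentiable P u d (rnorm (P u) + 1)) => // x /Hd xu.
by rewrite -[P x](subrK (P u)) (le_trans (ler_rnormD _ _))// addrC lerD// ltW.
Qed.

Lemma continuous_polynomial_cst (c : C R) : continuous_polynomial (fun _ : E => c).
Proof.
apply/continuous_polynomialP; split; first exact: homogeneous_polynomial_map (homogeneous_cst c).
by move=> u; exact: differentiable_cst.
Qed.

Lemma continuous_polynomialM P Q : continuous_polynomial P ->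
  continuous_polynomial Q -> continuous_polynomial (fun x => P x * Q x).
Proof.
move=> /continuous_polynomialP[pP dP] /continuous_polynomialP[pQ dQ].
apply/continuous_polynomialP; split; first exact: polynomial_mapM.
by move=> u; apply: (@differentiableM _ _ P Q).
Qed.

Lemma continuous_polynomialX P n : continuous_polynomial P ->
  continuous_polynomial (fun x => P x ^+ n).
Proof.
move=> cP; elim: n => [|n IH].
  rewrite (_ : (fun x => _) = fun=> 1); first exact: continuous_polynomial_cst.
  by apply/funext => x; rewrite expr0.
rewrite (_ : (fun x => _) = fun x => P x * P x ^+ n).
  exact: continuous_polynomialM.
by apply/funext => x; rewrite exprS.
Qed.

Lemma continuous_polynomialD P Q : continuous_polynomial P ->
  continuous_polynomial Q -> continuous_polynomial (fun x => P x + Q x).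
Proof.
move=> /continuous_polynomialP[pP dP] /continuous_polynomialP[pQ dQ].
apply/continuous_polynomialP; split; first exact: polynomial_mapD.
by move=> u; apply: (@differentiableD _ _ _ P Q).
Qed.

Lemma continuous_polynomial_sum (F : nat -> E -> C R) n :
  (forall k, continuous_polynomial (F k)) ->
  continuous_polynomial (fun x => \sum_(k < n) F k x).
Proof.
move=> cF; elim: n => [|n IH].
  rewrite (_ : (fun x => _) = fun=> 0); first exact: continuous_polynomial_cst.
  by apply/funext => x; rewrite big_ord0.
rewrite (_ : (fun x => _) = fun x => \sum_(k < n) F k x + F n x).
  exact: (@continuous_polynomialD (fun x => \sum_(k < n) F k x) (F n) IH (cF n)).
by apply/funext => x; rewrite big_ord_recr.
Qed.

Lemma continuous_polynomial_shift P h : continuous_polynomial P ->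
  continuous_polynomial (fun x => P (x + h)).
Proof.
move=> /continuous_polynomialP[pP dP]; apply/continuous_polynomialP; split.
  exact: polynomial_map_shift.
by move=> u; apply: (@differentiable_comp _ _ _ _ (fun v => v + h)).
Qed.

Lemma continuous_polynomial_dilate P (a : C R) : continuous_polynomial P ->
  continuous_polynomial (fun x => P (a *: x)).
Proof.
move=> /continuous_polynomialP[pP dP]; apply/continuous_polynomialP; split.
  exact: polynomial_map_dilate.
move=> u; apply: (@differentiable_comp _ _ _ _ (fun v => a *: v)) => //.
Qed.

(** Balls need not be compact, but the homogeneous components are bounded near 0
    by Cauchy's estimates, hence on all balls. *)
Lemma continuous_polynomial_bounded P (r : R) : continuous_polynomial P ->
  exists B, forall x, rnorm x <= r -> rnorm (P x) <= B.
Proof.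
move=> /continuous_polynomialP[pP dP].
have [m [Q [hQ [PQ Qs]]]] := polynomial_line_psum 0 pP.
have [d d0 [M HM]] := differentiable_bounded_near (dP 0).
have r1 : 0 < `|r| + 1 by rewrite ltr_wpDl.
pose T := d / (`|r| + 1); have T0 : 0 < T by rewrite divr_gt0.
exists (\sum_(k < m) M / T ^+ k) => x xr.
rewrite -[x]add0r PQ (le_trans (ler_rnorm_sum _ _ _))//; apply: ler_sum => k _.
have := cauchy_estimate k T0 (Qs x T) (M := M); rewrite ltn_ord => H.
rewrite ler_pdivlMr ?exprn_gt0//; apply: H => z zT; apply: HM.
rewrite subr0 add0r rnormZ; apply: (@le_lt_trans _ _ (rnorm z * (`|r| + 1))).
  rewrite ler_wpM2l ?rnorm_ge0// (le_trans xr)// (le_trans (ler_norm _))//.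
  by rewrite lerDl.
by rewrite -ltr_pdivlMr.
Qed.

(** Cauchy's estimates bound the component near 0, homogeneity bounds it near
    every other point, and [polynomial_differentiable] applies. *)
Lemma taylor_component_continuous (U : set E) (f : E -> C R) k : open U -> hol_on U f -> U 0 ->
  continuous_polynomial (taylor_component f k).
Proof.
move=> oU fU U0; have hk := taylor_component_homogeneous k oU fU U0.
have pk := homogeneous_polynomial_map hk.
apply/continuous_polynomialP; split; first exact: pk.
move=> u.
have [r r0 [_ rU]] := hol_on_ball oU U0 fU.
have [d d0 [M HM]] := differentiable_bounded_near (fU 0 U0).
pose s := Num.min r d; have s0 : 0 < s by rewrite lt_min r0.
have sU x : rnorm x < s -> U x.
  by move=> xs; apply: rU; rewrite subr0 (lt_le_trans xs)// ge_min lexx.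
have small x : rnorm x < s -> rnorm (taylor_component f k x) <= M.
  move=> xs.
  have xz (z : C R) : rnorm z < 1 -> rnorm (z *: x) < s.
    by move=> z1; rewrite rnormZ (le_lt_trans _ xs)// ler_piMl ?rnorm_ge0// ltW.
  have fx := @taylor_component_psum R E U f x 1 oU fU ltr01 (fun z z1 => sU _ (xz z z1)).
  have := cauchy_estimate k ltr01 fx (M := M).
  rewrite expr1n mulr1; apply => z z1; apply: HM; rewrite subr0.
  by rewrite (lt_le_trans (xz z z1))// ge_min lexx orbT.
pose t := s / (rnorm u + 1).
have u1 : 0 < rnorm u + 1 by rewrite ltr_wpDl// rnorm_ge0.
have t0 : 0 < t by rewrite divr_gt0.
apply: (@polynomial_differentiable _ u 1 (M / t ^+ k) pk ltr01) => x xu.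
have nx : rnorm x < rnorm u + 1.
  by rewrite -[x](subrK u) (le_lt_trans (ler_rnormD _ _))// addrC ltrD2l.
have /small : rnorm (toC t *: x) < s.
  rewrite rnormZ rnormC gtr0_norm// /t mulrAC ltr_pdivrMr//.
  by rewrite ltr_pM2l.
rewrite (homogeneousZ _ _ hk) rnormM rnormX rnormC gtr0_norm// mulrC.
by rewrite ler_pdivlMr// exprn_gt0.
Qed.

End ContinuousPolynomials.

(** * Polynomial hulls of U-bounded sets *)

Section Hulls.
Context {R : realType} {E : normedModType R[i]}.
Implicit Types (x y z h : E) (A U : set E) (P g : E -> C R).

Lemma UboundedP U A : Ubounded U A <->
  [/\ A `<=` U, exists M, forall x, A x -> rnorm x <= M &
      exists2 r : R, 0 < r & forall x y, A x -> rnorm (y - x) < r -> U y].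
Proof.
split=> -[AU bA].
  move=> [r r0 Hr]; split=> //.
    have [M [Mr HM]] := bA; exists (complex.Re (M + 1)) => x Ax.
    have : `|x| <= M + 1 by apply: HM => //; rewrite ltrDl.
    have Mr1 : M + 1 \is Num.real by rewrite realD.
    by rewrite -(RRe_real Mr1) rnorm_le.
  exists (complex.Re r); first by have := r0; rewrite -{1}(RRe_real (gtr0_real r0)) ltcR.
  move=> x y Ax yx; apply: contrapT => Uy; have := Hr x y Ax Uy.
  by rewrite -(RRe_real (gtr0_real r0)) normE lecR leNgt rdistC yx.
move=> [r r0 Hr]; split=> //.
  have [M HM] := bA; exists (toC M); split; first by rewrite /toC complex_real.
  by move=> N MN x Ax; apply: ltW; apply: le_lt_trans MN; rewrite rnorm_le HM.
exists (toC r); first by rewrite ltcR.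
move=> x y Ax Uy; rewrite normE lecR leNgt; apply/negP => xy; apply: Uy.
by apply: Hr Ax _; rewrite rdistC.
Qed.

(** Bounds by real numbers replace the supremum, whatever its value in the
    extended reals. *)
Lemma poly_hullP A z : poly_hull A z <-> forall P M, continuous_polynomial P ->
  (forall x, A x -> rnorm (P x) <= M) -> rnorm (P z) <= M.
Proof.
split=> [Az P M cP HM|H P cP].
  have := Az P cP; rewrite -lee_fin => /le_trans; apply.
  by apply: ge_ereal_sup => _ [x Ax <-]; rewrite lee_fin HM.
have ub x : A x -> ((rnorm (P x))%:E <= esupnorm P A)%E.
  by move=> Ax; apply: ereal_sup_ubound; exists x.
case: (esupnorm P A) ub => [r| |] ub; last 2 first.
- by rewrite leey.
- have : rnorm (P z) <= -1 by apply: H => // x /ub.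
  by move=> /(le_trans (rnorm_ge0 _)); rewrite lerNr oppr0 leNgt ltr01.
- by rewrite lee_fin; apply: H => // x /ub.
Qed.

Lemma poly_hull_nonempty A z : poly_hull A z -> exists x, A x.
Proof.
move=> /poly_hullP H; apply: contrapT => nA.
have := H (fun=> 0) (-1) (continuous_polynomial_cst 0).
rewrite rnorm0 lerNr oppr0 leNgt ltr01 => /(_ _)/wrap[] // x Ax.
by exfalso; apply: nA; exists x.
Qed.

Lemma domain_hullP U z :
  domain_hull U z <-> exists2 A, Ubounded U A & poly_hull A z.
Proof.
split=> [[n _ zn]|[A UA zA]].
  by exists (exhaustion U n) => //; exact: exhaustion_Ubounded.
have [n An] := (exhaustion_fundamental U).2 A UA.
by exists n => //; exact: poly_hullS zA.
Qed.

Definition thickening A (d : R) : set E := [set y | exists2 x, A x & rnorm (y - x) < d].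

Lemma Ubounded_thickening U A : Ubounded U A ->
  exists2 d : R, 0 < d & Ubounded U (thickening A d).
Proof.
move=> /UboundedP[AU [M HM] [r r0 Hr]]; exists (r / 2); first by rewrite divr_gt0.
apply/UboundedP; split.
- move=> y [x Ax yx]; apply: Hr Ax _; apply: lt_trans yx _.
  by rewrite ltr_pdivrMr// ltr_pMr// ltr1n.
- exists (r / 2 + M) => y [x Ax yx]; rewrite -[y](subrK x).
  by rewrite (le_trans (ler_rnormD _ _))// lerD ?HM// ltW.
- exists (r / 2); first by rewrite divr_gt0.
  move=> y w [x Ax yx] wy; apply: Hr Ax _.
  by rewrite (le_lt_trans (ler_rdistD y _ _))// [r]splitr ltrD.
Qed.

(** Translations preserve the continuous polynomials, so hulls have translates
    in the hulls of slightly larger sets; this makes the hull of [U] open. *)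
Lemma poly_hull_thickening A d z h : poly_hull A z -> rnorm h < d ->
  poly_hull (thickening A d) (z + h).
Proof.
move=> /poly_hullP Az hd; apply/poly_hullP => P M cP HM.
apply: (Az (fun x => P (x + h)) M (continuous_polynomial_shift h cP)) => x Ax.
by apply: HM; exists x => //; rewrite addrAC subrr add0r.
Qed.

Definition dilation A (t : R) : set E :=
  [set y | exists2 x, A x & exists2 a : C R, rnorm a <= t & y = a *: x].

Lemma poly_hull_dilation A t z (a : C R) : poly_hull A z -> rnorm a <= t ->
  poly_hull (dilation A t) (a *: z).
Proof.
move=> /poly_hullP Az at'; apply/poly_hullP => P M cP HM.
apply: (Az (fun x => P (a *: x)) M (continuous_polynomial_dilate a cP)) => x Ax.
by apply: HM; exists x => //; exists a.
Qed.

(** Near 0 the dilated set stays in a ball inside [U]; away from 0 a ball around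
    a point of [U], multiplied by a scalar of modulus at most 1, is a ball of
    comparable radius inside [U]. *)
Lemma Ubounded_dilation U A : open U -> balanced U -> U 0 -> Ubounded U A ->
  exists2 e : R, 0 < e & Ubounded U (dilation A (1 + e)).
Proof.
move=> /open_rnormP/(_ 0) oU balU /oU[s s0 Hs] /UboundedP[AU [M' HM'] [r r0 Hr]].
pose M := `|M'| + 1; have M0 : 0 < M by rewrite ltr_wpDl.
have HM x : A x -> rnorm x <= M.
  by move=> /HM' /le_trans; apply; rewrite (le_trans (ler_norm _))// lerDl.
have s20 : 0 < s / 2 by exact: divr_gt0.
have r20 : 0 < r / 2 by exact: divr_gt0.
have M20 : 0 < 2 * M by exact: mulr_gt0.
pose e := Num.min 1 (r / 2 / M).
have e0 : 0 < e by rewrite lt_min ltr01; exact: divr_gt0.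
have e1 : e <= 1 by rewrite ge_min lexx.
have eM : e * M <= r / 2 by rewrite -ler_pdivlMr// ge_min lexx orbT.
pose c := s / 2 / (2 * M); have c0 : 0 < c by exact: divr_gt0.
pose t := Num.min (s / 2) (c * (r / 2)).
have t0 : 0 < t by rewrite lt_min s20; exact: mulr_gt0.
have key y w : dilation A (1 + e) y -> rnorm (w - y) < t -> U w.
  move=> [x Ax [a ae ->]] wy.
  have wy1 : rnorm (w - a *: x) < s / 2 by rewrite (lt_le_trans wy)// ge_min lexx.
  have wy2 : rnorm (w - a *: x) < c * (r / 2) by rewrite (lt_le_trans wy)// ge_min lexx orbT.
  pose sigma := Num.max 1 (rnorm a).
  have s1 : 1 <= sigma by rewrite le_max lexx.
  have se : sigma <= 1 + e by rewrite ge_max lerDl (ltW e0).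
  have sg0 : 0 < sigma by rewrite (lt_le_trans ltr01).
  pose mu := a / toC sigma.
  have nmu : rnorm mu = rnorm a / sigma.
    by rewrite rnormM rnormV rnormC ger0_norm// ltW.
  have mu1 : rnorm mu <= 1 by rewrite nmu ler_pdivrMr// mul1r le_max lexx orbT.
  have amu : a = mu * toC sigma by rewrite /mu divfK// toC_eq0 gt_eqF.
  have [muc|cmu] := leP (rnorm mu) c.
    apply: Hs; rewrite subr0 -[w](subrK (a *: x)).
    rewrite (le_lt_trans (ler_rnormD _ _))// [s]splitr ltr_leD// rnormZ.
    have ax : rnorm a <= c * 2.
      rewrite amu rnormM rnormC gtr0_norm//; apply: ler_pM; rewrite ?rnorm_ge0 ?(ltW sg0)//.
      by rewrite (le_trans se)//; lra.
    apply: le_trans (ler_pM (rnorm_ge0 _) (rnorm_ge0 _) ax (HM x Ax)) _.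
    by rewrite /c le_eqVlt; apply/orP; left; apply/eqP; field; rewrite gt_eqF.
  have mu0 : mu != 0 by apply/eqP => m0; move: cmu; rewrite m0 rnorm0 ltNge ltW.
  have -> : w = mu *: (mu^-1 *: w) by rewrite scalerA mulfV// scale1r.
  apply: balU; first by rewrite (rnorm_le (mu : C R) 1).
  apply: (Hr x _ Ax).
  have -> : mu^-1 *: w - x = mu^-1 *: (w - a *: x) + toC (sigma - 1) *: x.
    rewrite scalerBr scalerA amu mulKf// rmorphB rmorph1 scalerBl scale1r.
    by rewrite addrA subrK.
  rewrite (le_lt_trans (ler_rnormD _ _))// [r]splitr ltr_leD//.
    rewrite rnormZ rnormV ltr_pdivrMl ?(lt_trans c0)//.
    by rewrite (lt_trans wy2)// ltr_pM2r// divr_gt0.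
  rewrite rnormZ rnormC ger0_norm ?subr_ge0//; apply: le_trans eM.
  apply: ler_pM.
  - by rewrite subr_ge0.
  - exact: rnorm_ge0.
  - by rewrite lerBlDl.
  - exact: HM.
exists e => //; apply/UboundedP; split.
- by move=> y yA; apply: (key y y yA); rewrite subrr rnorm0.
- exists (2 * M) => y [x Ax [a ae ->]]; rewrite rnormZ.
  apply: ler_pM; rewrite ?rnorm_ge0 ?HM//.
  by rewrite (le_trans ae)//; lra.
- by exists t.
Qed.

Lemma domain_hull_ball U z : domain_hull U z -> exists2 A, Ubounded U A &
  exists2 d : R, 0 < d & forall x, rnorm (x - z) < d -> poly_hull A x.
Proof.
move=> /domain_hullP[A UA Az]; have [d d0 UAd] := Ubounded_thickening UA.
exists (thickening A d) => //; exists d => // x xz.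
by rewrite -[x](subrK z) addrC; exact: poly_hull_thickening.
Qed.

Lemma open_domain_hull U : open (domain_hull U).
Proof.
apply/open_rnormP => z /domain_hull_ball[A UA [d d0 Hd]]; exists d => // x /Hd Ax.
by apply/domain_hullP; exists A.
Qed.

Lemma Ubounded_set1 U z : open U -> U z -> Ubounded U [set z].
Proof.
move=> /open_rnormP oU Uz; have [r r0 Hr] := oU z Uz; apply/UboundedP; split.
- by move=> _ ->.
- by exists (rnorm z) => _ ->.
- by exists r => // _ y ->; exact: Hr.
Qed.

End Hulls.

(** * Extension to the hull *)

Section Extension.
Context {R : realType} {E : normedModType R[i]}.
Implicit Types (x y z h u : E) (A U : set E) (P f g G : E -> C R).

Lemma line_identity f g u h (T t : R) : 0 < t ->
  (forall z : C R, rnorm z < T -> differentiable f (u + z *: h)) ->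
  (forall z : C R, rnorm z < T -> differentiable g (u + z *: h)) ->
  (forall z : C R, rnorm z < t -> f (u + z *: h) = g (u + z *: h)) ->
  forall z : C R, rnorm z < T -> f (u + z *: h) = g (u + z *: h).
Proof.
move=> t0 df dg fg z zT.
have [|a af] := @taylor_series R (fun z : C R => f (u + z *: h)) T.
  by move=> w wT; exact: (diff_slice (df w wT)).1.
have [|b bg] := @taylor_series R (fun z : C R => g (u + z *: h)) T.
  by move=> w wT; exact: (diff_slice (dg w wT)).1.
have T0 : 0 < T by exact: le_lt_trans (rnorm_ge0 _) zT.
pose s := Num.min t T; have s0 : 0 < s by rewrite lt_min t0.
have sT : s <= T by rewrite ge_min lexx orbT.
have ab : a = b.
  apply: (psum_unique s0 (psum_le sT af)).
  apply: (psum_ext _ (psum_le sT bg)) => w ws; rewrite fg//.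
  by rewrite (lt_le_trans ws)// ge_min lexx.
by apply: (tends_unique (af z zT)); rewrite ab; exact: bg.
Qed.

Definition bounded_type U g : Prop := hol_on U g /\
  forall A, Ubounded U A -> exists M, forall x, A x -> rnorm (g x) <= M.

Section Balanced.
Variable U : set E.
Hypotheses (oU : open U) (balU : balanced U).

Lemma balanced0 x : U x -> U 0.
Proof. by move=> Ux; rewrite -(scale0r x); apply: balU; rewrite // normr0 ler01. Qed.

Lemma domain_hull_balanced0 z : domain_hull U z -> U 0.
Proof.
move=> /domain_hullP[A /UboundedP[AU _ _] /poly_hull_nonempty[x /AU]].
exact: balanced0.
Qed.

Lemma Ubounded_taylor_psum g A e x : bounded_type U g -> 0 < e ->
  Ubounded U (dilation A (1 + e)) -> A x ->
  psum (taylor_component g ^~ x) (fun z : C R => g (z *: x)) (1 + e).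
Proof.
move=> [gU _] e0 /UboundedP[AU _ _] Ax.
apply: (taylor_component_psum oU gU); first by rewrite addr_gt0.
by move=> z ze; apply: AU; exists x => //; exists z => //; exact: ltW.
Qed.

(** On [A] these are Cauchy's estimates on discs of radius 1 + e, with e from
    [Ubounded_dilation]; since the components are polynomials, the bounds pass to
    the hull. *)
Lemma taylor_component_geometric g A : bounded_type U g -> Ubounded U A ->
  exists K q : R, 0 <= q < 1 /\
    forall x k, poly_hull A x -> rnorm (taylor_component g k x) <= K * q ^+ k.
Proof.
move=> gU UA; have [[x0 Ax0]|nA] := pselect (exists x, A x); last first.
  exists 0, 0; split; first by rewrite lexx ltr01.
  by move=> x k /poly_hull_nonempty/nA.
have U0 : U 0 by case/UboundedP: UA => /(_ x0 Ax0)/balanced0.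
have [e e0 Ue] := Ubounded_dilation oU balU U0 UA.
have [M HM] := gU.2 _ Ue; exists M, (1 + e)^-1.
have e1 : 0 < 1 + e by rewrite addr_gt0.
split; first by rewrite invr_ge0 (ltW e1) invf_lt1// ltrDl.
move=> x k /poly_hullP Ax; apply: (Ax (taylor_component g k)).
  exact: taylor_component_continuous gU.1 U0.
move=> y Ay; have gy := Ubounded_taylor_psum gU e0 Ue Ay.
have := cauchy_estimate k e1 gy (M := M) _.
rewrite exprVn ler_pdivlMr ?exprn_gt0//; apply => z ze.
by apply: HM; exists y => //; exists z => //; exact: ltW.
Qed.

(** The Taylor series at 0 converges geometrically on the hull of each U-bounded
    set, hence uniformly on a ball around each point of the hull of [U]. *)
Theorem extension_to_hull g : bounded_type U g -> exists G,
  [/\ hol_on (domain_hull U) G, forall x, U x -> G x = g x &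
   forall A, Ubounded U A -> exists K q : R, 0 <= q < 1 /\ forall x m, poly_hull A x ->
     rnorm (G x - \sum_(k < m) taylor_component g k x) <= K * q ^+ m].
Proof.
move=> gU; pose S n x := \sum_(k < n) taylor_component g k x.
pose G x := xget 0 [set s | tends (S ^~ x) s].
have GA A : Ubounded U A -> exists K q : R, 0 <= q < 1 /\ forall x m, poly_hull A x ->
    rnorm (G x - S m x) <= K * q ^+ m.
  move=> UA; have [K [q [q01 HK]]] := taylor_component_geometric gU UA.
  exists (K / (1 - q)), q; split=> // x m Ax.
  have [s us Hs] := geometric_tends q01 (fun k => HK x k Ax).
  have -> : G x = s.
    by rewrite /G; case: xgetP => [y _ yS|/(_ s)//]; exact: tends_unique yS us.
  by rewrite (le_trans (Hs m))// mulrAC.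
have GS A x : Ubounded U A -> poly_hull A x -> tends (S ^~ x) (G x).
  move=> UA Ax e e0; have [K [q [q01 HK]]] := GA A UA.
  have [N HN] := expr_cvg0 K q01 e0; exists N => n Nn.
  by rewrite rdistC (le_trans (HK x n Ax))// HN.
exists G; split=> // [z Uz|x Ux].
  have [A UA [d d0 Hd]] := domain_hull_ball Uz.
  have U0 : U 0 by exact: domain_hull_balanced0 Uz.
  apply: (@uniform_limit_differentiable _ _ S G z d d0 _ _).1.
    exists 0%N => n _ x xz.
    have /continuous_polynomialP[_ //] : continuous_polynomial (S n).
    apply: continuous_polynomial_sum => k.
    exact: taylor_component_continuous gU.1 U0.
  move=> e e0; have [K [q [q01 HK]]] := GA A UA.
  have [N HN] := expr_cvg0 K q01 e0; exists N => n x Nn xz.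
  by rewrite rdistC (le_trans (HK x n (Hd x xz)))// HN.
have U1 : Ubounded U [set x] by exact: Ubounded_set1.
have [e e0 Ue] := Ubounded_dilation oU balU (balanced0 Ux) U1.
have gx := Ubounded_taylor_psum gU e0 Ue (erefl : [set x] x).
have /gx : rnorm (1 : C R) < 1 + e by rewrite rnorm1 ltrDl.
rewrite scale1r => Sg; have xx : poly_hull [set x] x by exact: sub_poly_hull.
apply: (tends_unique (GS _ _ U1 xx)).
apply: tends_ext Sg => n; rewrite /S; apply: eq_bigr => k _.
by rewrite expr1n mulr1.
Qed.

(** The hull is balanced, so a holomorphic function on it is determined on each
    complex line through 0 by its values near 0. *)
Lemma hull_identity f g : hol_on (domain_hull U) f -> hol_on (domain_hull U) g ->
  (forall x, U x -> f x = g x) -> forall x, domain_hull U x -> f x = g x.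
Proof.
move=> fU gU fg x Ux; have U0 := domain_hull_balanced0 Ux.
have /domain_hullP[A UA Ax] := Ux.
have [e e0 Ue] := Ubounded_dilation oU balU U0 UA.
have hz (z : C R) : rnorm z < 1 + e -> domain_hull U (0 + z *: x).
  move=> ze; apply/domain_hullP; exists (dilation A (1 + e)) => //.
  by rewrite add0r; apply: poly_hull_dilation => //; exact: ltW.
have [r r0 Hr] := (open_rnormP U).1 oU 0 U0.
have x1 : 0 < rnorm x + 1 by rewrite ltr_wpDl// rnorm_ge0.
have := @line_identity f g 0 x (1 + e) (r / (rnorm x + 1)) (divr_gt0 r0 x1).
move=> /(_ (fun (z : C R) ze => fU _ (hz z ze)) (fun (z : C R) ze => gU _ (hz z ze)))/(_ _ 1).
rewrite rnorm1 ltrDl add0r scale1r; apply=> // z.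
rewrite ltr_pdivlMr// => zr; apply: fg; apply: Hr; rewrite subr0 add0r rnormZ.
by apply: le_lt_trans zr; rewrite ler_wpM2l ?rnorm_ge0// lerDl.
Qed.

(** The partial sums of the Taylor series are polynomials, uniformly close to [G]
    on [A] and on the hull of [A]. *)
Lemma extension_ler g G A M z : bounded_type U g ->
  (forall x, U x -> G x = g x) ->
  (exists K q : R, 0 <= q < 1 /\ forall x m, poly_hull A x ->
     rnorm (G x - \sum_(k < m) taylor_component g k x) <= K * q ^+ m) ->
  Ubounded U A -> poly_hull A z -> (forall x, A x -> rnorm (g x) <= M) ->
  rnorm (G z) <= M.
Proof.
move=> gU Gg [K [q [q01 HK]]] UA Az HM.
have AU : A `<=` U by case/UboundedP: UA.
have U0 : U 0 by apply: (@domain_hull_balanced0 z); apply/domain_hullP; exists A.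
apply: ler_addgt0 => e e0; have e20 : 0 < e / 2 by rewrite divr_gt0.
have [N HN] := expr_cvg0 K q01 e20.
pose S x := \sum_(k < N) taylor_component g k x.
have cS : continuous_polynomial S.
  by apply: continuous_polynomial_sum => k; exact: taylor_component_continuous gU.1 U0.
have near x : poly_hull A x -> rnorm (G x - S x) <= e / 2.
  by move=> Ax; rewrite (le_trans (HK x N Ax))// HN.
have SA : rnorm (S z) <= M + e / 2.
  move/poly_hullP: Az; apply => // x Ax.
  have -> : S x = g x - (G x - S x) by rewrite -(Gg _ (AU _ Ax)) opprB addrCA subrr addr0.
  rewrite (le_trans (ler_rnormB _ _))// lerD ?HM// near//.
  exact: sub_poly_hull.
rewrite -[G z](subrK (S z)) (le_trans (ler_rnormD _ _))//.
rewrite (le_trans (lerD (near z Az) SA))//; lra.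
Qed.

End Balanced.
End Extension.

(** * Open subsets as Riemann domains *)

Section SubsetDomains.
Context {R : realType} {E : normedModType R[i]}.
Implicit Types (x y z : E) (A V : set E).

Lemma open_set_val V (W : set V) : open V -> open W -> open (set_val @` W).
Proof.
move=> oV [Q oQ <-]; rewrite (_ : _ @` _ = Q `&` V); first exact: openI.
apply/seteqP; split=> [_ [v Qv <-]|x [Qx Vx]]; first by split=> //; exact: set_valP.
by exists (SigSub (mem_set Vx)).
Qed.

Lemma chart_setT V : open V -> chart (set_val : V -> E) setT.
Proof.
move=> oV; split.
- exact: openT.
- by move=> v w _ _; exact: val_inj.
- by move=> v _; exact: initial_continuous.
- by move=> W oW _; exact: open_set_val.
Qed.

Lemma riemann_domain_set_val V : open V -> riemann_domain (set_val : V -> E).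
Proof.
move=> oV; split; last by move=> v; exists setT => //; exact: chart_setT.
move=> v w vw; apply: val_inj; apply: (@norm_hausdorff _ E) => A B vA wB.
have cv : continuous (set_val : V -> E) by exact: initial_continuous.
have [u [Au Bu]] := vw _ _ (cv v A vA) (cv w B wB).
by exists (set_val u).
Qed.

Lemma hol_on_holomorphic V (G : E -> C R) : hol_on V G ->
  holomorphic (set_val : V -> E) (fun v => G (set_val v)).
Proof. by move=> GV W _; exists G => // v _; apply: GV; exact: set_valP. Qed.

Lemma holomorphic_hol_on V (g : V -> C R) : open V ->
  holomorphic (set_val : V -> E) g ->
  exists2 G : E -> C R, hol_on V G & forall v, g v = G (set_val v).
Proof.
move=> oV /(_ _ (chart_setT oV))[G gG dG]; exists G; last by move=> v; exact: gG.
by move=> x Vx; have := dG (SigSub (mem_set Vx)) I.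
Qed.

Variables (U : set E).
Hypothesis oU : open U.

Lemma Hb_representative (f : Hb U) : exists2 g : E -> C R, bounded_type U g &
  forall u : U, f u = g (set_val u).
Proof.
case: f => f Hf; have /asboolP[hf bf] := Hf.
have [g gU fg] := holomorphic_hol_on oU hf; exists g => //; split=> // A UA.
have AU : A `<=` U by case: UA.
have sA : set_val @` (set_val @^-1` A : set U) = A.
  apply/seteqP; split=> [_ [u Au <-]//|x Ax].
  by exists (SigSub (mem_set (AU x Ax))).
have /bf/bounded_inP[M HM] : Ubounded_sub (set_val @^-1` A : set U).
  by rewrite /Ubounded_sub sA.
exists M => x Ax; have := HM (SigSub (mem_set (AU x Ax))) Ax.
by rewrite fg rnorm_le.
Qed.

Lemma Hb_restriction (g : E -> C R) : bounded_type U g ->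
  exists f : Hb U, forall u : U, f u = g (set_val u).
Proof.
move=> [gU bg].
have Hg : is_Hb (fun u : U => g (set_val u)).
  split; first exact: hol_on_holomorphic.
  move=> A UA; apply/bounded_inP; have [M HM] := bg _ UA; exists M => u Au.
  by rewrite rnorm_le; apply: HM; exists u.
have Hg' : (fun u : U => g (set_val u)) \in @Hb_pred R E U by apply/asboolP.
by exists (MkHb Hg').
Qed.

Lemma Hb_cvg (f : nat -> Hb U) (g : Hb U) :
  (forall A, Ubounded U A -> forall e : R, 0 < e -> exists N, forall n, (N <= n)%N ->
    forall u : U, A (set_val u) -> rnorm (f n u - g u) <= e) ->
  f n @[n --> \oo] --> g.
Proof.
move=> fg.
have FF : Filter ((fun n => Hb_val (f n) : {family @Ubounded_sub R E U, U -> C R}) @ \oo).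
  exact: fmap_filter.
have cvgF : (fun n => Hb_val (f n) : {family @Ubounded_sub R E U, U -> C R}) @ \oo -->
    (Hb_val g : {family @Ubounded_sub R E U, U -> C R}).
  apply/fam_cvgP => A UA B /uniform_nbhs[D [entD DB]].
  move: entD; rewrite -entourage_ballE => -[e /= e0 He].
  have e0' : 0 < complex.Re e by have := e0; rewrite -{1}(RRe_real (gtr0_real e0)) ltcR.
  have [N HN] := fg _ UA (complex.Re e / 2) (divr_gt0 e0' (ltr0n R 2)).
  exists N => // n /= Nn; apply: DB => u Au; apply: He => /=.
  rewrite -ball_normE /= -(RRe_real (gtr0_real e0)).
  rewrite (_ : (_ < _) = (rnorm (g u - f n u) < complex.Re e)); last exact: rnorm_lt.
  rewrite rdistC (le_lt_trans (HN n Nn u _))//; first by exists u.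
  by rewrite ltr_pdivrMr// ltr_pMr// ltr1n.
move=> B [W [[Q oQ <-] Qg QB]].
have /cvgF : nbhs (Hb_val g : {family @Ubounded_sub R E U, U -> C R}) Q.
  exact: open_nbhs_nbhs.
by move=> [N _ HN]; exists N => // n /HN Qn; exact: QB.
Qed.

Lemma Hb_linear_continuous (phi : Hb U -> C R) A : linear phi -> Ubounded U A ->
  (forall (f : Hb U) M, (forall u : U, A (set_val u) -> rnorm (f u) <= M) ->
     rnorm (phi f) <= M) ->
  continuous phi.
Proof.
move=> lphi UA bphi f B /nbhs_rnormP[e e0 He].
have UA' : Ubounded_sub (set_val @^-1` A : set U).
  rewrite /Ubounded_sub (_ : _ @` _ = A)//.
  have AU : A `<=` U by case: UA.
  apply/seteqP; split=> [_ [u Au <-]//|x Ax].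
  by exists (SigSub (mem_set (AU x Ax))).
have cval := @initial_continuous (Hb U) {family @Ubounded_sub R E U, U -> C R}
  (fun f : Hb U => Hb_val f) f.
pose N : set (U -> C R) := [set h | forall u, A (set_val u) -> rnorm (h u - f u) < e / 2].
have /cval : nbhs (Hb_val f : {family @Ubounded_sub R E U, U -> C R}) N.
  have FF : Filter (nbhs (Hb_val f : {family @Ubounded_sub R E U, U -> C R})).
    exact: nbhs_filter.
  have /(fam_cvgP _ _ FF)/(_ _ UA') : {family @Ubounded_sub R E U,
    nbhs (Hb_val f : {family @Ubounded_sub R E U, U -> C R}) --> Hb_val f} by [].
  apply; apply/uniform_nbhs.
  exists [set p : C R * C R | rnorm (p.2 - p.1) < e / 2]; split => //.
  rewrite -entourage_ballE; exists (toC (e / 2)) => /=; first by rewrite ltcR divr_gt0.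
  move=> [p q] /=; rewrite -ball_normE /= (_ : (_ < _) = (rnorm (p - q) < e / 2)).
    by rewrite rdistC.
  exact: rnorm_lt.
move=> fN; apply: (@filterS (Hb U) (nbhs f) _ _ _ _ fN) => h Nh; apply: He.
have -> : phi h - phi f = phi (h - f).
  have := lphi (-1) f h; rewrite scaleN1r => E1.
  by rewrite [h - f]addrC E1 scaleN1r addrC.
apply: (@le_lt_trans _ _ (e / 2)); last by rewrite ltr_pdivrMr// ltr_pMr// ltr1n.
by apply: bphi => u Au; apply: ltW; exact: Nh.
Qed.

End SubsetDomains.

(** * Evaluations at points of the hull *)

Section Evaluations.
Context {R : realType} {E : normedModType R[i]} (U : set E).
Hypotheses (oU : open U) (balU : balanced U).
Implicit Types (x y z : E) (A : set E) (f h : Hb U).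

Lemma polynomial_bounded_type (P : E -> C R) : continuous_polynomial P ->
  bounded_type U P.
Proof.
move=> cP; have /continuous_polynomialP[_ dP] := cP; split; first by move=> x _; exact: dP.
move=> A /UboundedP[_ [M HM] _]; have [B HB] := continuous_polynomial_bounded M cP.
by exists B => x /HM/HB.
Qed.

Definition hull_extension f (G : E -> C R) : Prop :=
  hol_on (domain_hull U) G /\ forall u : U, G (set_val u) = f u.

Lemma hull_extension_unique f G G' : hull_extension f G -> hull_extension f G' ->
  forall z, domain_hull U z -> G z = G' z.
Proof.
move=> [hG Gf] [hG' G'f]; apply: (hull_identity oU balU hG hG') => x Ux.
by have := Gf (SigSub (mem_set Ux)); rewrite -G'f.
Qed.

Lemma hull_extension_exists f : exists G, [/\ hull_extension f G,
  forall A z M, Ubounded U A -> poly_hull A z ->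
    (forall u : U, A (set_val u) -> rnorm (f u) <= M) -> rnorm (G z) <= M,
  forall A, Ubounded U A -> exists M, forall z, poly_hull A z -> rnorm (G z) <= M &
  exists S : nat -> E -> C R, (forall n, continuous_polynomial (S n)) /\
    forall A e, Ubounded U A -> 0 < e -> exists N, forall n z, (N <= n)%N ->
      poly_hull A z -> rnorm (S n z - G z) <= e].
Proof.
have [g gU fg] := Hb_representative oU f.
have [G [hG Gg GA]] := extension_to_hull oU balU gU.
have bG A z M : Ubounded U A -> poly_hull A z ->
    (forall u : U, A (set_val u) -> rnorm (f u) <= M) -> rnorm (G z) <= M.
  move=> UA Az fM; apply: (extension_ler oU balU gU Gg (GA A UA) UA Az) => x Ax.
  have AU : A `<=` U by case: UA.
  have := fM (SigSub (mem_set (AU x Ax))) Ax.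
  by rewrite fg.
exists G; split=> //.
- by split=> // u; rewrite Gg ?fg//; exact: set_valP.
- move=> A UA; have [M HM] := gU.2 A UA; exists M => z Az.
  apply: (bG A z M UA Az) => u Au; rewrite fg; exact: HM.
have [U0|nU0] := pselect (U 0); last first.
  exists (fun _ _ => 0); split; first by move=> n; exact: continuous_polynomial_cst.
  move=> A e UA _; exists 0%N => n z _ Az; exfalso; apply: nU0.
  by apply: (domain_hull_balanced0 balU (z := z)); apply/domain_hullP; exists A.
exists (fun n x => \sum_(k < n) taylor_component g k x); split.
  move=> n; apply: continuous_polynomial_sum => k.
  exact: taylor_component_continuous gU.1 U0.
move=> A e UA e0; have [K [q [q01 HK]]] := GA A UA.
have [N HN] := expr_cvg0 K q01 e0; exists N => n z Nn Az.
by rewrite rdistC (le_trans (HK z n Az))// HN.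
Qed.

(** The functional is the evaluation at [z] of the extension to the hull, linear
    and multiplicative because extensions are unique, and continuous because it
    is dominated by [A]. *)
Theorem unique_delta A z : Ubounded U A -> poly_hull A z ->
  exists delta : Hb U -> C R, unique (is_delta z) delta /\ prec delta A.
Proof.
move=> UA Az.
have Uz : domain_hull U z by apply/domain_hullP; exists A.
have [ext Hext] := choice hull_extension_exists.
have extE f G : hull_extension f G -> ext f z = G z.
  by move=> fG; have [fe _ _ _] := Hext f; exact: hull_extension_unique fe fG z Uz.
pose delta f : C R := ext f z.
have bd f M : (forall u : U, A (set_val u) -> rnorm (f u) <= M) -> rnorm (delta f) <= M.
  by have [_ H _ _] := Hext f; exact: H.
have ld : linear delta.
  move=> a f h; have [[hf fe] _ _ _] := Hext f; have [[hh he] _ _ _] := Hext h.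
  apply: (extE _ (fun x => a * ext f x + ext h x)); split; first exact: hol_onZD.
  by move=> u; rewrite fe he.
have md : {morph delta : f g / f * g}.
  move=> f h; have [[hf fe] _ _ _] := Hext f; have [[hh he] _ _ _] := Hext h.
  apply: (extE _ (fun x => ext f x * ext h x)); split; last by move=> u; rewrite fe he.
  by move=> x Ux; apply: (@differentiableM _ _ (ext f) (ext h)); [exact: hf|exact: hh].
have cd : continuous delta by exact: (Hb_linear_continuous ld UA bd).
have ed : evaluates_polynomials_at z delta.
  move=> P f cP fP; apply: extE; split; last by move=> u; rewrite fP.
  by move=> x _; have /continuous_polynomialP[_] := cP; exact.
exists delta; split; last first.
  move=> f; set S := esupnorm _ _.
  have ub u : A (set_val u) -> ((rnorm (f u))%:E <= S)%E.
    by move=> Au; apply: ereal_sup_ubound; exists u.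
  case: S ub => [r| |] ub; last 2 first.
  - by rewrite leey.
  - have : rnorm (delta f) <= -1 by apply: bd => u /ub.
    by move=> /(le_trans (rnorm_ge0 _)); rewrite lerNr oppr0 leNgt ltr01.
  - by rewrite lee_fin; apply: bd => u /ub.
have [one H1] := Hb_restriction (polynomial_bounded_type (continuous_polynomial_cst 1)).
split.
  split=> //; split=> //; exists one.
  by rewrite (ed _ _ (continuous_polynomial_cst 1) H1) oner_eq0.
(* Polynomials are dense, so a continuous evaluation is determined by them. *)
move=> delta' [[_ _ _ cd'] ed']; apply/funext => f.
have [[hf fe] _ _ [S [cS HS]]] := Hext f.
have [s Hs] := choice (fun n => Hb_restriction (polynomial_bounded_type (cS n))).
have sf : s n @[n --> \oo] --> f.
  apply: Hb_cvg => B UB e e0; have [N HN] := HS B e UB e0; exists N => n Nn u Bu.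
  by rewrite Hs -fe; apply: HN => //; exact: sub_poly_hull.
apply: (tends_unique (u := fun n => S n z)).
  by move=> e e0; have [N HN] := HS A e UA e0; exists N => n Nn; exact: HN.
move=> e e0.
have : nbhs (delta' f) [set w : C R | rnorm (w - delta' f) < e].
  by apply/nbhs_rnormP; exists e.
move=> /cd' /sf [N _ HN]; exists N => n /HN /= Hn.
by rewrite -(ed' (S n) (s n) (cS n) (Hs n)) ltW.
Qed.

Theorem bounded_extension_to_hull f : exists g : domain_hull U -> C R,
  [/\ holomorphic (set_val : domain_hull U -> E) g, g \o hull_inclusion oU = f &
   forall A, Ubounded U A -> [bounded g x | x in set_val @^-1` poly_hull A]].
Proof.
have [G [[hG Gf] _ bG _]] := hull_extension_exists f.
exists (fun v => G (set_val v)); split.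
- exact: hol_on_holomorphic.
- by apply/funext => u; rewrite /= Gf.
- move=> A UA; apply/bounded_inP; have [M HM] := bG A UA; exists M => v Av.
  by rewrite rnorm_le; exact: HM.
Qed.

Theorem hull_Hb_extension :
  Hb_extension (set_val : domain_hull U -> E) (hull_inclusion oU).
Proof.
have oH := @open_domain_hull R E U.
split; first exact: riemann_domain_set_val.
  split; last by apply/funext => u.
  move=> u B [W [[Q oQ <-] Qu QB]].
  have : nbhs (set_val u : E) Q by exact: open_nbhs_nbhs.
  move=> /(@initial_continuous _ _ (set_val : U -> E) u).
  by move=> uQ; apply: (@filterS U (nbhs u) _ _ _ _ uQ) => v Qv; exact: QB.
move=> f; have [G [[hG Gf] _ _ _]] := hull_extension_exists f.
exists (fun v => G (set_val v)); split.
  by split; [exact: hol_on_holomorphic|apply/funext => u; rewrite /= Gf].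
move=> g' [hg' g'f]; have [G' hG' g'G'] := holomorphic_hol_on oH hg'.
apply/funext => v; rewrite g'G'; apply: (@hull_extension_unique f) => //.
  by split=> // u; rewrite -g'f /= g'G'.
exact: set_valP.
Qed.

End Evaluations.

(** * Functions that do not continue beyond the hull *)

Section GlidingHump.
Context {R : realType} {E : normedModType R[i]} (U : set E).
Implicit Types (x y z : E) (A : set E) (P T F g : E -> C R).

Lemma exhaustion_mono m n : (m <= n)%N -> exhaustion U m `<=` exhaustion U n.
Proof.
move=> mn x [Ux dx nx]; split=> //.
- move=> y Uy; apply: le_trans (dx y Uy).
  by rewrite lef_pV2 ?posrE ?ltr0n// ler_nat ltnS.
- by rewrite (le_trans nx)// ler_nat ltnS.
Qed.

Lemma not_poly_hull A y : ~ poly_hull A y -> exists P m, [/\ continuous_polynomial P,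
  0 <= m < rnorm (P y) & forall x, A x -> rnorm (P x) <= m].
Proof.
move=> nAy; have [P [M [cP [HM PM]]]] : exists P M, continuous_polynomial P /\
    (forall x, A x -> rnorm (P x) <= M) /\ M < rnorm (P y).
  apply: contrapT => H; apply: nAy; apply/poly_hullP => P M cP HM.
  by rewrite leNgt; apply/negP => PM; apply: H; exists P, M.
have [M0|M0] := leP 0 M; first by exists P, M; rewrite M0.
exists (fun=> 1), 0; split; first exact: continuous_polynomial_cst.
  by rewrite lexx rnorm1 ltr01.
by move=> x /HM/(le_trans (rnorm_ge0 _)); rewrite leNgt M0.
Qed.

(** Powers of a polynomial that is larger at [y] than on [A] are as large as
    desired at [y] and as small as desired on [A]. *)
Lemma peaking_polynomial A y (B e : R) : ~ poly_hull A y -> 0 <= B -> 0 < e ->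
  exists P, [/\ continuous_polynomial P, rnorm (P y) = B &
    forall x, A x -> rnorm (P x) <= e].
Proof.
move=> /not_poly_hull[P [m [cP /andP[m0 mP] HP]]] B0 e0.
set p := rnorm (P y) in mP; have p0 : 0 < p by exact: le_lt_trans mP.
have q01 : 0 <= m / p < 1 by rewrite divr_ge0 ?(ltW p0)//= ltr_pdivrMr// mul1r.
have [N HN] := expr_cvg0 B q01 e0.
have pN : 0 < p ^+ N by rewrite exprn_gt0.
have nB : rnorm (toC (B / p ^+ N)) = B / p ^+ N.
  by rewrite rnormC ger0_norm// divr_ge0// ltW.
exists (fun x => toC (B / p ^+ N) * P x ^+ N); split.
- apply: (@continuous_polynomialM _ _ (fun=> _) (fun x => P x ^+ N)).
    exact: continuous_polynomial_cst.
  exact: continuous_polynomialX.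
- by rewrite rnormM rnormX nB divfK// gt_eqF.
- move=> x /HP Px; rewrite rnormM rnormX nB; apply: le_trans (HN N (leqnn _)).
  rewrite expr_div_n mulrAC mulrA ler_wpM2r ?invr_ge0 ?(ltW pN)// ler_wpM2l//.
  by rewrite !lerXn2r ?nnegrE ?rnorm_ge0.
Qed.

(** [J] is a strict bound on the degree rather than the degree itself. *)
Definition line_degree z h T (J : nat) : Prop := exists c : nat -> C R,
  forall w : C R, T (z + w *: h) = \sum_(k < J) c k * w ^+ k.

Lemma line_degree_exists z h T J : continuous_polynomial T ->
  exists2 J', (J <= J')%N & line_degree z h T J'.
Proof.
move=> [pT _]; have [m [Q [hQ [TQ _]]]] := polynomial_line_psum z pT.
exists (maxn J m); first exact: leq_maxl.
exists (fun k => if (k < m)%N then Q k h else 0) => w.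
rewrite TQ (big_ord_widen (maxn J m) (fun k => Q k (w *: h)) (leq_maxr _ _)) big_mkcond.
apply: eq_bigr => k _; case: ifP => _; last by rewrite mul0r.
by rewrite (homogeneousZ _ _ (hQ k)) mulrC.
Qed.

(** For a point [y] of the ball outside the hull, a gliding hump gives
    polynomials [T n] that converge on the hull while [T n y] is unbounded. The
    Taylor sums, on the line through [z] and [y], of the continuation of the
    limit are then unbounded at [y]: taken up to the degree of [T n], they differ
    from [T n y] by at most 2. *)
Theorem continuation_ball_in_hull z (sigma : R) : domain_hull U z ->
  (forall F, hol_on (domain_hull U) F ->
    (forall A, Ubounded U A -> exists M, forall x, A x -> rnorm (F x) <= M) ->
    exists2 g, hol_ball g z sigma & exists2 t : R, 0 < t &
      forall x, rnorm (x - z) < t -> g x = F x) ->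
  forall y, rnorm (y - z) < sigma -> domain_hull U y.
Proof.
move=> Uz cont y yz; apply: contrapT => nUy.
have X_hull n x : poly_hull (exhaustion U n) x -> domain_hull U x by exists n.
have nXy n : ~ poly_hull (exhaustion U n) y by move=> /X_hull.
have hull_X A : Ubounded U A -> exists m, A `<=` exhaustion U m.
  by move=> UA; have [_ /(_ A UA)] := exhaustion_fundamental U.
have [A0 UA0 [d d0 Hd]] := domain_hull_ball Uz.
have [n0 A0X] := hull_X A0 UA0.
have Hd' x : rnorm (x - z) < d -> poly_hull (exhaustion U n0) x.
  by move=> /Hd; exact: poly_hullS.
set h := y - z in yz.
have h0 : 0 < rnorm h.
  by apply: rnorm_gt0; apply/eqP => h0; apply: nUy; rewrite -[y](subrK z) -/h h0 add0r.
pose t := d / (rnorm h + 1).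
have h1 : 0 < rnorm h + 1 by rewrite ltr_wpDl// ltW.
have t0 : 0 < t by rewrite divr_gt0.
pose K (J : nat) : R := \sum_(k < J) t^-1 ^+ k.
have t1 k : 0 <= t^-1 ^+ k by rewrite exprn_ge0// invr_ge0 ltW.
have K0 J : 0 <= K J by apply: sumr_ge0.
have Kmono i j : (i <= j)%N -> K i <= K j.
  move=> ij; rewrite /K (big_ord_widen j (fun k => t^-1 ^+ k) ij) big_mkcond.
  by apply: ler_sum => k _; case: ifP.
(* By Cauchy's estimates, a perturbation by eps n J on the disc of radius t
   changes the sum of the first J Taylor coefficients by at most 2^-n. *)
pose eps (n J : nat) : R := 2^-1 ^+ n / (K J + 1).
have K1 J : 0 < K J + 1 by rewrite ltr_wpDl.
have half0 n : 0 < 2^-1 ^+ n :> R by rewrite exprn_gt0// invr_gt0.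
have eps0 n J : 0 < eps n J by rewrite divr_gt0.
have step (a : nat * ((E -> C R) * nat)) : exists b : (E -> C R) * nat,
    continuous_polynomial a.2.1 -> [/\ continuous_polynomial b.1,
      line_degree z h b.1 b.2, (a.2.2 <= b.2)%N, a.1%:R <= rnorm (b.1 y) &
      forall x, exhaustion U a.1 x -> rnorm (b.1 x - a.2.1 x) <= eps a.1 a.2.2].
  case: a => n [T J] /=; have [cT|ncT] := pselect (continuous_polynomial T); last first.
    by exists (T, J) => /ncT.
  have [P [cP Py HP]] := peaking_polynomial (nXy n)
    (addr_ge0 (ler0n R n) (rnorm_ge0 (T y))) (eps0 n J).
  have cTP : continuous_polynomial (fun x => T x + P x) by exact: continuous_polynomialD.
  have [J' JJ' dJ'] := line_degree_exists z h J cTP.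
  exists (fun x => T x + P x, J') => _; split=> //=.
  - have := ler_rnormB (T y + P y) (T y); rewrite addrAC subrr add0r Py.
    by rewrite lerD2r.
  - by move=> x Xx; rewrite addrAC subrr add0r HP.
have [next Hnext] := choice step.
pose st := fix st n := if n is n'.+1 then next (n', st n') else (fun _ : E => 0 : C R, 0%N).
pose T n := (st n).1; pose J n := (st n).2.
have cT n : continuous_polynomial (T n).
  elim: n => [|n IH]; first exact: continuous_polynomial_cst.
  by have [] := Hnext (n, st n) IH.
have HT n := Hnext (n, st n) (cT n).
have Jmono n k : (n <= k)%N -> (J n <= J k)%N.
  move=> /subnK <-; elim: (k - n)%N => // i IH; apply: leq_trans IH _.
  by have [] := HT (i + n)%N.
have Tstep m n x : (m <= n)%N -> poly_hull (exhaustion U m) x ->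
    rnorm (T n.+1 x - T n x) <= eps n (J n).
  move=> mn /(poly_hullS (exhaustion_mono mn))/poly_hullP.
  move=> /(_ (fun x => T n.+1 x + -1 * T n x) (eps n (J n))).
  rewrite mulN1r; apply.
    apply: continuous_polynomialD; first exact: cT.
    apply: (@continuous_polynomialM _ _ (fun=> -1) (T n)); last exact: cT.
    exact: continuous_polynomial_cst.
  by move=> w Xw; rewrite mulN1r; have [_ _ _ _] := HT n; exact.
have Tclose m n k x : (m <= n)%N -> (n <= k)%N -> poly_hull (exhaustion U m) x ->
    rnorm (T k x - T n x) <= 2 * eps n (J n).
  move=> mn nk mx; suff : rnorm (T k x - T n x) <=
      (2 * 2^-1 ^+ n - 2 * 2^-1 ^+ k) / (K (J n) + 1).
    move=> /le_trans; apply; rewrite /eps mulrA ler_wpM2r ?invr_ge0 ?(ltW (K1 _))//.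
    by rewrite gerBl mulr_ge0 ?(ltW (half0 _)).
  rewrite -(subnK nk); elim: (k - n)%N => [|i IH].
    by rewrite add0n !subrr rnorm0 mul0r.
  have nin : (n <= i + n)%N by rewrite leq_addl.
  rewrite addSn (le_trans (ler_rdistD (T (i + n)%N x) _ _))// addrC.
  apply: le_trans (lerD IH (Tstep m (i + n)%N x (leq_trans mn nin) mx)) _.
  have le1 : eps (i + n)%N (J (i + n)%N) <= 2^-1 ^+ (i + n) / (K (J n) + 1).
    rewrite ler_wpM2l ?(ltW (half0 _))// lef_pV2 ?posrE// lerD2r.
    by apply: Kmono; exact: Jmono.
  apply: le_trans (lerD (lexx _) le1) _; rewrite -mulrDl.
  rewrite ler_wpM2r ?invr_ge0 ?(ltW (K1 _))// exprS.
  have -> : 2 * (2^-1 * 2^-1 ^+ (i + n)) = 2^-1 ^+ (i + n) :> R by rewrite mulrA mulfV ?mul1r.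
  lra.
have eps_le n k : (n <= k)%N -> eps k (J k) <= 2^-1 ^+ k.
  by move=> _; rewrite ler_pdivrMr// ler_peMr ?(ltW (half0 _))// lerDr.
have half01 : 0 <= (2^-1 : R) < 1 by rewrite invr_ge0 ler0n invf_lt1 ?ltr1n.
have small e : 0 < e -> exists N, forall n, (N <= n)%N -> 2 * eps n (J n) <= e.
  move=> e0; have [N HN] := expr_cvg0 2 half01 e0; exists N => n Nn.
  by apply: le_trans (HN n Nn); rewrite ler_wpM2l// (eps_le n n).
pose F x := xget 0 [set s | tends (T ^~ x) s].
have TF m x : poly_hull (exhaustion U m) x -> tends (T ^~ x) (F x).
  move=> mx; rewrite /F; case: xgetP => [//|none]; exfalso.
  have [|s /none//] := @tends_cauchy R (T ^~ x).
  move=> e e0; have [N HN] := small e e0; exists (maxn m N) => n Nn.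
  apply: le_trans (Tclose m _ _ x (leq_maxl _ _) Nn mx) _.
  by apply: HN; exact: leq_maxr.
have FT m n x : (m <= n)%N -> poly_hull (exhaustion U m) x ->
    rnorm (F x - T n x) <= 2 * eps n (J n).
  move=> mn mx; apply: (tends_le (TF m x mx) (N := n)) => k nk.
  exact: Tclose mx.
have dT n x : differentiable (T n) x by have /continuous_polynomialP[_] := cT n; exact.
have hF : hol_on (domain_hull U) F.
  move=> x /domain_hull_ball[A UA [r r0 Hr]]; have [m AX] := hull_X A UA.
  apply: (@uniform_limit_differentiable _ _ T F x r r0 _ _).1.
    by exists 0%N => n _ w _; exact: dT.
  move=> e e0; have [N HN] := small e e0; exists (maxn m N) => n w.
  rewrite geq_max => /andP[mn Nn] /Hr/(poly_hullS AX) mw.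
  by rewrite rdistC (le_trans (FT m n w mn mw))// HN.
have bF A : Ubounded U A -> exists M, forall x, A x -> rnorm (F x) <= M.
  move=> UA; have [m AX] := hull_X A UA.
  have /UboundedP[_ [r Hr] _] := UA.
  have [B HB] := continuous_polynomial_bounded r (cT m).
  exists (2 * eps m (J m) + B) => x Ax; rewrite -[F x](subrK (T m x)).
  rewrite (le_trans (ler_rnormD _ _))// lerD ?HB ?Hr//.
  by apply: (FT m m x (leqnn _)); apply: sub_poly_hull; exact: AX.
have [g gz [t' t'0 gF]] := cont F hF bF.
(* On the line through z and y, the continuation g and the limit F have the same
   Taylor coefficients, and those of g are summable at y. *)
pose rho := sigma / rnorm h.
have sigma0 : 0 < sigma by exact: lt_trans yz.
have rho1 : 1 < rho by rewrite ltr_pdivlMr// mul1r.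
have rho0 : 0 < rho by exact: lt_trans rho1.
have [|a ag _] := @hol_ball_slice _ _ g z h sigma rho sigma0 gz rho0.
  by rewrite /rho divfK// gt_eqF.
have Fz : hol_ball F z d by move=> x /Hd' xn; apply: hF; exact: X_hull xn.
have th : t * rnorm h <= d.
  by rewrite /t mulrAC ler_pdivrMr// ler_wpM2l ?(ltW d0)// lerDl.
have [b bFs _] := @hol_ball_slice _ _ F z h d t d0 Fz t0 th.
have ab : a = b.
  pose s := Num.min (Num.min rho t) (t' / rnorm h).
  have th0 : 0 < t' / rnorm h by exact: divr_gt0.
  have s0 : 0 < s by rewrite !lt_min rho0 t0 th0.
  have sr : s <= rho by rewrite !ge_min lexx.
  have st0 : s <= t by rewrite !ge_min lexx orbT.
  apply: (psum_unique s0 (psum_le sr ag)).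
  apply: (psum_ext _ (psum_le st0 bFs)) => w ws; rewrite gF//.
  rewrite addrAC subrr add0r rnormZ -ltr_pdivlMr//.
  by rewrite (lt_le_trans ws)// ge_min lexx orbT.
have [|B HB] := tends_bounded (ag 1 _); first by rewrite rnorm1.
have bound n : (n0 <= n)%N -> n%:R <= B + 2.
  move=> n0n; have [_ [c Hc] _ Ty _] := HT n.
  have n0n' : (n0 <= n.+1)%N by exact: leqW.
  rewrite -/(T n.+1) -/(J n.+1) in Hc Ty.
  set N := J n.+1 in Hc.
  have cT' : psum (fun k => if (k < N)%N then c k else 0)
      (fun w => T n.+1 (z + w *: h)) t.
    by apply: (psum_ext _ (@psum_polynomial R c N t)) => w _; rewrite Hc.
  have coef k : (k < N)%N -> rnorm (a k - c k) <= 2 * eps n.+1 N * t^-1 ^+ k.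
    move=> kN; have := cauchy_estimate k t0 (psumB bFs cT') (M := 2 * eps n.+1 N).
    rewrite -ab kN exprVn ler_pdivlMr ?exprn_gt0//; apply => w wt.
    apply: (FT n0 n.+1 _ n0n'); apply: Hd'; rewrite addrAC subrr add0r rnormZ.
    apply: (@lt_le_trans _ _ (t * rnorm h)) => //.
    by rewrite ltr_pM2r.
  have yE : T n.+1 y = \sum_(k < N) c k.
    have := Hc 1; rewrite scale1r /h addrC subrK => ->.
    by apply: eq_bigr => k _; rewrite expr1n mulr1.
  have diffle : rnorm (\sum_(k < N) a k * 1 ^+ k - T n.+1 y) <= 2.
    rewrite yE -sumrB (le_trans (ler_rnorm_sum _ _ _))//.
    apply: (@le_trans _ _ (\sum_(k < N) 2 * eps n.+1 N * t^-1 ^+ k)).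
      by apply: ler_sum => k _; rewrite expr1n mulr1; exact: coef.
    rewrite -mulr_sumr -/(K N) -mulrA ler_piMr// /eps mulrAC ler_pdivrMr// mul1r.
    apply: (@le_trans _ _ (K N)); last by rewrite lerDl.
    by rewrite ler_piMl// exprn_ile1// ?invr_ge0// invf_le1// ler1n.
  rewrite (le_trans Ty)// -[T n.+1 y](subrK (\sum_(k < N) a k * 1 ^+ k)).
  by rewrite (le_trans (ler_rnormD _ _))// addrC lerD ?HB// rdistC.
have := bound (maxn n0 (Num.bound `|B + 2|)) (leq_maxl _ _).
apply/negP; rewrite -ltNge (le_lt_trans (ler_norm _))//.
rewrite (lt_le_trans (archi_boundP _))// ?normr_ge0//.
by rewrite ler_nat leq_maxr.
Qed.

End GlidingHump.

(** * Charts of Riemann domains *)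

Section Charts.
Context {R : realType} {E : normedModType R[i]}.
Variables (Z : topologicalType) (r : Z -> E).
Implicit Types (w : Z) (V N : set Z).

Lemma chart_preimage_ball V w (d : R) : chart r V -> V w -> 0 < d ->
  nbhs w [set w' | V w' /\ rnorm (r w' - r w) < d].
Proof.
move=> [oV _ cV _] Vw d0; apply: filterI; first exact: open_nbhs_nbhs.
apply: (cV w (mem_set Vw) [set x | rnorm (x - r w) < d]).
by apply/nbhs_rnormP; exists d.
Qed.

Lemma chart_image_ball V N w : chart r V -> V w -> nbhs w N ->
  exists2 d : R, 0 < d & forall x, rnorm (x - r w) < d ->
    exists w', [/\ V w', N w' & r w' = x].
Proof.
move=> [oV _ _ opV] Vw wN.
have : nbhs w (N `&` V) by apply: filterI => //; exact: open_nbhs_nbhs.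
rewrite nbhsE => -[W [oW Ww] WN].
have oI : open (r @` W) by apply: opV => // w' /WN[].
have [d d0 Hd] := (open_rnormP _).1 oI (r w) (ex_intro2 _ _ w Ww erefl).
by exists d => // x /Hd[w' /WN[Nw' Vw'] <-]; exists w'.
Qed.

Lemma ball_identity (f g : E -> C R) (u : E) (rho t : R) : 0 < t ->
  hol_ball f u rho -> hol_ball g u rho ->
  (forall x, rnorm (x - u) < t -> f x = g x) ->
  forall x, rnorm (x - u) < rho -> f x = g x.
Proof.
move=> t0 fu gu fg x xu; have [->|xneu] := eqVneq x u.
  by apply: fg; rewrite subrr rnorm0.
have h0 : 0 < rnorm (x - u) by rewrite rnorm_gt0// subr_eq0.
have line (z : C R) s : rnorm z < s / rnorm (x - u) ->
    rnorm (u + z *: (x - u) - u) < s.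
  by rewrite addrAC subrr add0r rnormZ ltr_pdivlMr.
have := @line_identity _ _ f g u (x - u) (rho / rnorm (x - u)) (t / rnorm (x - u)).
move=> /(_ _ _ _ _ 1); rewrite scale1r [u + _]addrC subrK; apply.
- exact: divr_gt0.
- by move=> z /line; exact: fu.
- by move=> z /line; exact: gu.
- by move=> z /line; exact: fg.
- by rewrite rnorm1 ltr_pdivlMr// mul1r.
Qed.

End Charts.

(** * The envelope of holomorphy *)

Section Envelope.
Context {R : realType} {E : normedModType R[i]} (U : set E).
Hypotheses (oU : open U) (balU : balanced U).
Variables (Z : topologicalType) (r : Z -> E) (n : U -> Z).
Hypothesis extZ : Hb_extension r n.
Implicit Types (w : Z) (f : Hb U) (G : E -> C R) (g : Z -> C R).

Definition agreement_set : set Z := [set w | domain_hull U (r w) /\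
  exists2 N, nbhs w N & forall f G g, hull_extension f G -> holomorphic r g ->
    g \o n = f -> forall w', N w' -> g w' = G (r w')].

Let chartZ w : exists2 V, V w & chart r V.
Proof. by case: extZ => -[_ + _ _]; exact. Qed.

Let rn u : r (n u) = set_val u.
Proof. by case: extZ => _ [_ <-] _. Qed.

Let continuous_r w : {for w, continuous r}.
Proof. by have [V Vw [_ _ cV _]] := chartZ w; apply: cV; exact: mem_set. Qed.

Lemma agreement_set_image u : agreement_set (n u).
Proof.
have Uu : U (set_val u) by exact: set_valP.
split; first by rewrite rn; apply: sub_domain_hull.
have [V Vw cV] := chartZ (n u).
have cn : continuous n by case: extZ => _ [].
have [oV iV _ _] := cV.
have : nbhs u (n @^-1` V) by apply: cn; exact: open_nbhs_nbhs.
move=> [W [[Q oQ <-] Qu QV]].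
have oQU : open (Q `&` U) by exact: openI.
have QUu : (Q `&` U) (set_val u) by split.
have [d d0 Hd] := (open_rnormP _).1 oQU _ QUu.
exists [set w' | V w' /\ rnorm (r w' - r (n u)) < d]; first exact: chart_preimage_ball.
move=> f G g [_ Gf] _ gn w' [Vw']; rewrite rn => /Hd[Qw Uw].
pose v : U := SigSub (mem_set Uw).
have <- : n v = w'.
  apply: iV; [apply: mem_set|exact: mem_set|by rewrite rn].
  exact: (QV v).
by rewrite rn Gf -gn.
Qed.

Lemma agreement_set_open w : agreement_set w -> nbhs w agreement_set.
Proof.
move=> [hw [N wN HN]].
have : nbhs w (N^° `&` r @^-1` domain_hull U).
  apply: filterI; first exact: nbhs_interior.
  by apply: continuous_r; apply: open_nbhs_nbhs; split => //; exact: open_domain_hull.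
apply: (@filterS Z (nbhs w)) => w' [Nw' hw']; split=> //.
by exists N.
Qed.

(** From a point [w'] of the agreement set near [w], all functions on the hull
    that extend to [Z] continue to a ball that contains the image of [w]; by
    [continuation_ball_in_hull] this ball lies in the hull. *)
Lemma agreement_set_closed w :
  (forall B, nbhs w B -> exists2 w', B w' & agreement_set w') -> agreement_set w.
Proof.
move=> clw; have [V Vw cV] := chartZ w; have [oV iV _ opV] := cV.
have [rho rho0 Hrho] := chart_image_ball cV Vw (@filterT Z (nbhs w) _).
have rho4 : 0 < rho / 4 by rewrite divr_gt0.
have [w' [Vw' ww'] [hw' [N wN HN]]] := clw _ (chart_preimage_ball cV Vw rho4).
pose s := rho / 2; have s0 : 0 < s by rewrite divr_gt0.
have ballV x : rnorm (x - r w') < s -> exists2 v, V v & r v = x.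
  move=> xw'; have [|v [Vv _ <-]] := Hrho x; last by exists v.
  have := ler_rdistD (r w') x (r w); rewrite /s in xw'; lra.
(* A function on Z read in the chart, and its agreement near w'. *)
have local f G g : hull_extension f G -> holomorphic r g -> g \o n = f ->
    exists g0 : E -> C R, [/\ forall v, V v -> g v = g0 (r v), hol_ball g0 (r w') s &
      exists2 t : R, 0 < t & forall x, rnorm (x - r w') < t -> g0 x = G x].
  move=> fG hg gn; have [g0 gg0 dg0] := hg V cV; exists g0; split=> //.
    by move=> x /ballV[v Vv <-]; exact: dg0.
  have [t t0 Ht] := chart_image_ball cV Vw' wN.
  exists t => // x /Ht[v [Vv Nv <-]].
  by rewrite -gg0//; exact: HN fG hg gn v Nv.
have ball_hull : forall x, rnorm (x - r w') < s -> domain_hull U x.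
  apply: (continuation_ball_in_hull hw') => F hF bF.
  have FU : bounded_type U F.
    split=> // x Ux; apply: hF; exact: sub_domain_hull.
  have [f fF] := Hb_restriction FU.
  have fFh : hull_extension f F by split=> // u; rewrite fF.
  have [_ _ /(_ f)[g [[hg gn] _]]] := extZ.
  by have [g0 [_ hg0 g0F]] := local f F g fFh hg gn; exists g0.
have ws : rnorm (r w - r w') < s by rewrite rdistC /s; lra.
split; first exact: ball_hull.
exists [set v | V v /\ rnorm (r v - r w) < s - rnorm (r w - r w')].
  by apply: chart_preimage_ball => //; rewrite subr_gt0.
move=> f G g fG hg gn v [Vv vw].
have [g0 [gg0 hg0 [t t0 g0G]]] := local f G g fG hg gn.
rewrite gg0//; apply: (ball_identity t0 hg0 _ g0G).
  by move=> x /ball_hull hx; apply: fG.1.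
by have := ler_rdistD (r w) (r v) (r w'); lra.
Qed.

(** The agreement set is open and closed, so the indicator function of its
    complement is holomorphic; it vanishes on the image of [U], hence on [Z], as
    0 has only one extension. *)
Lemma agreement_setT w : agreement_set w.
Proof.
pose chi v : C R := if pselect (agreement_set v) then 0 else 1.
have hchi : holomorphic r chi.
  move=> V cV; have [oV iV _ _] := cV.
  pose g x : C R := if pselect (exists v, [/\ V v, agreement_set v & r v = x]) then 0 else 1.
  have gchi v : V v -> chi v = g (r v).
    move=> Vv; rewrite /chi /g; case: pselect => av; case: pselect => // ex.
      by exfalso; apply: ex; exists v.
    move: ex => [v' [Vv' av' vv']]; exfalso; apply: av.
    by rewrite -(iV v' v _ _ vv') ?inE.
  exists g => // v Vv.
  have [N vN Nc] : exists2 N, nbhs v N & forall v', N v' -> chi v' = chi v.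
    rewrite /chi; case: pselect => av.
      exists agreement_set; first exact: agreement_set_open.
      by move=> v' av'; case: pselect.
    have [B vB Bn] : exists2 B, nbhs v B & forall v', B v' -> ~ agreement_set v'.
      apply: contrapT => H; apply: av; apply: agreement_set_closed => B vB.
      apply: contrapT => H'; apply: H; exists B => // v' Bv' av'.
      by apply: H'; exists v'.
    by exists B => // v' /Bn nav'; case: pselect.
  have [d d0 Hd] := chart_image_ball cV Vv vN.
  apply: (@diff_local _ _ (fun=> chi v) g (r v) d d0 _ _).1.
    by move=> x /Hd[v' [Vv' Nv' <-]]; rewrite -gchi// Nc.
  exact: differentiable_cst.
have [_ _ /(_ 0)[g [_ gu]]] := extZ.
have E1 : g = chi.
  apply: gu; split=> //; apply/funext => u; rewrite /= /chi.
  by case: pselect => //; case; exact: agreement_set_image.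
have E2 : g = fun=> 0.
  by apply: gu; split; [exact: holomorphic_cst|apply/funext].
have : chi w = 0 by rewrite -E1 E2.
by rewrite /chi; case: pselect => // _ /eqP; rewrite oner_eq0.
Qed.

Lemma extension_factors : exists m : Z -> domain_hull U,
  morphism r set_val m /\ m \o n = hull_inclusion oU.
Proof.
pose m w : domain_hull U := SigSub (mem_set (agreement_setT w).1).
exists m; split; last by apply/funext => u; apply: val_inj; rewrite /= -[RHS]rn.
split; last by apply/funext.
move=> w B [W [[Q oQ <-] Qw QB]].
have : nbhs w (r @^-1` Q) by apply: continuous_r; exact: open_nbhs_nbhs.
by move=> wQ; apply: (@filterS Z (nbhs w) _ _ _ _ wQ) => v Qv; exact: QB.
Qed.

End Envelope.

(** * The hull as envelope of holomorphy *)

Theorem theorem2p2 (R : realType) (E : completeNormedModType R[i]) (U : set E)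
    (oU : open U) (balU : balanced U) :
  [/\ Hb_envelope (set_val : domain_hull U -> E) (hull_inclusion oU),
      forall f : Hb U, exists g : domain_hull U -> C R,
        [/\ holomorphic (set_val : domain_hull U -> E) g,
            g \o hull_inclusion oU = f &
            forall A : set E, Ubounded U A ->
              [bounded g x | x in set_val @^-1` poly_hull A]] &
      forall A : set E, Ubounded U A -> forall z : E, poly_hull A z ->
        exists delta : Hb U -> C R,
          unique (is_delta z) delta /\ prec delta A].
Proof.
split.
- split; first exact: hull_Hb_extension.
  by move=> Z r n; exact: extension_factors.
- exact: bounded_extension_to_hull.
- by move=> A UA z; exact: unique_delta.
Qed.
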